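(* The Vietoris–Rips metric thickening $\mathrm{VR}^m(S^1;r)$ is homotopy equivalent to $S^1$ for $0\le r<\frac{2\pi}{3}$, and $\mathrm{VR}^m(S^1;\frac{2\pi}{3})$ is homotopy equivalent to $S^3$.
   Context: The circle $S^1$ carries the geodesic metric of total circumference $2\pi$. For a metric space $X$ and $r\ge 0$, the Vietoris–Rips metric thickening is the set $$\mathrm{VR}^m(X;r)=\Bigl\{\sum_{i=0}^k\lambda_i\delta_{x_i} : k\in\mathbb{N},\ x_i\in X,\ \mathrm{diam}(\{x_0,\dots,x_k\})\le r,\ \lambda_i\ge 0,\ \sum_i\lambda_i=1\Bigr\}$$ of finitely supported probability measures on $X$ ($\delta_x$ is the Dirac mass at $x$), equipped with the $1$-Wasserstein metric: the distance between $\sum_i\lambda_i\delta_{x_i}$ and $\sum_j\lambda'_j\delta_{x'_j}$ is the infimum of $\sum_{i,j}p_{i,j}d(x_i,x'_j)$ over all non-negative $(p_{i,j})$ with $\sum_j p_{i,j}=\lambda_i$ and $\sum_i p_{i,j}=\lambda'_j$. (The superscript $m$ stands for ''metric'' and is not a numerical parameter.) *)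

(* Defs.v *)
From HB Require Import structures.
From mathcomp Require Import all_boot all_order all_algebra finmap.
From mathcomp Require Import all_classical all_reals all_analysis.
From mathcomp Require Import ring lra.

Set Implicit Arguments.
Unset Strict Implicit.
Unset Printing Implicit Defensive.

Import Order.TTheory GRing.Theory Num.Theory.
Import numFieldNormedType.Exports.

Local Open Scope classical_set_scope.
Local Open Scope ring_scope.

Section HomotopyEquivalence.
Variable R : realType.

(* The homotopy is a function on [R * X] of which only the restriction to
   [0, 1] * X, with its subspace topology, matters. *)
Definition homotopic (X Y : topologicalType) (f g : X -> Y) :=
  exists H : R * X -> Y,
    [/\ {within `[0, 1] `*` [set: X], continuous H},
        forall x, H (0, x) = f x & forall x, H (1, x) = g x].

Definition homotopy_equivalent (X Y : topologicalType) :=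
  exists (f : X -> Y) (g : Y -> X),
    [/\ continuous f, continuous g,
        homotopic (g \o f) id & homotopic (f \o g) id].

End HomotopyEquivalence.

Arguments homotopy_equivalent : clear implicits.

Section Wasserstein.
Variables (R : realType) (X : metricType R).
Implicit Types (mu nu rho : {fsfun X -> R with 0}) (p q : X -> X -> R).

(* A finitely supported measure on [X] is encoded by its point masses
   [mu x = mu {x}]; its support is [finsupp mu]. *)
Definition finitely_supported_probability mu :=
  (forall x, 0 <= mu x) /\ \sum_(x <- finsupp mu) mu x = 1.

(* Only the values of [p] on [finsupp mu * finsupp nu] matter: they are the
   entries of a transport matrix from [mu] to [nu]. *)
Definition coupling mu nu : set (X -> X -> R) :=
  [set p | [/\ forall x y, 0 <= p x y,
    forall x, x \in finsupp mu -> \sum_(y <- finsupp nu) p x y = mu x &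
    forall y, y \in finsupp nu -> \sum_(x <- finsupp mu) p x y = nu y]].

Definition transport_cost mu nu p : R :=
  \sum_(x <- finsupp mu) \sum_(y <- finsupp nu) p x y * mdist x y.

Definition wasserstein mu nu : R :=
  inf [set transport_cost mu nu p | p in coupling mu nu].

Lemma transport_cost_ge0 mu nu p : coupling mu nu p ->
  0 <= transport_cost mu nu p.
Proof.
case=> p0 _ _; apply: sumr_ge0 => x _; apply: sumr_ge0 => y _.
by rewrite mulr_ge0// mdist_ge0.
Qed.

Lemma wasserstein_le_cost mu nu p : coupling mu nu p ->
  wasserstein mu nu <= transport_cost mu nu p.
Proof.
move=> cp; apply: ge_inf; last by exists p.
by exists 0 => _ [q cq <-]; exact: transport_cost_ge0.
Qed.

Lemma coupling_prod mu nu :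
  finitely_supported_probability mu -> finitely_supported_probability nu ->
  coupling mu nu (fun x y => mu x * nu y).
Proof.
move=> [mu0 mu1] [nu0 nu1]; split => [x y|x _|y _].
- exact: mulr_ge0.
- by rewrite -mulr_sumr nu1 mulr1.
- by rewrite -mulr_suml mu1 mul1r.
Qed.

Lemma le_wasserstein mu nu c :
  finitely_supported_probability mu -> finitely_supported_probability nu ->
  (forall p, coupling mu nu p -> c <= transport_cost mu nu p) ->
  c <= wasserstein mu nu.
Proof.
move=> Pmu Pnu H; apply: lb_le_inf => [|_ [p cp <-]]; last exact: H.
by eexists; exists (fun x y => mu x * nu y); [exact: coupling_prod|reflexivity].
Qed.

Lemma wasserstein_ge0 mu nu :
  finitely_supported_probability mu -> finitely_supported_probability nu ->
  0 <= wasserstein mu nu.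
Proof. by move=> Pmu Pnu; apply: le_wasserstein => // p /transport_cost_ge0. Qed.

Lemma wassersteinxx mu : finitely_supported_probability mu ->
  wasserstein mu mu = 0.
Proof.
move=> Pmu; have [mu0 _] := Pmu.
have sum_eq (S : {fset X}) x : x \in S ->
    \sum_(y <- S) (if x == y then mu x else 0) = mu x.
  move=> xS; rewrite (big_fsetD1 _ xS)/= eqxx big_seq big1 ?addr0// => y.
  by rewrite in_fsetD1 eq_sym => /andP[/negPf -> _].
have cp : coupling mu mu (fun x y => if x == y then mu x else 0).
  split=> [x y|x xS|y yS]; first by case: ifP.
  - exact: sum_eq.
  - rewrite -[RHS](sum_eq _ _ yS); apply: eq_bigr => x _.
    by rewrite eq_sym; case: eqP => [->|].
apply/eqP; rewrite eq_le wasserstein_ge0// andbT.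
apply: (le_trans (wasserstein_le_cost cp)); rewrite /transport_cost.
rewrite big1// => x _; rewrite big1// => y _.
by case: eqP => [->|]; rewrite ?mdistxx ?mulr0 ?mul0r.
Qed.

Lemma wasserstein_le_sym mu nu :
  finitely_supported_probability mu -> finitely_supported_probability nu ->
  wasserstein mu nu <= wasserstein nu mu.
Proof.
move=> Pmu Pnu; apply: le_wasserstein => // p [p0 p1 p2].
have cp : coupling mu nu (fun x y => p y x) by split=> [x y|x|y]; [|exact: p2|exact: p1].
apply: (le_trans (wasserstein_le_cost cp)).
rewrite /transport_cost exchange_big/=; apply: ler_sum => x _.
by apply: ler_sum => y _; rewrite metric_sym.
Qed.

Lemma wasserstein_sym mu nu :
  finitely_supported_probability mu -> finitely_supported_probability nu ->
  wasserstein mu nu = wasserstein nu mu.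
Proof.
by move=> Pmu Pnu; apply/eqP; rewrite eq_le !wasserstein_le_sym.
Qed.

Lemma wasserstein_triangle mu nu rho :
  finitely_supported_probability mu -> finitely_supported_probability nu ->
  finitely_supported_probability rho ->
  wasserstein mu rho <= wasserstein mu nu + wasserstein nu rho.
Proof.
move=> Pmu Pnu Prho; rewrite -lerBlDr; apply: le_wasserstein => // p cp.
rewrite lerBlDr -lerBlDl; apply: le_wasserstein => // q cq; rewrite lerBlDl.
have [p0 p1 p2] := cp; have [q0 q1 q2] := cq; have [nu0 _] := Pnu.
have nuN0 y : y \in finsupp nu -> nu y != 0 by rewrite mem_finsupp.
pose g x z := \sum_(y <- finsupp nu) p x y * q y z / nu y.
have cg : coupling mu rho g.
  split=> [x z|x xmu|z zrho].
  - by apply: sumr_ge0 => y _; rewrite divr_ge0// mulr_ge0.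
  - rewrite exchange_big/= -[RHS](p1 x xmu); apply: eq_big_seq => y ynu.
    by rewrite -mulr_suml -mulr_sumr q1// mulfK// nuN0.
  - rewrite exchange_big/= -[RHS](q2 z zrho); apply: eq_big_seq => y ynu.
    by rewrite -mulr_suml -mulr_suml p2// [nu y * _]mulrC mulfK// nuN0.
apply: (le_trans (wasserstein_le_cost cg)).
have -> : transport_cost mu nu p =
    \sum_(x <- finsupp mu) \sum_(y <- finsupp nu) \sum_(z <- finsupp rho)
      p x y * q y z / nu y * mdist x y.
  apply: eq_bigr => x _; apply: eq_big_seq => y ynu.
  by rewrite -mulr_suml -mulr_suml -mulr_sumr q1// mulfK// nuN0.
have -> : transport_cost nu rho q =
    \sum_(x <- finsupp mu) \sum_(y <- finsupp nu) \sum_(z <- finsupp rho)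
      p x y * q y z / nu y * mdist y z.
  rewrite [RHS]exchange_big/=; apply: eq_big_seq => y ynu.
  rewrite exchange_big/=; apply: eq_bigr => z _.
  by rewrite -mulr_suml -mulr_suml -mulr_suml p2// [nu y * _]mulrC mulfK// nuN0.
rewrite -big_split/=; apply: ler_sum => x _.
rewrite -big_split/=.
under eq_bigr do rewrite /g mulr_suml.
rewrite [leLHS]exchange_big/=; apply: ler_sum => y _.
rewrite -big_split/=; apply: ler_sum => z _.
rewrite -mulrDr; apply: ler_wpM2l; last exact: metric_triangle.
by rewrite divr_ge0// mulr_ge0.
Qed.

Let separation (S : {fset X}) z :
  exists2 d : R, 0 < d & forall y, y \in S -> y != z -> d <= mdist z y.
Proof.
elim/fset1U_rect: S => [|y S _ [d d0 dP]]; first by exists 1.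
have [->|yz] := eqVneq y z.
  by exists d => // y'; rewrite in_fset1U => /orP[/eqP ->|/dP//]; rewrite eqxx.
exists (Num.min d (mdist z y)).
  by rewrite lt_min d0 mdist_gt0 eq_sym.
move=> y'; rewrite in_fset1U => /orP[/eqP -> _|/dP y'S /y'S dle].
  by rewrite ge_min lexx orbT.
by rewrite ge_min dle.
Qed.

Lemma wasserstein0_le mu nu z :
  finitely_supported_probability mu -> finitely_supported_probability nu ->
  wasserstein mu nu = 0 -> mu z <= nu z.
Proof.
move=> Pmu Pnu W0; have [mu0 _] := Pmu; have [nu0 _] := Pnu.
have [zmu|] := boolP (z \in finsupp mu); last first.
  by rewrite memNfinsupp => /eqP ->.
have [d d0 dP] := separation (finsupp nu) z.
suff : d * (mu z - nu z) <= wasserstein mu nu.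
  by rewrite W0 pmulr_rle0// subr_le0.
apply: le_wasserstein => // p [p0 p1 p2].
have row_le x : x \in finsupp mu -> forall y, y \in finsupp nu -> p x y <= nu y.
  move=> xmu y ynu; rewrite -(p2 y ynu) (big_fsetD1 x)//= lerDl.
  exact: sumr_ge0.
have : d * (mu z - nu z) <= \sum_(y <- finsupp nu) p z y * mdist z y.
  have [znu|] := boolP (z \in finsupp nu).
    rewrite -(p1 z zmu) (big_fsetD1 z znu)/= (big_fsetD1 z znu)/= mdistxx mulr0 add0r.
    rewrite (@le_trans _ _ (d * \sum_(y <- (finsupp nu `\ z)%fset) p z y))//.
      rewrite ler_pM2l// lerBlDl lerD2r; exact: row_le.
    rewrite mulr_sumr big_seq [leRHS]big_seq; apply: ler_sum => y.
    rewrite in_fsetD1 => /andP[yz ynu].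
    by rewrite mulrC ler_wpM2l// dP.
  move=> znu; rewrite (eqP (_ : nu z == 0)); last by rewrite -memNfinsupp.
  rewrite subr0 -(p1 z zmu) mulr_sumr big_seq [leRHS]big_seq; apply: ler_sum => y ynu.
  rewrite mulrC ler_wpM2l// dP//.
  by apply: contraNneq znu => <-.
move=> /le_trans; apply; rewrite /transport_cost (big_fsetD1 z zmu)/= lerDl.
by apply: sumr_ge0 => x _; apply: sumr_ge0 => y _; rewrite mulr_ge0// mdist_ge0.
Qed.

Lemma wasserstein_positivity mu nu :
  finitely_supported_probability mu -> finitely_supported_probability nu ->
  wasserstein mu nu = 0 -> mu = nu.
Proof.
move=> Pmu Pnu W0; apply/fsfunP => z; apply/eqP; rewrite eq_le.
by rewrite !wasserstein0_le// wasserstein_sym.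
Qed.

Section DiracCombination.
Variables (mu : {fsfun X -> R with 0}) (I : finType) (x : I -> X) (l : I -> R).
Hypotheses (l0 : forall i, 0 <= l i)
  (muE : forall z, mu z = \sum_i l i * (x i == z)%:R).

Lemma dirac_combination_eq0 i : x i \notin finsupp mu -> l i = 0.
Proof.
rewrite memNfinsupp muE => /eqP s0; apply/eqP.
have /eqP : l i * (x i == x i)%:R = 0.
  have := @psumr_eq0P _ _ xpredT (fun j => l j * (x j == x i)%:R) _ s0 i.
  by apply=> // j _; rewrite mulr_ge0.
by rewrite eqxx mulr1.
Qed.

Lemma sum_finsupp_eq (c : R) i : (x i \notin finsupp mu -> c = 0) ->
  \sum_(z <- finsupp mu) c * (x i == z)%:R = c.
Proof.
move=> c0; have [xi|/c0 ->] := boolP (x i \in finsupp mu); last first.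
  by rewrite big1// => z _; rewrite mul0r.
rewrite (big_fsetD1 _ xi)/= eqxx big_seq big1 ?addr0 ?mulr1// => z.
by rewrite in_fsetD1 eq_sym => /andP[/negPf -> _]; rewrite mulr0.
Qed.

Lemma dirac_combination_integral (F : X -> R) :
  \sum_i l i * F (x i) = \sum_(z <- finsupp mu) mu z * F z.
Proof.
under [RHS]eq_bigr do rewrite muE mulr_suml.
rewrite exchange_big/=; apply: eq_bigr => i _.
rewrite -[LHS](@sum_finsupp_eq _ i) => [|/dirac_combination_eq0 ->]; last first.
  by rewrite mul0r.
by apply: eq_bigr => z _; case: eqP => [->|]; rewrite ?mulr1// ?mulr0 ?mul0r.
Qed.

Lemma dirac_combination_probability : \sum_i l i = 1 ->
  finitely_supported_probability mu.
Proof.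
move=> l1; split=> [z|].
  by rewrite muE; apply: sumr_ge0 => i _; rewrite mulr_ge0.
have := dirac_combination_integral (fun=> 1).
by under eq_bigr do rewrite mulr1; under [RHS]eq_bigr do rewrite mulr1; rewrite l1.
Qed.

End DiracCombination.

(* [wasserstein] may be computed from arbitrary presentations of its arguments
   as convex combinations of Dirac measures, possibly with repeated points or
   zero weights. *)
Lemma wasserstein_dirac_combination mu nu (I J : finType) (x : I -> X)
    (y : J -> X) (l : I -> R) (l' : J -> R) :
  (forall i, 0 <= l i) -> \sum_i l i = 1 ->
  (forall z, mu z = \sum_i l i * (x i == z)%:R) ->
  (forall j, 0 <= l' j) -> \sum_j l' j = 1 ->
  (forall z, nu z = \sum_j l' j * (y j == z)%:R) ->
  wasserstein mu nu =
  inf [set \sum_i \sum_j P i j * mdist (x i) (y j) | P in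
        [set P : I -> J -> R | [/\ forall i j, 0 <= P i j,
           forall i, \sum_j P i j = l i & forall j, \sum_i P i j = l' j]]].
Proof.
move=> l0 l1 muE l'0 l'1 nuE.
have Pmu := dirac_combination_probability l0 muE l1.
have Pnu := dirac_combination_probability l'0 nuE l'1.
apply/eqP; rewrite eq_le; apply/andP; split.
- apply: lb_le_inf.
    eexists; exists (fun i j => l i * l' j); last reflexivity.
    split=> [i j|i|j]; first exact: mulr_ge0.
    + by rewrite -mulr_sumr l'1 mulr1.
    + by rewrite -mulr_suml l1 mul1r.
  move=> _ [P [P0 Pr Pc] <-].
  have Pi0 i j : x i \notin finsupp mu -> P i j = 0.
    move=> /(dirac_combination_eq0 l0 muE); rewrite -Pr => s0.
    exact: (psumr_eq0P (fun j _ => P0 i j) s0).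
  have Pj0 i j : y j \notin finsupp nu -> P i j = 0.
    move=> /(dirac_combination_eq0 l'0 nuE); rewrite -Pc => s0.
    exact: (psumr_eq0P (fun i _ => P0 i j) s0).
  pose p a b := \sum_i \sum_j P i j * (x i == a)%:R * (y j == b)%:R.
  have cp : coupling mu nu p.
    split=> [a b|a _|b _].
    + by do 2 (apply: sumr_ge0 => ? _); rewrite !mulr_ge0.
    + rewrite exchange_big muE/=; apply: eq_bigr => i _.
      rewrite exchange_big -Pr mulr_suml/=; apply: eq_bigr => j _.
      by rewrite sum_finsupp_eq// => /Pj0 ->; rewrite mul0r.
    + rewrite exchange_big/=; under eq_bigr do rewrite exchange_big/=.
      rewrite exchange_big nuE/=; apply: eq_bigr => j _.
      rewrite -Pc mulr_suml; apply: eq_bigr => i _.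
      by rewrite -mulr_suml sum_finsupp_eq// => /Pi0 ->.
  apply: (le_trans (wasserstein_le_cost cp)); rewrite le_eqVlt; apply/orP; left.
  apply/eqP; rewrite /transport_cost /p.
  transitivity (\sum_(a <- finsupp mu) \sum_(b <- finsupp nu) \sum_i \sum_j
     P i j * mdist (x i) (y j) * (x i == a)%:R * (y j == b)%:R).
    apply: eq_bigr => a _; apply: eq_bigr => b _.
    rewrite mulr_suml; apply: eq_bigr => i _.
    rewrite mulr_suml; apply: eq_bigr => j _.
    case: eqP => [->|]; last by rewrite !(mulr0, mul0r).
    by case: eqP => [->|]; rewrite !(mulr0, mul0r, mulr1).
  under eq_bigr do rewrite exchange_big/=.
  rewrite exchange_big/=; apply: eq_bigr => i _.
  under eq_bigr do rewrite exchange_big/=.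
  rewrite exchange_big/=; apply: eq_bigr => j _.
  under eq_bigr => a _.
    rewrite sum_finsupp_eq; last by move=> /Pj0 ->; rewrite !mul0r.
    over.
  by rewrite sum_finsupp_eq// => /Pi0 ->; rewrite mul0r.
- apply: le_wasserstein => // p [p0 pr pc].
  have nuN0 b : b \in finsupp nu -> nu b != 0 by rewrite mem_finsupp.
  have muN0 a : a \in finsupp mu -> mu a != 0 by rewrite mem_finsupp.
  have [mu0 _] := Pmu; have [nu0 _] := Pnu.
  pose P i j := l i * (l' j * (p (x i) (y j) / (mu (x i) * nu (y j)))).
  apply: ge_inf.
    exists 0 => _ [Q [Q0 _ _] <-]; do 2 (apply: sumr_ge0 => ? _).
    by rewrite mulr_ge0// mdist_ge0.
  exists P.
    split=> [i j|i|j].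
    + by rewrite !mulr_ge0// invr_ge0 mulr_ge0.
    + rewrite -mulr_sumr.
      rewrite (dirac_combination_integral l'0 nuE
        (fun b => p (x i) b / (mu (x i) * nu b))).
      have [xi|/(dirac_combination_eq0 l0 muE) ->] := boolP (x i \in finsupp mu);
        last by rewrite mul0r.
      rewrite (eq_big_seq (fun b => p (x i) b / mu (x i))) => [|b bnu].
        by rewrite -mulr_suml pr// mulfV ?mulr1// muN0.
      by field; rewrite nuN0// muN0.
    + rewrite (dirac_combination_integral l0 muE
        (fun a => l' j * (p a (y j) / (mu a * nu (y j))))).
      have [yj|/(dirac_combination_eq0 l'0 nuE) ->] := boolP (y j \in finsupp nu);
        last by rewrite big1// => a _; rewrite mul0r mulr0.
      rewrite (eq_big_seq (fun a => p a (y j) * (l' j / nu (y j)))) => [|a amu].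
        by rewrite -mulr_suml pc// mulrCA mulfV ?mulr1// nuN0.
      by field; rewrite nuN0// muN0.
  rewrite /transport_cost /P.
  under eq_bigr => i _.
    under eq_bigr do rewrite -!mulrA.
    rewrite -mulr_sumr (dirac_combination_integral l'0 nuE
      (fun b => p (x i) b * ((mu (x i) * nu b)^-1 * mdist (x i) b))).
    over.
  rewrite (dirac_combination_integral l0 muE (fun a => \sum_(b <- finsupp nu)
    nu b * (p a b * ((mu a * nu b)^-1 * mdist a b)))).
  apply: eq_big_seq => a amu; rewrite mulr_sumr; apply: eq_big_seq => b bnu.
  by field; rewrite nuN0// muN0.
Qed.

End Wasserstein.

Section VietorisRipsMetricThickening.
Variables (R : realType) (X : metricType R) (r : R).

(* The condition [forall i j, mdist (x i) (x j) <= r] says that the finite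
   nonempty set {x_0, ..., x_k} has diameter at most [r]; [(x i == z)%:R] is
   the point mass at [z] of the Dirac measure at [x i].  The points [x i] need
   not be distinct. *)
Definition VR_measures : set {fsfun X -> R with 0} :=
  [set mu | exists (k : nat) (x : 'I_k.+1 -> X) (lambda : 'I_k.+1 -> R),
    [/\ forall i j, mdist (x i) (x j) <= r,
        forall i, 0 <= lambda i,
        \sum_i lambda i = 1 &
        forall z, mu z = \sum_i lambda i * (x i == z)%:R]].

Lemma VR_measures_probability mu : VR_measures mu ->
  finitely_supported_probability mu.
Proof.
by move=> [k [x [l [_ l0 l1 muE]]]]; exact: dirac_combination_probability muE l1.
Qed.

Definition VRm : Type := set_type VR_measures.

HB.instance Definition _ := Choice.on VRm.

Definition VRm_dist (mu nu : VRm) : R := wasserstein (val mu) (val nu).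

Let VRm_prob (mu : VRm) : finitely_supported_probability (val mu).
Proof. exact: VR_measures_probability (set_valP mu). Qed.

Let VRm_distxx mu : VRm_dist mu mu = 0.
Proof. exact: wassersteinxx. Qed.

Let VRm_dist_positivity mu nu : VRm_dist mu nu = 0 -> mu = nu.
Proof. by move=> /wasserstein_positivity H; apply: val_inj; exact: H. Qed.

Let VRm_dist_sym mu nu : VRm_dist mu nu = VRm_dist nu mu.
Proof. exact: wasserstein_sym. Qed.

Let VRm_dist_triangle nu mu rho :
  VRm_dist mu rho <= VRm_dist mu nu + VRm_dist nu rho.
Proof. exact: wasserstein_triangle. Qed.

HB.instance Definition _ := isMetric.Build R VRm
  VRm_distxx VRm_dist_positivity VRm_dist_sym VRm_dist_triangle.

End VietorisRipsMetricThickening.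

Section Spheres.
Variable R : realType.

Definition sphere n : set 'rV[R]_n.+1 :=
  [set u | \sum_i u ord0 i ^+ 2 = 1].
Arguments sphere : clear implicits.

Definition circle : Type := set_type (sphere 1).

HB.instance Definition _ := Choice.on circle.

(* The length of the shorter arc between two points of the unit circle is the
   angle between them, that is, the arc cosine of their inner product. *)
Definition circle_dist (u v : circle) : R :=
  acos (\sum_i val u ord0 i * val v ord0 i).

Let sum2 (F : 'I_2 -> R) : \sum_i F i = F ord0 + F (lift ord0 ord0).
Proof. by rewrite !big_ord_recl big_ord0 addr0. Qed.

Let circleP (u : circle) :
  val u ord0 ord0 ^+ 2 + val u ord0 (lift ord0 ord0) ^+ 2 = 1.
Proof. by have := set_valP u; rewrite /sphere/= sum2. Qed.

Let circle_inner_itv (u v : circle) :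
  -1 <= \sum_i val u ord0 i * val v ord0 i <= 1.
Proof.
rewrite sum2; have := circleP u; have := circleP v.
move: (val u _ _) (val u _ _) (val v _ _) (val v _ _) => a b c d h1 h2.
have := sqr_ge0 (a - c); have := sqr_ge0 (b - d).
have := sqr_ge0 (a + c); have := sqr_ge0 (b + d).
rewrite !sqrrD !sqrrN => *; apply/andP; split; lra.
Qed.

Let circle_dist_sym u v : circle_dist u v = circle_dist v u.
Proof. by congr acos; apply: eq_bigr => i _; rewrite mulrC. Qed.

Let circle_distxx u : circle_dist u u = 0.
Proof. by rewrite /circle_dist sum2 -!expr2 circleP acos1. Qed.

Let circle_dist_positivity u v : circle_dist u v = 0 -> u = v.
Proof.
rewrite /circle_dist => /(congr1 cos).
rewrite cos0 acosK; last first.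
  by rewrite in_itv/= circle_inner_itv.
rewrite sum2.
have := circleP u; have := circleP v; move=> hv hu h.
have h0 : (val u ord0 ord0 - val v ord0 ord0) ^+ 2 +
  (val u ord0 (lift ord0 ord0) - val v ord0 (lift ord0 ord0)) ^+ 2 = 0 by nra.
move/eqP: h0; rewrite paddr_eq0 ?sqr_ge0// !sqrf_eq0 !subr_eq0 => /andP[/eqP e0 /eqP e1].
apply: val_inj; apply/rowP => i.
case: (unliftP ord0 i) => [j ->|->]; last exact: e0.
by rewrite (ord1 j); exact: e1.
Qed.

Let circle_dist_triangle v u w :
  circle_dist u w <= circle_dist u v + circle_dist v w.
Proof.
have [uv0 uvp] := andP (acos_def (circle_inner_itv u v)).1.
have [vw0 vwp] := andP (acos_def (circle_inner_itv v w)).1.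
have [uw0 uwp] := andP (acos_def (circle_inner_itv u w)).1.
have [_ cuv] := acos_def (circle_inner_itv u v).
have [_ cvw] := acos_def (circle_inner_itv v w).
have [_ cuw] := acos_def (circle_inner_itv u w).
rewrite -!/(circle_dist _ _) in uv0 uvp vw0 vwp uw0 uwp cuv cvw cuw *.
have [le_pi|/ltW] := leP (circle_dist u v + circle_dist v w) pi; last first.
  exact: le_trans.
rewrite leNgt -ltr_cos -?leNgt; last 2 first.
- by rewrite in_itv/= ?uw0 ?uwp ?le_pi ?addr_ge0.
- by rewrite in_itv/= ?uw0 ?uwp ?le_pi ?addr_ge0.
rewrite cosD cuv cvw cuw !sum2.
have suv0 := sin_ge0_pi (introT andP (conj uv0 uvp)).
have svw0 := sin_ge0_pi (introT andP (conj vw0 vwp)).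
have := sin2cos2 (circle_dist u v); have := sin2cos2 (circle_dist v w).
rewrite cuv cvw !sum2.
have := circleP u; have := circleP v; have := circleP w.
move: (val u ord0 ord0) (val u ord0 (lift ord0 ord0)).
move: (val v ord0 ord0) (val v ord0 (lift ord0 ord0)).
move: (val w ord0 ord0) (val w ord0 (lift ord0 ord0)).
move: (sin (circle_dist u v)) (sin (circle_dist v w)) suv0 svw0 => s t s0 t0 e f c d a b hw hv hu ht hs.
have s2 : s ^+ 2 = (a * d - b * c) ^+ 2 by rewrite hs; nra.
have t2 : t ^+ 2 = (c * f - d * e) ^+ 2 by rewrite ht; nra.
have sE : s = `|a * d - b * c| by apply/eqP; rewrite -(@eqrXn2 _ 2)// ?s2 ?real_normK ?num_real.
have tE : t = `|c * f - d * e| by apply/eqP; rewrite -(@eqrXn2 _ 2)// ?t2 ?real_normK ?num_real.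
have stE : s * t = `|(a * d - b * c) * (c * f - d * e)| by rewrite normrM -sE -tE.
have -> : a * e + b * f = (a * c + b * d) * (c * e + d * f) +
    (a * d - b * c) * (d * e - c * f).
  rewrite -[LHS]mulr1 -hv; ring.
rewrite lerD2l stE lerNl; apply: (le_trans _ (ler_norm _)).
by rewrite -mulrN opprB.
Qed.

HB.instance Definition _ := isMetric.Build R circle
  circle_distxx circle_dist_positivity circle_dist_sym circle_dist_triangle.

End Spheres.

Arguments sphere : clear implicits.

(* Main.v *)
(* Weak convergence implies convergence in the Wasserstein distance near a
   finitely supported measure on a bounded space, so a map into the thickening is
   continuous as soon as the integrals of continuous functions are.

   A finite set of points of the circle at mutual distances at most 2pi/3 either
   contains an equilateral triangle or lies in an arc of length at most 2pi/3.
   For r < 2pi/3 only the second case occurs, the barycentre of a measure is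
   nonzero, and sliding all the mass to its direction c retracts the thickening
   onto the Dirac masses; c lies in the same arc, so the diameter bound persists.

   For r = 2pi/3 consider the mean of the cubes x^3.  Its norm is 1 when the
   measure sits on a triangle, and a measure of norm less than 1 lies in an arc.
   Where the norm is large, drop the points whose cube is far from the direction
   u of this mean and move the others to the nearest cube root of u, which does
   not increase diameters beyond 2pi/3; as the norm decreases, transfer the mass
   to the direction of the new barycentre.  At the end of this homotopy the
   measure only depends on its barycentre, on u, and on the fraction not yet
   transferred, that is, on a point of the join S^1 * S^1 = S^3.  Conversely, each
   point of S^3 gives such a measure, and the resulting self-map of S^3 never
   sends a point to its antipode, hence is homotopic to the identity. *)

Require Import Defs.
From mathcomp Require Import all_boot all_order all_algebra finmap.
From mathcomp Require Import all_classical all_reals all_analysis.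
From mathcomp Require Import ring lra.

Set Implicit Arguments.
Unset Strict Implicit.
Unset Printing Implicit Defensive.

Import Order.TTheory GRing.Theory Num.Theory.
Import numFieldNormedType.Exports.

Local Open Scope classical_set_scope.
Local Open Scope ring_scope.

(** Measures are accessed through their integrals [expect]: equality is tested on all functions,
    continuity on continuous functions bounded by 1. The obstacle at scale 2pi/3 is that the nearest
    cube root of [u] jumps and that directions are undefined at the origin. Each such choice is
    therefore multiplied by a weight that vanishes where the choice breaks down: points get their
    new weight before they start moving, and the transfer to the barycentre is switched off before
    the norm of the mean cube reaches 1 and complete before it reaches 0. Moves have angle below
    pi/6. Added to the half-width pi/3 of an arc, this keeps the measure in an open half-circle, so
    no triangle can appear there and the new barycentre is nonzero. In the end the mass not
    transferred sits on three cube roots, and a measure on a triangle is determined by its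
    barycentre [b], with weight [(1 + 2 <b, w>) / 3] at the vertex [w]; this is why the composite
    through S^3 equals the end of the homotopy. *)

Section Expectation.
Variables (R : realType) (X : metricType R).
Implicit Types (mu nu : {fsfun X -> R with 0}) (F G : X -> R) (s : seq (R * X)).

Definition expect mu F : R := \sum_(x <- finsupp mu) mu x * F x.

Lemma expect_fsubset mu F (S : {fset X}) : (finsupp mu `<=` S)%fset ->
  expect mu F = \sum_(x <- S) mu x * F x.
Proof.
move=> sub; apply: big_fset_incl => // x _.
by rewrite memNfinsupp => /eqP ->; rewrite mul0r.
Qed.

Lemma eq_expect mu F G : {in finsupp mu, F =1 G} -> expect mu F = expect mu G.
Proof. by move=> FG; apply: eq_big_seq => x xmu; rewrite FG. Qed.

Lemma expect_eq1 mu z : expect mu (fun x => (x == z)%:R) = mu z.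
Proof.
have [zmu|] := boolP (z \in finsupp mu); last first.
  rewrite memNfinsupp => /eqP mz; rewrite mz /expect big1// => x _.
  by case: eqP => [->|]; rewrite ?mz ?mul0r ?mulr0.
rewrite /expect (big_fsetD1 _ zmu)/= eqxx mulr1 big_seq big1 ?addr0// => x.
by rewrite in_fsetD1 => /andP[/negPf -> _]; rewrite mulr0.
Qed.

Lemma expect_ext mu nu : expect mu =1 expect nu -> mu = nu.
Proof. by move=> h; apply/fsfunP => z; rewrite -!expect_eq1 h. Qed.

Lemma expectD mu F G :
  expect mu (fun x => F x + G x) = expect mu F + expect mu G.
Proof. by rewrite /expect -big_split; apply: eq_bigr => x _; rewrite mulrDr. Qed.

Lemma expectZ mu (a : R) F : expect mu (fun x => a * F x) = a * expect mu F.
Proof. by rewrite /expect mulr_sumr; apply: eq_bigr => x _; rewrite mulrCA. Qed.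

Lemma expect_cst mu (a : R) : finitely_supported_probability mu ->
  expect mu (fun=> a) = a.
Proof. by move=> [_ mu1]; rewrite /expect -mulr_suml mu1 mul1r. Qed.

Lemma le_expect mu F G : (forall x, 0 <= mu x) ->
  (forall x, x \in finsupp mu -> F x <= G x) -> expect mu F <= expect mu G.
Proof.
move=> mu0 FG; rewrite /expect big_seq [leRHS]big_seq; apply: ler_sum => x xmu.
by rewrite ler_wpM2l// FG.
Qed.

Lemma prob_supp mu : finitely_supported_probability mu ->
  exists x, x \in finsupp mu.
Proof.
move=> [_]; have [->|[x xmu] _] := fset_0Vmem (finsupp mu); last by exists x.
by rewrite big_seq_fset0 => /esym/eqP; rewrite oner_eq0.
Qed.

Lemma ler_norm_expect mu F M : finitely_supported_probability mu ->
  (forall x, x \in finsupp mu -> `|F x| <= M) -> `|expect mu F| <= M.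
Proof.
move=> Pmu FM; have [mu0 _] := Pmu; rewrite -(expect_cst M Pmu).
apply: (le_trans (ler_norm_sum _ _ _)); rewrite big_seq /expect [leRHS]big_seq.
by apply: ler_sum => x xmu; rewrite normrM (ger0_norm (mu0 x)) ler_wpM2l// FM.
Qed.

(** Entries may repeat a point, and then their masses add up, so push-forwards and mixtures can be
    listed without any injectivity. *)
Definition combination s : {fsfun X -> R with 0} :=
  [fsfun z in seq_fset tt (map snd s) => \sum_(p <- s) p.1 * (p.2 == z)%:R | 0].

Lemma combinationE s z :
  combination s z = \sum_(p <- s) p.1 * (p.2 == z)%:R.
Proof.
rewrite /combination fsfunE seq_fsetE; case: ifPn => // zs.
rewrite big_seq big1// => p ps; case: eqP => [pz|]; last by rewrite mulr0.
by case/negP: zs; apply/mapP; exists p.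
Qed.

Lemma expect_combination s F : expect (combination s) F = \sum_(p <- s) p.1 * F p.2.
Proof.
rewrite (@expect_fsubset _ _ (seq_fset tt (map snd s))); last first.
  apply/fsubsetP => z; rewrite mem_finsupp combinationE seq_fsetE => h.
  apply: contraNT h => zs; rewrite big_seq big1// => p ps.
  case: eqP => [pz|]; last by rewrite mulr0.
  by case/negP: zs; apply/mapP; exists p.
under eq_bigr do rewrite combinationE mulr_suml.
rewrite exchange_big/=; apply: eq_big_seq => p ps.
have pS : p.2 \in seq_fset tt (map snd s) by rewrite seq_fsetE; apply/mapP; exists p.
rewrite (big_fsetD1 _ pS)/= eqxx mulr1 big_seq big1 ?addr0// => z.
by rewrite in_fsetD1 eq_sym => /andP[/negPf -> _]; rewrite mulr0 mul0r.
Qed.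

Lemma finsupp_combination s z : z \in finsupp (combination s) ->
  exists2 p, p \in s & p.1 != 0 /\ p.2 = z.
Proof.
rewrite mem_finsupp combinationE => h.
have [/hasP[p ps /andP[p0 /eqP pz]]|/hasPn H] :=
  boolP (has (fun p => (p.1 != 0) && (p.2 == z)) s); first by exists p.
case/eqP: h; rewrite big_seq big1// => p /H; rewrite negb_and negbK.
by case/orP => [/eqP ->|/negPf ->]; rewrite ?mul0r ?mulr0.
Qed.

Variable r : R.

Lemma VR_measuresP mu : VR_measures r mu <->
  finitely_supported_probability mu /\
  {in finsupp mu &, forall x y, mdist x y <= r}.
Proof.
split=> [vm|[Pmu dmu]].
  split; first exact: VR_measures_probability vm.
  case: vm => k [x [l [dx _ _ muE]]].
  have suppE z : z \in finsupp mu -> exists i, x i = z.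
    rewrite mem_finsupp muE => h.
    have [/existsP[i /eqP]|/existsPn H] := boolP [exists i, x i == z]; first by exists i.
    by case/eqP: h; rewrite big1// => i _; rewrite (negPf (H i)) mulr0.
  by move=> y z /suppE[i <-] /suppE[j <-].
have [mu0 mu1] := Pmu; have [x0 x0mu] := prob_supp Pmu.
have [k sz] : exists k, size (finsupp mu) = k.+1.
  have : x0 \in enum_fset (finsupp mu) by [].
  by case: (enum_fset _) => [//|y t] _; exists (size t).
have sumE (F : X -> R) :
    \sum_(i < k.+1) F (nth x0 (finsupp mu) i) = \sum_(x <- finsupp mu) F x.
  by rewrite (big_nth x0) big_mkord sz.
have memx (i : 'I_k.+1) : nth x0 (finsupp mu) i \in finsupp mu.
  by rewrite mem_nth// sz.
exists k, (fun i => nth x0 (finsupp mu) i), (fun i => mu (nth x0 (finsupp mu) i)).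
split=> [i j|i||z]; first exact: dmu.
- exact: mu0.
- by rewrite sumE.
- by rewrite (sumE (fun x => mu x * (x == z)%:R)) -[RHS]/(expect _ _) expect_eq1.
Qed.

(** Distances are compared for entries of nonzero mass only: erased points, or an ill-defined centre
    of weight 0, may lie anywhere. *)
Lemma VR_measures_combination s : (forall p, p \in s -> 0 <= p.1) ->
  \sum_(p <- s) p.1 = 1 ->
  (forall p q, p \in s -> q \in s -> p.1 != 0 -> q.1 != 0 -> mdist p.2 q.2 <= r) ->
  VR_measures r (combination s).
Proof.
move=> s0 s1 sd; apply/VR_measuresP; split; last first.
  move=> x y /finsupp_combination[p ps [p0 <-]] /finsupp_combination[q qs [q0 <-]].
  exact: sd.
split=> [z|].
  by rewrite combinationE big_seq sumr_ge0// => p ps; rewrite mulr_ge0// s0.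
have := expect_combination s (fun=> 1); rewrite /expect.
by under eq_bigr do rewrite mulr1; move=> ->; under eq_bigr do rewrite mulr1.
Qed.

Lemma VRm_prob (mu : VRm X r) : finitely_supported_probability (val mu).
Proof. exact: VR_measures_probability (set_valP mu). Qed.

Lemma VRm_ge0 (mu : VRm X r) x : 0 <= val mu x.
Proof. by have [] := VRm_prob mu. Qed.

Lemma VRm_diam (mu : VRm X r) :
  {in finsupp (val mu) &, forall x y, mdist x y <= r}.
Proof. by have [] := (VR_measuresP _).1 (set_valP mu). Qed.

Lemma VRm_ext (mu nu : VRm X r) :
  (forall F, expect (val mu) F = expect (val nu) F) -> mu = nu.
Proof. by move=> h; apply: val_inj; apply: expect_ext. Qed.

End Expectation.

(** * Bounds relating integrals and the Wasserstein distance *)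

Section Continuity.
Variables (R : realType) (X : metricType R).
Implicit Types (mu nu : {fsfun X -> R with 0}).

(** The easy half of Kantorovich duality, for two test functions at once: a coupling writes both
    integrals as double sums over the same pairs. *)
Lemma le_wasserstein_gap mu nu (F G : X -> R) (a b : R) :
  finitely_supported_probability mu -> finitely_supported_probability nu ->
  0 < b ->
  {in finsupp mu & finsupp nu, forall x y, `|F x - G y| <= a + b * mdist x y} ->
  `|expect mu F - expect nu G| <= a + b * wasserstein mu nu.
Proof.
move=> Pmu Pnu b0 FG.
have key p : coupling mu nu p ->
    `|expect mu F - expect nu G| <= a + b * transport_cost mu nu p.
  move=> [p0 p1 p2].
  have -> : expect mu F = \sum_(x <- finsupp mu) \sum_(y <- finsupp nu) p x y * F x.
    by apply: eq_big_seq => x xmu; rewrite -mulr_suml p1.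
  have -> : expect nu G = \sum_(x <- finsupp mu) \sum_(y <- finsupp nu) p x y * G y.
    by rewrite exchange_big; apply: eq_big_seq => x xmu; rewrite -mulr_suml p2.
  have -> : a = \sum_(x <- finsupp mu) \sum_(y <- finsupp nu) p x y * a.
    rewrite -[LHS](expect_cst a Pmu); apply: eq_big_seq => x xmu.
    by rewrite -mulr_suml p1.
  rewrite /transport_cost mulr_sumr -!sumrB -big_split/=.
  apply: (le_trans (ler_norm_sum _ _ _)).
  rewrite big_seq [leRHS]big_seq; apply: ler_sum => x xmu.
  rewrite mulr_sumr -!sumrB -big_split/=.
  apply: (le_trans (ler_norm_sum _ _ _)).
  rewrite big_seq [leRHS]big_seq; apply: ler_sum => y ynu.
  rewrite -mulrBr normrM (ger0_norm (p0 _ _)) mulrCA -mulrDr ler_wpM2l//.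
  exact: FG.
rewrite -lerBlDl -ler_pdivrMl//; apply: le_wasserstein => // p cp.
by rewrite ler_pdivrMl// lerBlDl key.
Qed.

(** A partial transport plan leaves masses [a] and [b] of equal total [1 - t]; the product
    [a x * b y / (1 - t)] completes the plan at cost at most [D] per unit of mass. *)
Lemma le_wasserstein_subcoupling mu nu (p : X -> X -> R) (D : R) :
  finitely_supported_probability mu -> finitely_supported_probability nu ->
  (forall x y, 0 <= p x y) ->
  {in finsupp mu, forall x, \sum_(y <- finsupp nu) p x y <= mu x} ->
  {in finsupp nu, forall y, \sum_(x <- finsupp mu) p x y <= nu y} ->
  (forall x y : X, mdist x y <= D) ->
  wasserstein mu nu <= transport_cost mu nu p +
    D * (1 - \sum_(x <- finsupp mu) \sum_(y <- finsupp nu) p x y).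
Proof.
move=> Pmu Pnu p0 pr pc dD; have [mu0 mu1] := Pmu; have [nu0 nu1] := Pnu.
set t := \sum_(x <- _) _.
pose a x := mu x - \sum_(y <- finsupp nu) p x y.
pose b y := nu y - \sum_(x <- finsupp mu) p x y.
have a0 x : x \in finsupp mu -> 0 <= a x by move=> /pr; rewrite subr_ge0.
have b0 y : y \in finsupp nu -> 0 <= b y by move=> /pc; rewrite subr_ge0.
have sa : \sum_(x <- finsupp mu) a x = 1 - t by rewrite sumrB mu1.
have sb : \sum_(y <- finsupp nu) b y = 1 - t by rewrite sumrB nu1 exchange_big.
have t1 : 0 <= 1 - t by rewrite -sa big_seq; apply: sumr_ge0.
(* If [1 - t = 0] the quotient is 0 by convention, and so is [a x], a nonnegative term of a zero
   sum. *)
have rowE x : x \in finsupp mu -> a x * (1 - t) / (1 - t) = a x.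
  have [t10|t10] := eqVneq (1 - t) 0; last by rewrite mulfK.
  move=> xmu; rewrite t10 mulr0 mul0r; apply/eqP; rewrite eq_sym eq_le a0// andbT.
  rewrite -t10 -sa (big_fsetD1 _ xmu)/= lerDl big_seq; apply: sumr_ge0 => z.
  by rewrite in_fsetD1 => /andP[_ /a0].
have colE y : y \in finsupp nu -> b y * (1 - t) / (1 - t) = b y.
  have [t10|t10] := eqVneq (1 - t) 0; last by rewrite mulfK.
  move=> ynu; rewrite t10 mulr0 mul0r; apply/eqP; rewrite eq_sym eq_le b0// andbT.
  rewrite -t10 -sb (big_fsetD1 _ ynu)/= lerDl big_seq; apply: sumr_ge0 => z.
  by rewrite in_fsetD1 => /andP[_ /b0].
(* [coupling] requires nonnegativity at all pairs, while [a] and [b] are only controlled on the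
   supports. *)
pose ext (P : pred X) (f : X -> R) x := if P x then f x else 0.
pose q x y := p x y + ext (mem (finsupp mu)) a x * ext (mem (finsupp nu)) b y / (1 - t).
have qE x y : x \in finsupp mu -> y \in finsupp nu ->
    q x y = p x y + a x * b y / (1 - t) by move=> xmu ynu; rewrite /q /ext/= xmu ynu.
have cq : coupling mu nu q.
  split=> [x y|x xmu|y ynu].
  - rewrite addr_ge0// divr_ge0// mulr_ge0// /ext/=; first by case: ifP => // /a0.
    by case: ifP => // /b0.
  - rewrite (eq_big_seq (fun y => p x y + a x * b y / (1 - t))) => [|y ynu]; last first.
      exact: qE.
    by rewrite big_split/= -mulr_suml -mulr_sumr sb rowE// /a addrC subrK.
  - rewrite (eq_big_seq (fun x => p x y + a x * b y / (1 - t))) => [|x xmu]; last first.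
      exact: qE.
    rewrite big_split/= -mulr_suml -mulr_suml sa [_ * b y]mulrC colE//.
    by rewrite /b addrC subrK.
apply: (le_trans (wasserstein_le_cost cq)); rewrite /transport_cost.
have -> : D * (1 - t) = \sum_(x <- finsupp mu) \sum_(y <- finsupp nu)
    D * (a x * b y / (1 - t)).
  rewrite -{1}sa mulr_sumr; apply: eq_big_seq => x xmu.
  by rewrite -mulr_sumr -mulr_suml -mulr_sumr sb rowE.
rewrite -big_split/= big_seq [leRHS]big_seq; apply: ler_sum => x xmu.
rewrite -big_split/= big_seq [leRHS]big_seq; apply: ler_sum => y ynu.
rewrite qE// mulrDl lerD2l [leRHS]mulrC ler_wpM2l//.
by rewrite divr_ge0// mulr_ge0// ?a0 ?b0.
Qed.

End Continuity.

(** * Continuity criteria for maps out of and into the thickening *)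

Section CvgExpect.
Variables (R : realType) (X : metricType R) (r : R).

Lemma uniform_gt0 (T : eqType) (P : T -> R -> Prop) (s : seq T) :
  (forall x d d', P x d -> 0 < d' -> d' <= d -> P x d') ->
  (forall x, x \in s -> exists2 d : R, 0 < d & P x d) ->
  exists2 d : R, 0 < d & forall x, x \in s -> P x d.
Proof.
move=> Pdown; elim: s => [_|x s ih H]; first by exists 1.
have [d d0 Pd] := H x (mem_head _ _).
have [|e e0 Pe] := ih; first by move=> y ys; apply: H; rewrite inE ys orbT.
have m0 : 0 < Num.min d e by rewrite lt_min d0 e0.
exists (Num.min d e) => // y; rewrite inE => /predU1P[->|ys].
  by apply: Pdown Pd _ _ => //; rewrite ge_min lexx.
by apply: Pdown (Pe _ ys) _ _ => //; rewrite ge_min lexx orbT.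
Qed.

Lemma near_all_seq (T : Type) (I : eqType) (A : set_system T) {FA : Filter A}
    (P : I -> T -> Prop) (s : seq I) :
  (forall i, i \in s -> \forall y \near A, P i y) ->
  \forall y \near A, forall i, i \in s -> P i y.
Proof.
elim: s => [_|i s ih H]; first by apply: nearW.
have iP := H i (mem_head _ _).
have {}ih := ih (fun j js => H j (mem_behead (s := i :: s) js)).
by apply: filterS2 iP ih => y yi ys j; rewrite inE => /predU1P[->|/ys].
Qed.

(** The integrand may vary with [y]; joint continuity is asked at the atoms of the limit measure.
    There are finitely many of them, so one radius [d] serves all. *)
Lemma cvg_expect (Y : topologicalType) (F : Y -> VRm X r) (Psi : Y -> X -> R)
    (y0 : Y) (M : R) :
  F @ y0 --> F y0 ->
  (\forall y \near y0, forall x, `|Psi y x| <= M) ->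
  (forall p, p \in finsupp (val (F y0)) ->
    Psi z.1 z.2 @[z --> (y0, p)] --> Psi y0 p) ->
  expect (val (F y)) (Psi y) @[y --> y0] --> expect (val (F y0)) (Psi y0).
Proof.
move=> Fc PM Pc.
have [K K0 PK] : exists2 K : R, 0 < K & \forall y \near y0, forall x, `|Psi y x| <= K.
  exists (`|M| + 1); first by rewrite ltr_wpDl.
  apply: filterS PM => y My x; apply: (le_trans (My x)).
  by rewrite (le_trans (ler_norm M))// lerDl.
have PK0 := nbhs_singleton PK.
apply/cvgrPdist_lt => e e0.
have e20 : 0 < e / 2 by rewrite divr_gt0.
have [d d0 dP] : exists2 d : R, 0 < d & forall p, p \in finsupp (val (F y0)) ->
    \forall y \near y0, forall x, mdist x p < d -> `|Psi y x - Psi y0 p| < e / 2.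
  apply: (uniform_gt0 (P := fun p d => \forall y \near y0, forall x,
    mdist x p < d -> `|Psi y x - Psi y0 p| < e / 2)).
    move=> p d d' dp d'0 d'd; apply: filterS dp => y yP x xd'.
    by apply: yP; exact: lt_le_trans d'd.
  move=> p /Pc/cvgrPdist_lt/(_ _ e20) [[A B]/= [Ay Bp] AB].
  have /nbhs_ballP[d /= d0 dB] := Bp.
  exists d => //; apply: filterS Ay => y yA x xd.
  rewrite distrC; apply: (AB (y, x)); split=> //=.
  by apply: dB; rewrite ballEmdist/= metric_sym.
have dall := @near_all_seq _ _ (nbhs y0) (nbhs_filter y0) _ _ dP.
(* Slope chosen so that a pair at distance at least [d] pays for the full oscillation [2 * K]. *)
pose b := 2 * K / d.
have b0 : 0 < b by rewrite divr_gt0// mulr_gt0.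
have c0 : 0 < e / 2 / b by rewrite divr_gt0.
move/metricType_numDomainType.cvgrPdist_lt : Fc => /(_ _ c0) Fc.
apply: filterS3 dall Fc PK => y dy Fy PKy.
have gap : {in finsupp (val (F y)) & finsupp (val (F y0)),
    forall x p, `|Psi y x - Psi y0 p| <= e / 2 + b * mdist x p}.
  move=> x p _ pF; have [xd|dx] := ltP (mdist x p) d.
    apply: (le_trans (ltW (dy p pF x xd))).
    by rewrite lerDl mulr_ge0 ?mdist_ge0// ltW.
  apply: (@le_trans _ _ (2 * K)).
    by rewrite (le_trans (ler_normB _ _))// mulr2n mulrDl mul1r lerD.
  apply: ler_wpDl; first exact: ltW.
  rewrite /b -mulrA; apply: ler_peMr; first by rewrite mulr_ge0// ltW.
  by rewrite mulrC ler_pdivlMr// mul1r.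
rewrite distrC; apply: (le_lt_trans (le_wasserstein_gap _ _ b0 gap)); do ?exact: VRm_prob.
rewrite [ltRHS]splitr ltrD2l mulrC -ltr_pdivlMr//.
by rewrite wasserstein_sym; do ?exact: VRm_prob.
Qed.

Lemma mdist_continuous (p : X) : continuous (fun x : X => mdist x p).
Proof.
move=> x; apply/cvgrPdist_lt => e e0; apply/nbhs_ballP; exists e => // y.
rewrite ballEmdist/= => xy; apply: le_lt_trans xy; rewrite ler_norml.
have := metric_triangle x y p; have := metric_triangle y x p.
rewrite (metric_sym y x) => h1 h2; apply/andP; split; lra.
Qed.

Lemma cvg_max (T : Type) (A : set_system T) {FA : Filter A} (f g : T -> R) (a b : R) :
  f @ A --> a -> g @ A --> b -> Num.max (f x) (g x) @[x --> A] --> Num.max a b.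
Proof.
move=> fa gb; under eq_cvg do rewrite maxr_absE.
rewrite maxr_absE; apply: cvgM; last exact: cvg_cst.
apply: cvgD; first exact: cvgD.
by apply: cvg_norm; apply: cvgB.
Qed.

(* Normalized so as to sum to at most [1], and equal to [1] at [p] and to [0] at
   the other points of [S] when [d] is small. *)
Definition tent (S : {fset X}) (d : R) (p x : X) : R :=
  Num.max 0 (1 - mdist x p / d) /
  Num.max 1 (\sum_(q <- S) Num.max 0 (1 - mdist x q / d)).

Lemma tent_ge0 (S : {fset X}) d p x : 0 <= tent S d p x.
Proof. by rewrite divr_ge0// le_max ?lexx ?ler01. Qed.

Lemma tent_sum (S : {fset X}) d x : \sum_(p <- S) tent S d p x <= 1.
Proof.
rewrite -mulr_suml ler_pdivrMr ?lt_max ?ltr01// mul1r le_max lexx orbT//.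
Qed.

Lemma tent_le1 (S : {fset X}) d p x : p \in S -> tent S d p x <= 1.
Proof.
move=> pS; apply: le_trans (tent_sum S d x).
by rewrite (big_fsetD1 _ pS)/= lerDl sumr_ge0// => q _; exact: tent_ge0.
Qed.

Lemma tent_eq0 (S : {fset X}) d p x : 0 < d -> d <= mdist x p -> tent S d p x = 0.
Proof.
move=> d0 dx; rewrite /tent (_ : Num.max 0 _ = 0) ?mul0r//; apply/max_idPl.
by rewrite subr_le0 ler_pdivlMr// mul1r.
Qed.

Lemma tent_eq1 (S : {fset X}) d p : 0 < d -> p \in S ->
  {in S, forall q, q != p -> d <= mdist p q} -> tent S d p p = 1.
Proof.
move=> d0 pS far; rewrite /tent (big_fsetD1 _ pS)/= mdistxx mul0r subr0.
rewrite (max_idPr ler01) big_seq big1 ?addr0 ?maxxx ?divr1// => q.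
rewrite in_fsetD1 => /andP[qp qS]; apply/max_idPl.
by rewrite subr_le0 ler_pdivlMr// mul1r far.
Qed.

Lemma tent_continuous (S : {fset X}) d p : continuous (tent S d p).
Proof.
have bc (q : X) : continuous (fun x : X => Num.max 0 (1 - mdist x q / d)).
  move=> x; apply: cvg_max; first exact: cvg_cst.
  apply: cvgB; first exact: cvg_cst.
  apply: cvgM; last exact: cvg_cst. exact: (@mdist_continuous q x).
move=> x; apply: cvgM; first exact: bc.
apply: cvgV; first by rewrite gt_eqF// lt_max ltr01.
apply: cvg_max; first exact: cvg_cst.
by apply: cvg_big => [|q _]; [exact: add_continuous|exact: bc].
Qed.

(** The [mu]-mass under the tent at [p], cut down to at most [nu p] by the factor [c p], moves to
    [p] over a distance less than [d]. What stays unmatched is at most the sum of the defects, and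
    travels at most [D]. *)
Lemma wasserstein_tent (mu nu : {fsfun X -> R with 0}) (d D : R) :
  finitely_supported_probability mu -> finitely_supported_probability nu ->
  0 < d -> (forall x y : X, mdist x y <= D) ->
  {in finsupp nu &, forall x y, y != x -> d <= mdist x y} ->
  wasserstein mu nu <= d + D * \sum_(p <- finsupp nu)
    `|expect nu (tent (finsupp nu) d p) - expect mu (tent (finsupp nu) d p)|.
Proof.
move=> Pmu Pnu d0 dD sep; have [mu0 mu1] := Pmu; have [nu0 nu1] := Pnu.
set S := finsupp nu; pose phi := tent S d.
have nuE p : p \in S -> expect nu (phi p) = nu p.
  move=> pS; rewrite -[RHS]expect_eq1; apply: eq_expect => q qS.
  have [->|qp] := eqVneq q p; last by rewrite [LHS]tent_eq0// sep// eq_sym.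
  by apply: tent_eq1 => // z zS; exact: sep.
pose m p := expect mu (phi p).
have m0 p : 0 <= m p.
  by apply: sumr_ge0 => x _; rewrite mulr_ge0// tent_ge0.
pose c p := Num.min 1 (nu p / m p).
have c0 p : 0 <= c p by rewrite le_min ler01 divr_ge0.
have c1 p : c p <= 1 by rewrite ge_min lexx.
have mc p : m p * c p <= nu p.
  have [mp0|mpn0] := eqVneq (m p) 0; first by rewrite mp0 mul0r.
  have mp : 0 < m p by rewrite lt_neqAle m0 eq_sym mpn0.
  by rewrite mulrC -ler_pdivlMr// ge_min lexx orbT.
have nmc p : nu p - m p * c p <= `|nu p - m p|.
  rewrite /c; case: (leP 1 (nu p / m p)) => _; first by rewrite mulr1 ler_norm.
  have [mp0|mpn0] := eqVneq (m p) 0; first by rewrite mp0 mul0r !subr0 ler_norm.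
  by rewrite mulrC divfK// subrr.
pose q x p := mu x * phi p x * c p.
have q0 x p : 0 <= q x p by apply: mulr_ge0 (mulr_ge0 (mu0 x) (tent_ge0 S d p x)) (c0 p).
have qle x p : q x p <= mu x * phi p x.
  by rewrite /q ler_piMr// mulr_ge0// tent_ge0.
have qr : {in finsupp mu, forall x, \sum_(p <- S) q x p <= mu x}.
  move=> x _; apply: (@le_trans _ _ (\sum_(p <- S) mu x * phi p x)).
    by apply: ler_sum.
  by rewrite -mulr_sumr ler_piMr// tent_sum.
have colE p : \sum_(x <- finsupp mu) q x p = m p * c p by rewrite -mulr_suml.
have qc : {in finsupp nu, forall p, \sum_(x <- finsupp mu) q x p <= nu p}.
  by move=> p _; rewrite colE.
have D0 : 0 <= D by have [x _] := prob_supp Pmu; rewrite -(mdistxx x).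
have := le_wasserstein_subcoupling Pmu Pnu q0 qr qc dD.
move=> /le_trans; apply; apply: lerD.
  apply: (@le_trans _ _ (\sum_(x <- finsupp mu) \sum_(p <- S) q x p * d)).
    apply: ler_sum => x _; apply: ler_sum => p _.
    have [xp|px] := ltP (mdist x p) d; first by rewrite ler_wpM2l// ltW.
    by rewrite /q /phi tent_eq0// mulr0 !mul0r.
  apply: (@le_trans _ _ (\sum_(x <- finsupp mu) mu x * d)).
    rewrite big_seq [leRHS]big_seq; apply: ler_sum => x xmu.
    by rewrite -mulr_suml; apply: ler_wpM2r; [exact: ltW|exact: qr].
  by rewrite -mulr_suml mu1 mul1r.
rewrite ler_wpM2l// exchange_big/= -nu1 -sumrB.
rewrite big_seq [leRHS]big_seq; apply: ler_sum => p pS.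
by rewrite colE nuE// nmc.
Qed.

(** Finitely many tests decide: the tents at the atoms of [F y0]. Their width is at most the
    separation of the atoms, so each isolates one atom, and at most [e / 2], so the matched mass is
    cheap to move. *)
Lemma cvg_VRm (Y : topologicalType) (F : Y -> VRm X r) (y0 : Y) (D : R) :
  (forall x y : X, mdist x y <= D) ->
  (forall psi : X -> R, continuous psi -> (forall x, `|psi x| <= 1) ->
    expect (val (F y)) psi @[y --> y0] --> expect (val (F y0)) psi) ->
  F @ y0 --> F y0.
Proof.
move=> dD H; apply/metricType_numDomainType.cvgrPdist_lt => e e0.
set nu := val (F y0); pose S := finsupp nu.
have [s s0 sS] : exists2 s : R, 0 < s &
    forall x, x \in S -> {in S, forall y, y != x -> s <= mdist x y}.
  apply: (uniform_gt0 (P := fun x s => {in S, forall y, y != x -> s <= mdist x y})).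
    by move=> x d d' dx d'0 d'd y yS yx; rewrite (le_trans d'd)// dx.
  move=> x xS.
  apply: (uniform_gt0 (P := fun y s => y != x -> s <= mdist x y)).
    by move=> y d d' dy d'0 d'd yx; rewrite (le_trans d'd)// dy.
  move=> y _; have [->|yx] := eqVneq y x; first by exists 1.
  by exists (mdist x y); rewrite ?mdist_gt0 1?eq_sym.
have D0 : 0 <= D by have [x _] := prob_supp (VRm_prob (F y0)); rewrite -(mdistxx x).
pose d := Num.min s (e / 2).
have d0 : 0 < d by rewrite lt_min s0 divr_gt0.
have sep : {in finsupp nu &, forall x y, y != x -> d <= mdist x y}.
  by move=> x y xS yS yx; rewrite (le_trans _ (sS x xS y yS yx))// ge_min lexx.
pose gap y := \sum_(p <- S) `|expect nu (tent S d p) - expect (val (F y)) (tent S d p)|.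
have gapc : gap y @[y --> y0] --> \sum_(p <- S | p \in S) (0 : R).
  rewrite /gap; under eq_cvg do rewrite big_seq.
  apply: cvg_big => [|p pS]; first exact: add_continuous.
  have := H _ (@tent_continuous S d p) _.
  have tb x : `|tent S d p x| <= 1 by rewrite ger0_norm ?tent_ge0// tent_le1.
  move=> /(_ tb) hc.
  suff : expect nu (tent S d p) - expect (val (F y)) (tent S d p) @[y --> y0] -->
      expect nu (tent S d p) - expect nu (tent S d p).
    by move/cvg_norm; rewrite subrr normr0.
  by apply: cvgB => //; exact: cvg_cst.
rewrite big1// in gapc.
have D1 : 0 < D + 1 by rewrite ltr_wpDl.
have c0 : 0 < e / 2 / (D + 1) by rewrite !divr_gt0.
move/cvgrPdist_lt : gapc => /(_ _ c0); apply: filterS => y.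
have gap0 : 0 <= gap y by rewrite sumr_ge0.
rewrite sub0r normrN ger0_norm// ltr_pdivlMr// => gy.
rewrite /mdist/= /VRm_dist wasserstein_sym; do ?exact: VRm_prob.
apply: (le_lt_trans (wasserstein_tent _ _ d0 dD sep)); do ?exact: VRm_prob.
rewrite -/(gap y) [ltRHS]splitr ler_ltD// ?ge_min ?lexx ?orbT//.
by apply: le_lt_trans gy; rewrite mulrC ler_wpM2l// lerDl.
Qed.

End CvgExpect.

Lemma continuous_mdistP (R : realType) (X : metricType R) (f : X -> R) :
  (forall u e, 0 < e -> exists2 d : R, 0 < d &
     forall v, mdist u v < d -> `|f u - f v| < e) -> continuous f.
Proof.
move=> H u; apply/cvgrPdist_lt => e /(H u)[d d0 dP]; apply/nbhs_ballP.
by exists d => // v; rewrite ballEmdist; exact: dP.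
Qed.

(** * The circle in coordinates *)

Section Circle.
Variable R : realType.
Local Notation C := (circle R).
Implicit Types (u v w x y z : C) (a b t : R).

Definition cx u : R := val u ord0 ord0.
Definition cy u : R := val u ord0 (lift ord0 ord0).
Definition dot u v : R := cx u * cx v + cy u * cy v.

Lemma circleE u : cx u ^+ 2 + cy u ^+ 2 = 1.
Proof. by have := set_valP u; rewrite /sphere/= !big_ord_recl big_ord0 addr0. Qed.

Lemma circle_ext u v : cx u = cx v -> cy u = cy v -> u = v.
Proof.
move=> hx hy; apply: val_inj; apply/rowP => i.
case: (unliftP ord0 i) => [j ->|->]; last exact: hx.
by rewrite (ord1 j); exact: hy.
Qed.

Let row2 a b : 'rV[R]_2 := \row_i (if i == ord0 then a else b).

Lemma row2_sphere a b : a ^+ 2 + b ^+ 2 = 1 -> row2 a b \in sphere R 1.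
Proof. by move=> h; rewrite inE /sphere/= !big_ord_recl big_ord0 addr0 !mxE. Qed.

Definition circle1 : C :=
  exist _ (row2 1 0) (row2_sphere (etrans (congr2 +%R (expr1n _ 2) (expr0n _ 2)) (addr0 _))).

(* The junk value off the unit circle is the point [(1, 0)]. *)
Definition cpoint a b : C := insubd (circle1 : set_type _) (row2 a b).

Lemma cx_cpoint a b : a ^+ 2 + b ^+ 2 = 1 -> cx (cpoint a b) = a.
Proof. by move=> /row2_sphere h; rewrite /cx /cpoint insubdK// mxE. Qed.

Lemma cy_cpoint a b : a ^+ 2 + b ^+ 2 = 1 -> cy (cpoint a b) = b.
Proof. by move=> /row2_sphere h; rewrite /cy /cpoint insubdK// mxE. Qed.

Lemma dot_itv u v : -1 <= dot u v <= 1.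
Proof.
have := circleE u; have := circleE v; rewrite /dot.
move: (cx u) (cy u) (cx v) (cy v) => a b c d h1 h2.
have := sqr_ge0 (a - c); have := sqr_ge0 (b - d).
have := sqr_ge0 (a + c); have := sqr_ge0 (b + d).
rewrite !sqrrD !sqrrN => *; apply/andP; split; lra.
Qed.

Lemma mdist_circle u v : mdist u v = acos (dot u v).
Proof. by rewrite /mdist/= /circle_dist !big_ord_recl big_ord0 addr0. Qed.

Lemma cos_mdist u v : cos (mdist u v) = dot u v.
Proof. by rewrite mdist_circle acosK// in_itv/= dot_itv. Qed.

Lemma mdist_lepi u v : mdist u v <= pi.
Proof. by rewrite mdist_circle acos_lepi// dot_itv. Qed.

Lemma mdist_itv u v : mdist u v \in `[0, pi].
Proof. by rewrite in_itv/= mdist_ge0 mdist_lepi. Qed.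

Lemma mdist_le u v r : 0 <= r <= pi -> (mdist u v <= r) = (cos r <= dot u v).
Proof. by move=> r0; rewrite leNgt [RHS]leNgt -cos_mdist ltr_cos ?mdist_itv. Qed.

Lemma mdist_lt u v r : 0 <= r <= pi -> (mdist u v < r) = (cos r < dot u v).
Proof. by move=> r0; rewrite -cos_mdist ltr_cos// mdist_itv. Qed.

(** The inner product with [c] tends to 1, and on [0, pi] a small distance is the same as a cosine
    close to 1; hence the cap of [d] at pi. *)
Lemma cvg_circle (T : Type) (A : set_system T) {FA : Filter A} (f : T -> C) c :
  cx (f t) @[t --> A] --> cx c -> cy (f t) @[t --> A] --> cy c -> f @ A --> c.
Proof.
move=> fx fy; apply/metricType_numDomainType.cvgrPdist_lt => e e0.
pose d := Num.min e pi.
have d0 : 0 < d by rewrite lt_min e0 pi_gt0.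
have dpi : 0 <= d <= pi by rewrite ltW//= /d ge_min lexx orbT.
have h : dot c (f t) @[t --> A] --> dot c c.
  by apply: cvgD; apply: cvgM => //; exact: cvg_cst.
have dcc : dot c c = 1 by rewrite /dot -!expr2 circleE.
have cosd : 0 < 1 - cos d.
  rewrite subr_gt0 -(cos0 R) ltr_cos// ?in_itv//=; last by rewrite lexx pi_ge0.
move/cvgrPdist_lt : h => /(_ _ cosd); apply: filterS => t; rewrite dcc.
move=> /(le_lt_trans (ler_norm _)); rewrite ltrD2l ltrN2.
rewrite -mdist_lt// => /lt_le_trans; apply; by rewrite /d ge_min lexx.
Qed.

(** The bound is the squared chord [2 * (1 - cos (mdist u v))], which tends to 0 with the
    distance. *)
Let coord_cts (f : C -> R) :
  (forall u v, `|f u - f v| ^+ 2 <= 2 * (1 - dot u v)) -> continuous f.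
Proof.
move=> H; apply: continuous_mdistP => u e e0.
have e1 : 0 < e ^+ 2 / 2 by rewrite divr_gt0// exprn_gt0.
have /cvgrPdist_lt/(_ _ e1)/nbhs_ballP[d /= d0 dP] := @continuous_cos R 0.
exists d => // v uv; rewrite -(@ltr_pXn2r _ 2)// ?nnegrE ?normr_ge0 ?ltW//.
apply: le_lt_trans (H u v) _; rewrite mulrC -ltr_pdivlMr//.
apply: le_lt_trans (dP (mdist u v) _); last first.
  by rewrite /ball/= sub0r normrN ger0_norm// mdist_ge0.
by rewrite cos0 cos_mdist ler_norm.
Qed.

Lemma cx_continuous : continuous cx.
Proof.
apply: coord_cts => u v; rewrite real_normK ?num_real// /dot.
have := circleE u; have := circleE v; have := sqr_ge0 (cy u - cy v).
rewrite !sqrrD !sqrrN; move: (cx u) (cx v) (cy u) (cy v) => *; lra.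
Qed.

Lemma cy_continuous : continuous cy.
Proof.
apply: coord_cts => u v; rewrite real_normK ?num_real// /dot.
have := circleE u; have := circleE v; have := sqr_ge0 (cx u - cx v).
rewrite !sqrrD !sqrrN; move: (cx u) (cx v) (cy u) (cy v) => *; lra.
Qed.

Definition norm2 a b : R := Num.sqrt (a ^+ 2 + b ^+ 2).

Definition dir a b : C := cpoint (a / norm2 a b) (b / norm2 a b).

Lemma sum_sqr_ge0 a b : 0 <= a ^+ 2 + b ^+ 2.
Proof. by rewrite addr_ge0 ?sqr_ge0. Qed.

Lemma sqr_norm2 a b : norm2 a b ^+ 2 = a ^+ 2 + b ^+ 2.
Proof. by rewrite sqr_sqrtr// sum_sqr_ge0. Qed.

Lemma norm2_ge0 a b : 0 <= norm2 a b. Proof. exact: sqrtr_ge0. Qed.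

Lemma norm2_gt0 a b : (0 < norm2 a b) = ((a != 0) || (b != 0)).
Proof.
rewrite sqrtr_gt0 lt_neqAle sum_sqr_ge0 andbT eq_sym paddr_eq0 ?sqr_ge0//.
by rewrite !sqrf_eq0 negb_and.
Qed.

Lemma norm2_eq0 a b : (norm2 a b == 0) = (a == 0) && (b == 0).
Proof.
by apply/negb_inj; rewrite negb_and -norm2_gt0 lt_neqAle norm2_ge0 andbT eq_sym.
Qed.

Lemma dir_sphere a b : norm2 a b != 0 ->
  (a / norm2 a b) ^+ 2 + (b / norm2 a b) ^+ 2 = 1.
Proof.
by move=> n0; rewrite !expr_div_n -mulrDl -sqr_norm2 divff// sqrf_eq0.
Qed.

Lemma cx_dir a b : norm2 a b != 0 -> cx (dir a b) = a / norm2 a b.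
Proof. by move=> n0; rewrite cx_cpoint// dir_sphere. Qed.

Lemma cy_dir a b : norm2 a b != 0 -> cy (dir a b) = b / norm2 a b.
Proof. by move=> n0; rewrite cy_cpoint// dir_sphere. Qed.

Lemma dir_circle u : dir (cx u) (cy u) = u.
Proof.
have n1 : norm2 (cx u) (cy u) = 1 by rewrite /norm2 circleE sqrtr1.
by apply: circle_ext; rewrite ?cx_dir ?cy_dir n1 ?divr1 ?oner_neq0.
Qed.

Lemma norm2_scale k a b : 0 <= k -> norm2 (k * a) (k * b) = k * norm2 a b.
Proof.
move=> k0; rewrite /norm2 !exprMn -mulrDr sqrtrM ?sqr_ge0// sqrtr_sqr.
by rewrite ger0_norm.
Qed.

Lemma dir_scale k a b : 0 < k -> dir (k * a) (k * b) = dir a b.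
Proof.
move=> k0; rewrite /dir norm2_scale ?(ltW k0)//.
by congr cpoint; rewrite -mulf_div divff ?mul1r// gt_eqF.
Qed.

Lemma cvg_norm2 (T : Type) (A : set_system T) {FA : Filter A} (f g : T -> R) a b :
  f @ A --> a -> g @ A --> b -> norm2 (f t) (g t) @[t --> A] --> norm2 a b.
Proof.
move=> fa gb; apply: continuous_cvg; first exact: sqrt_continuous.
by apply: cvgD; rewrite expr2; apply: cvgM.
Qed.

Lemma cvg_dir (T : Type) (A : set_system T) {FA : Filter A} (f g : T -> R) a b :
  norm2 a b != 0 -> f @ A --> a -> g @ A --> b -> dir (f t) (g t) @[t --> A] --> dir a b.
Proof.
move=> n0 fa gb; have nc := @cvg_norm2 _ _ FA _ _ _ _ fa gb.
have nV : (norm2 (f t) (g t))^-1 @[t --> A] --> (norm2 a b)^-1 by exact: cvgV n0 nc.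
have nn : \forall t \near A, norm2 (f t) (g t) != 0.
  have n1 : 0 < norm2 a b by rewrite lt_neqAle norm2_ge0 eq_sym n0.
  by near=> t; rewrite gt_eqF//; near: t; exact: (cvgr_gt _ nc _ n1).
apply: cvg_circle.
  rewrite cx_dir//.
  apply: (@cvg_trans _ (f t / norm2 (f t) (g t) @[t --> A])); last exact: cvgM.
  by apply: near_eq_cvg; near=> t; rewrite cx_dir//; near: t.
rewrite cy_dir//.
apply: (@cvg_trans _ (g t / norm2 (f t) (g t) @[t --> A])); last exact: cvgM.
by apply: near_eq_cvg; near=> t; rewrite cy_dir//; near: t.
Unshelve. all: by end_near. Qed.

End Circle.

Arguments cx {R} u.
Arguments cy {R} u.

Lemma seq_argmin (R : realType) (T : eqType) (f : T -> R) (s : seq T) (x0 : T) : x0 \in s ->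
  exists2 x, x \in s & forall y, y \in s -> f x <= f y.
Proof.
elim: s x0 => // a [|b s] ih x0 _.
  by exists a; rewrite ?inE// => y; rewrite inE => /eqP ->.
have [x xs xmin] := ih b (mem_head _ _).
have [ax|xa] := leP (f a) (f x).
  exists a; first by rewrite mem_head.
  by move=> y; rewrite inE => /predU1P[->//|/xmin]; exact: le_trans.
exists x; first by rewrite inE xs orbT.
by move=> y; rewrite inE => /predU1P[->|/xmin//]; exact: ltW.
Qed.

(** * Arcs, equilateral triangles, cubes and rotations *)

Section Geometry.
Variable R : realType.
Local Notation C := (circle R).
Implicit Types (u v w x y z : C) (a b t : R) (S : {fset C}).

(** With [dot], the cosine and sine of the oriented angle from [u] to [v]: the coordinates of [v] in
    the frame of [u]. *)
Definition cross u v : R := cx u * cy v - cy u * cx v.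

Lemma dotC u v : dot u v = dot v u.
Proof. by rewrite /dot mulrC [cy u * _]mulrC. Qed.

Lemma dotuu u : dot u u = 1.
Proof. by rewrite /dot -!expr2 circleE. Qed.

Lemma dot_cross u v w :
  dot u w = dot v u * dot v w + cross v u * cross v w.
Proof.
rewrite /dot /cross -[LHS]mul1r -(circleE v); ring.
Qed.

Lemma dot2_cross2 u v : dot u v ^+ 2 + cross u v ^+ 2 = 1.
Proof. by rewrite -[RHS](dotuu v) (dot_cross v u v) !expr2. Qed.

Lemma cx_frame u w : cx w = dot u w * cx u - cross u w * cy u.
Proof. rewrite -[LHS]mul1r -(circleE u) /dot /cross; ring. Qed.

Lemma cy_frame u w : cy w = dot u w * cy u + cross u w * cx u.
Proof. rewrite -[LHS]mul1r -(circleE u) /dot /cross; ring. Qed.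

(** By the triple-angle formula, [c = cos (pi / 3)] satisfies [4 c^3 - 3 c = -1], that is
    [(c + 1) (2 c - 1)^2 = 0], and [c > 0]. *)
Lemma cos_pi3 : cos (pi / 3) = 1 / 2 :> R.
Proof.
have c0 : 0 < cos (pi / 3 : R).
  apply: cos_gt0_pihalf; have := @pi_gt0 R => ?; apply/andP; split; lra.
have : cos (pi / 3 *+ 2 + pi / 3) = -1 :> R.
  by rewrite -cospi; congr cos; rewrite mulr2n; lra.
rewrite cosD cos_mulr2n mulr2n sinD; have := cos2Dsin2 (pi / 3 : R).
move: (cos _) (sin _) c0 => c s c0 cs h.
have s2 : s ^+ 2 = 1 - c ^+ 2 by rewrite -cs; ring.
have : (c + 1) * (2 * c - 1) ^+ 2 = 0.
  have h2 : 2 * c ^+ 3 - c - 2 * c * s ^+ 2 = -1 by apply: etrans h; ring.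
  by apply/eqP; rewrite -subr_eq0; move: h2; rewrite s2 => h2; apply/eqP; lra.
by move/eqP; rewrite mulf_eq0 sqrf_eq0 gt_eqF ?addr_gt0//= => /eqP; lra.
Qed.

Lemma cos_2pi3 : cos (2 * pi / 3) = - (1 / 2) :> R.
Proof.
have -> : 2 * pi / 3 = pi / 3 *+ 2 :> R by rewrite mulr2n; lra.
rewrite cos_mulr2n cos_pi3; lra.
Qed.

(** For [c = cos t] the bound is [cos (2 t)]: two points within [t] of [u] are within [2 t] of each
    other. *)
Lemma arc_dot (c : R) u x y : 0 <= c -> c <= dot u x -> c <= dot u y ->
  2 * c ^+ 2 - 1 <= dot x y.
Proof.
move=> c0 ux uy; rewrite (dot_cross x u y).
have := dot2_cross2 u x; have := dot2_cross2 u y.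
move: (dot u x) (dot u y) (cross u x) (cross u y) ux uy => a b s t ca cb hb ha.
have h1 : c ^+ 2 <= a * b by rewrite expr2 ler_pM.
have := sqr_ge0 (s + t); have := sqr_ge0 (a - b); rewrite !sqrrD sqrrN.
nra.
Qed.

(** Here [c] and [s] are the cosine and sine of half the angle between two points, and [a], [b]
    locate a third point from their midpoint, no farther from either than they are apart.
    Multiplying the two bounds gives [0 <= (c - a) (cos 3t - a)] with [c = cos t] and
    [cos 3t = 4 c^3 - 3 c]. Beyond the arc, [a <= cos 3t] and the sum of the two bounds give
    [(1 - c^2) (1 - 4 c^2) >= 0], which forces [c = 1/2]. *)
Let arc_real (a b c s : R) : a ^+ 2 + b ^+ 2 = 1 -> c ^+ 2 + s ^+ 2 = 1 ->
  1 / 2 <= c -> 2 * c ^+ 2 - 1 <= a * c + b * s -> 2 * c ^+ 2 - 1 <= a * c - b * s ->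
  c <= a \/ (c = 1 / 2 /\ a = -1).
Proof.
move=> ab cs c2 h1 h2; have [?|ac] := leP c a; [by left|right].
have b2 : b ^+ 2 = 1 - a ^+ 2 by lra.
have s2 : s ^+ 2 = 1 - c ^+ 2 by lra.
have t0 : 0 <= a * c - (2 * c ^+ 2 - 1) by lra.
have t2 : 0 <= (a * c - (2 * c ^+ 2 - 1)) ^+ 2 - b ^+ 2 * s ^+ 2.
  rewrite -exprMn subr_sqr; apply: mulr_ge0; lra.
have f1 : 0 <= (c - a) * (4 * c ^+ 3 - 3 * c - a).
  apply: le_trans t2 _; rewrite b2 s2 le_eqVlt; apply/orP; left; apply/eqP; ring.
rewrite pmulr_rge0 ?subr_gt0// in f1.
have f2 : a * c <= (4 * c ^+ 3 - 3 * c) * c by rewrite ler_pM2r; lra.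
have f3 : 0 <= (1 - c ^+ 2) * (1 - 4 * c ^+ 2).
  have -> : (1 - c ^+ 2) * (1 - 4 * c ^+ 2) =
    (4 * c ^+ 3 - 3 * c) * c - (2 * c ^+ 2 - 1) by ring.
  lra.
have c1 : c ^+ 2 < 1.
  rewrite lt_neqAle -subr_ge0 -s2 sqr_ge0 andbT; apply/eqP => c21.
  have : c = 1.
    by apply/eqP; rewrite -(@eqrXn2 _ 2)// ?expr1n ?c21//; lra.
  by move=> c11; rewrite c11 in t0 ac; lra.
rewrite pmulr_rge0 ?subr_gt0// in f3.
have ch : c = 1 / 2.
  apply/eqP; rewrite eq_le c2 andbT -(@ler_pXn2r _ 2)// ?nnegrE; lra.
by split=> //; rewrite ch in f1 t0; lra.
Qed.

(** Take [x], [y] farthest apart and [u] the direction of their sum. [arc_real] puts every point on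
    the arc between them, except possibly at the antipode of [u] when that arc has length 2pi/3;
    then [x], [y] and this point form a triangle. The bound [q] passes to the arc because
    [2 c^2 - 1] equals [dot x y]. *)
Lemma arc_or_equilateral S (q : R) : - (1 / 2) <= q -> S != fset0 ->
  {in S &, forall x y, q <= dot x y} ->
  (exists u c, [/\ 1 / 2 <= c, q <= 2 * c ^+ 2 - 1 & forall w, w \in S -> c <= dot u w])
  \/ (exists x y w, [/\ x \in S, y \in S, w \in S,
        cx x + cx y + cx w = 0 & cy x + cy y + cy w = 0]).
Proof.
move=> q2 /fset0Pn[x0 x0S] Sq.
have [[x y]] := @seq_argmin R _ (fun p => dot p.1 p.2) [seq (x, y) | x <- S, y <- S]
  (x0, x0) (allpairs_f pair x0S x0S).
move=> /allpairsP[[x' y'] [/= xS yS [? ?]]]; subst x' y' => xymin.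
have {}xymin z w : z \in S -> w \in S -> dot x y <= dot z w.
  by move=> zS wS; apply: (xymin (z, w)); exact: allpairs_f.
have d2 := le_trans q2 (Sq x y xS yS).
(* The sum has norm [N = 2 cos t], where [2 t] is the angle between [x] and [y], so [N / 2] is the
   cosine of the half-arc. *)
pose a := cx x + cx y; pose b := cy x + cy y; pose N := norm2 a b.
have N2 : N ^+ 2 = 2 + 2 * dot x y.
  rewrite sqr_norm2 /a /b /dot; have := circleE x; have := circleE y.
  by rewrite !sqrrD; move: (cx x) (cx y) (cy x) (cy y) => *; lra.
have N1 : 1 <= N by rewrite -(@ler_pXn2r _ 2)// ?nnegrE ?norm2_ge0// expr1n N2; lra.
have N0 : N != 0 by rewrite gt_eqF//; lra.
pose u := dir a b.
have ua : cx u = a / N by rewrite cx_dir.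
have ub : cy u = b / N by rewrite cy_dir.
have aE : a = N * cx u by rewrite ua mulrC divfK.
have bE : b = N * cy u by rewrite ub mulrC divfK.
have ux : dot u x = N / 2.
  apply: (mulfI N0); rewrite /dot mulrDr !mulrA -aE -bE -expr2 N2 /a /b /dot.
  have := circleE x; move: (cx x) (cx y) (cy x) (cy y) => *; lra.
have uy : dot u y = N / 2.
  apply: (mulfI N0); rewrite /dot mulrDr !mulrA -aE -bE -expr2 N2 /a /b /dot.
  have := circleE y; move: (cx x) (cx y) (cy x) (cy y) => *; lra.
have crossE : cross u y = - cross u x.
  apply/eqP; rewrite -addr_eq0 -(inj_eq (mulfI N0)) mulr0 /cross; apply/eqP.
  transitivity ((N * cx u) * b - (N * cy u) * a); first by rewrite /a /b; ring.
  by rewrite -aE -bE; ring.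
have c2E : 2 * (N / 2) ^+ 2 - 1 = dot x y by rewrite expr_div_n N2; lra.
have wP w : w \in S -> N / 2 <= dot u w \/ (N / 2 = 1 / 2 /\ dot u w = -1).
  move=> wS; apply: (@arc_real _ (cross u w) _ (cross u x)).
  - exact: dot2_cross2.
  - by rewrite -ux dot2_cross2.
  - lra.
  - by rewrite c2E -ux -(dot_cross w u x); exact: xymin.
  - by rewrite c2E -{1}uy -mulrN -crossE -(dot_cross w u y); exact: xymin.
have [/hasP[w wS /eqP uw]|/hasPn H] := boolP (has (fun w => dot u w == -1) S); last first.
  left; exists u, (N / 2); split; first lra.
    by rewrite c2E Sq.
  by move=> w wS; case: (wP w wS) => // -[_ /eqP]; rewrite (negPf (H w wS)).
have [h|[NE _]] := wP w wS; first by rewrite uw in h; lra.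
have {}NE : N = 1 by lra.
have cw : cross u w = 0.
  have := dot2_cross2 u w; rewrite uw => h.
  by apply/eqP; rewrite -sqrf_eq0; apply/eqP; lra.
right; exists x, y, w; rewrite wS xS yS; split=> //; rewrite -/a -/b.
  rewrite aE (cx_frame u w) uw cw NE; ring.
rewrite bE (cy_frame u w) uw cw NE; ring.
Qed.

(** The functional [dot u] is at least [c > 0] at the mean, which is thus nonzero; the mean has norm
    at most 1, so normalizing it cannot decrease this value. *)
Lemma mean_in_arc (mu : {fsfun C -> R with 0}) u (c : R) :
  finitely_supported_probability mu -> 0 < c ->
  (forall x, x \in finsupp mu -> c <= dot u x) ->
  norm2 (expect mu cx) (expect mu cy) != 0 /\
  c <= dot u (dir (expect mu cx) (expect mu cy)).
Proof.
move=> Pmu c0 ux; have [mu0 _] := Pmu.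
set a := expect mu cx; set b := expect mu cy.
have dotE (v : C) : expect mu (dot v) = cx v * a + cy v * b.
  by rewrite expectD !expectZ.
have cE : c <= cx u * a + cy u * b.
  by rewrite -dotE -(expect_cst c Pmu); apply: le_expect.
have n0 : norm2 a b != 0.
  apply/negP; rewrite norm2_eq0 => /andP[/eqP a0 /eqP b0].
  by move: cE; rewrite a0 b0 !mulr0 addr0 leNgt c0.
have n_gt0 : 0 < norm2 a b by rewrite lt_neqAle norm2_ge0 eq_sym n0.
have n1 : norm2 a b <= 1.
  have -> : norm2 a b = expect mu (dot (dir a b)).
    rewrite dotE cx_dir// cy_dir//; apply: (mulfI n0).
    transitivity (a / norm2 a b * norm2 a b * a + b / norm2 a b * norm2 a b * b).
      by rewrite !divfK// -!expr2 sqr_norm2.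
    ring.
  rewrite -[leRHS](expect_cst 1 Pmu); apply: le_expect => // x _.
  by have /andP[] := dot_itv (dir a b) x.
split=> //; rewrite /dot cx_dir// cy_dir// !mulrA -mulrDl ler_pdivlMr//.
by apply: le_trans cE; rewrite ler_piMr// ltW.
Qed.

(** The complex cube; its fibres are the inscribed equilateral triangles. *)
Definition cube x : C :=
  cpoint (cx x ^+ 3 - 3 * cx x * cy x ^+ 2) (3 * cx x ^+ 2 * cy x - cy x ^+ 3).

Let cube_sphere x : (cx x ^+ 3 - 3 * cx x * cy x ^+ 2) ^+ 2 +
  (3 * cx x ^+ 2 * cy x - cy x ^+ 3) ^+ 2 = 1.
Proof.
by transitivity ((cx x ^+ 2 + cy x ^+ 2) ^+ 3); [ring|rewrite circleE expr1n].
Qed.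

Lemma cx_cube x : cx (cube x) = cx x ^+ 3 - 3 * cx x * cy x ^+ 2.
Proof. by rewrite cx_cpoint// cube_sphere. Qed.

Lemma cy_cube x : cy (cube x) = 3 * cx x ^+ 2 * cy x - cy x ^+ 3.
Proof. by rewrite cy_cpoint// cube_sphere. Qed.

Lemma cube_frame x z (a b : R) : a = dot x z -> b = cross x z ->
  cx (cube z) = cx (cube x) * (a ^+ 3 - 3 * a * b ^+ 2)
    - cy (cube x) * (3 * a ^+ 2 * b - b ^+ 3) /\
  cy (cube z) = cx (cube x) * (3 * a ^+ 2 * b - b ^+ 3)
    + cy (cube x) * (a ^+ 3 - 3 * a * b ^+ 2).
Proof.
move=> aE bE; rewrite !cx_cube !cy_cube (cx_frame x z) (cy_frame x z) -aE -bE.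
split; ring.
Qed.

(** The hypothesis says that the angle from [x] to [z] is 0 or 2pi/3 in absolute value. *)
Lemma cube_eq_frame x z : (dot x z - 1) * (2 * dot x z + 1) = 0 -> cube z = cube x.
Proof.
move=> h; have [h1 h2] := @cube_frame x z _ _ erefl erefl.
have := dot2_cross2 x z; move: (dot x z) (cross x z) h h1 h2 => a b h h1 h2 ab.
have b2 : b ^+ 2 = 1 - a ^+ 2 by lra.
have e1 : a ^+ 3 - 3 * a * b ^+ 2 = 1.
  have -> : a ^+ 3 - 3 * a * b ^+ 2 = 1 + (a - 1) * (2 * a + 1) * (2 * a + 1).
    rewrite b2; ring.
  by rewrite h; ring.
have e2 : 3 * a ^+ 2 * b - b ^+ 3 = 0.
  have [a1|] := eqVneq a 1.
    have : b ^+ 2 = 0 by rewrite b2 a1; ring.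
    by move/eqP; rewrite sqrf_eq0 => /eqP ->; ring.
  rewrite -subr_eq0 => a1; move/eqP: h; rewrite mulf_eq0 (negPf a1)/= => /eqP a2.
  have -> : 3 * a ^+ 2 * b - b ^+ 3 = b * (2 * a + 1) * (2 * a - 1).
    have -> : b ^+ 3 = b * b ^+ 2 by ring.
    rewrite b2; ring.
  by rewrite a2; ring.
by apply: circle_ext; rewrite ?h1 ?h2 e1 e2; ring.
Qed.

Lemma equilateral_dot x y w : cx x + cx y + cx w = 0 -> cy x + cy y + cy w = 0 ->
  dot x y = - (1 / 2).
Proof.
move=> sx sy; have := circleE w; have -> : cx w = - (cx x + cx y) by lra.
have -> : cy w = - (cy x + cy y) by lra.
rewrite !sqrrN !sqrrD /dot; have := circleE x; have := circleE y.
by move: (cx x) (cx y) (cy x) (cy y) => *; lra.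
Qed.

(** A point within 2pi/3 of all three vertices is itself a vertex. Its inner products with them sum
    to 0, and those with [y] and [w], each raised by 1/2, have a product that is nonnegative and
    equal to [- (1/2) (1 - a) (2 a + 1) <= 0] for [a = dot x z]. *)
Lemma cube_equilateral x y w z : cx x + cx y + cx w = 0 -> cy x + cy y + cy w = 0 ->
  - (1 / 2) <= dot x z -> - (1 / 2) <= dot y z -> - (1 / 2) <= dot w z ->
  cube z = cube x.
Proof.
move=> sx sy hx hy hw.
have dxy := equilateral_dot sx sy.
have sxy : cross x y ^+ 2 = 3 / 4 by have := dot2_cross2 x y; rewrite dxy; lra.
have wE : dot w z = - dot x z - dot y z.
  have -> : dot w z = (cx x + cx y + cx w) * cx z + (cy x + cy y + cy w) * cy z
    - dot x z - dot y z by rewrite /dot; ring.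
  rewrite sx sy; ring.
have := dot_cross y x z; rewrite dxy => yE.
apply: cube_eq_frame; have := dot2_cross2 x z; have /andP[_] := dot_itv x z.
move: yE hx hy hw; rewrite wE {dxy sx sy wE}.
move: (dot x z) (cross x z) (dot y z) (cross x y) sxy => a b p s s2 pE a2 p2 q2 a1 ab.
have b2 : b ^+ 2 = 1 - a ^+ 2 by lra.
have h0 : 0 <= (p + 1 / 2) * (- a - p + 1 / 2) by apply: mulr_ge0; lra.
have h1 : 0 <= (1 - a) * (2 * a + 1) by apply: mulr_ge0; lra.
have hE : (p + 1 / 2) * (- a - p + 1 / 2) = - (1 / 2) * ((1 - a) * (2 * a + 1)).
  transitivity ((1 - a) ^+ 2 / 4 - s ^+ 2 * b ^+ 2); first by rewrite pE; field.
  by rewrite s2 b2; field.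
rewrite hE in h0.
have -> : (a - 1) * (2 * a + 1) = - ((1 - a) * (2 * a + 1)) by ring.
by apply/eqP; rewrite oppr_eq0 eq_le h1 andbT; lra.
Qed.

Definition rot t x : C :=
  cpoint (cx x * cos t - cy x * sin t) (cx x * sin t + cy x * cos t).

Let rot_sphere t x : (cx x * cos t - cy x * sin t) ^+ 2 +
  (cx x * sin t + cy x * cos t) ^+ 2 = 1.
Proof. rewrite -[RHS]mulr1 -{1}(circleE x) -(cos2Dsin2 t); ring. Qed.

Lemma cx_rot t x : cx (rot t x) = cx x * cos t - cy x * sin t.
Proof. by rewrite cx_cpoint// rot_sphere. Qed.

Lemma cy_rot t x : cy (rot t x) = cx x * sin t + cy x * cos t.
Proof. by rewrite cy_cpoint// rot_sphere. Qed.

Lemma rot0 x : rot 0 x = x.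
Proof. by apply: circle_ext; rewrite ?cx_rot ?cy_rot cos0 sin0; ring. Qed.

Lemma rotD s t x : rot s (rot t x) = rot (s + t) x.
Proof.
by apply: circle_ext; rewrite !(cx_rot, cy_rot) cosD sinD; ring.
Qed.

Lemma dot_rot s t x y :
  dot (rot s x) (rot t y) = dot x y * cos (t - s) - cross x y * sin (t - s).
Proof.
rewrite /dot /cross !(cx_rot, cy_rot) cosB sinB; ring.
Qed.

Lemma rot_inj t : injective (rot t).
Proof. by move=> x y /(congr1 (rot (- t))); rewrite !rotD addNr !rot0. Qed.

Lemma cube_rot t x : cube (rot t x) = rot (t *+ 3) (cube x).
Proof.
have c3 : cos (t *+ 3) = cos t ^+ 3 - 3 * cos t * sin t ^+ 2.
  by rewrite !mulrS addr0 !cosD !sinD; ring.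
have s3 : sin (t *+ 3) = 3 * cos t ^+ 2 * sin t - sin t ^+ 3.
  by rewrite !mulrS addr0 !sinD !cosD; ring.
apply: circle_ext; rewrite !(cx_rot, cy_rot, cx_cube, cy_cube) c3 s3; ring.
Qed.

Lemma rot_to x y : exists2 t, - mdist x y <= t <= mdist x y & y = rot t x.
Proof.
have d0 := mdist_ge0 x y; have dpi := mdist_lepi x y.
have cE := cos_mdist x y.
have s0 : 0 <= sin (mdist x y) by apply: sin_ge0_pi; rewrite d0 dpi.
have s2 : sin (mdist x y) ^+ 2 = cross x y ^+ 2.
  by rewrite sin2cos2 cE -(dot2_cross2 x y); ring.
have /orP[/eqP sE|/eqP sE] : (sin (mdist x y) == cross x y) || (sin (mdist x y) == - cross x y).
  by rewrite -eqf_sqr s2.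
- exists (mdist x y); first by rewrite lexx andbT; lra.
  apply: circle_ext; rewrite ?cx_rot ?cy_rot cE sE.
    by rewrite {1}(cx_frame x y); ring.
  by rewrite {1}(cy_frame x y); ring.
- exists (- mdist x y); first by rewrite lexx; lra.
  apply: circle_ext; rewrite ?cx_rot ?cy_rot cosN sinN cE sE opprK.
    by rewrite {1}(cx_frame x y); ring.
  by rewrite {1}(cy_frame x y); ring.
Qed.

Lemma rot_eq_id t x : rot t x = x -> cos t = 1.
Proof.
move=> h; have := dot_rot t 0 x x; rewrite rot0 h dotuu sub0r cosN.
by rewrite /cross => ->; rewrite mul1r [cy x * _]mulrC subrr mul0r subr0.
Qed.

(** The range [-3pi, 3pi] fits both uses: three times an angle of at most pi, and three times one of
    at most 2pi/3 plus a difference of two angles below pi/2. *)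
Lemma cos_eq1 t : - (3 * pi) <= t <= 3 * pi -> cos t = 1 ->
  exists2 k : R, k \in [:: -1; 0; 1] & t = 2 * pi * k.
Proof.
have p0 := @pi_gt0 R.
have core (s : R) : 0 <= s <= pi -> cos s = 1 -> s = 0.
  by move=> s01 cs; rewrite -(@cosK _ s) ?cs ?acos1// in_itv.
have cos2pi (s : R) : cos (s - 2 * pi) = cos s.
  by rewrite -[in RHS](subrK (2 * pi) s) [2 * pi]mulrC mulr_natr cosD2pi.
have half (s : R) : 0 <= s <= 3 * pi -> cos s = 1 -> s = 0 \/ s = 2 * pi.
  move=> /andP[s0 s3] cs; have [s1|s1] := leP s pi; first by left; apply: core; rewrite ?s0.
  have [s2|s2] := leP s (2 * pi); right.
    have : 2 * pi - s = 0.
      apply: core; first by apply/andP; split; lra.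
      by rewrite -opprB cosN cos2pi.
    lra.
  have : s - 2 * pi = 0.
    apply: core; first by apply/andP; split; lra.
    by rewrite cos2pi.
  lra.
move=> /andP[t1 t2] ct; have [t0|t0] := leP 0 t.
  have [|->|->] := half t _ ct; first by rewrite t0 t2.
    by exists 0; rewrite ?inE ?eqxx ?orbT// mulr0.
  by exists 1; rewrite ?inE ?eqxx ?orbT// mulr1.
have [||h|h] := half (- t); first by apply/andP; split; lra.
- by rewrite cosN.
- lra.
- by exists (-1); rewrite ?inE ?eqxx ?orbT//; lra.
Qed.

Lemma cos_ge_2pi3 t : - (2 * pi / 3) <= t <= 2 * pi / 3 -> - (1 / 2) <= cos t.
Proof.
have p0 := @pi_gt0 R.
have core (s : R) : 0 <= s <= 2 * pi / 3 -> - (1 / 2) <= cos s.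
  move=> /andP[s0 s1]; rewrite -cos_2pi3 leNgt ltr_cos -?leNgt// in_itv/=;
    apply/andP; split; lra.
move=> /andP[t1 t2]; have [t0|t0] := leP 0 t; first by apply: core; rewrite t0.
by rewrite -cosN; apply: core; apply/andP; split; lra.
Qed.

Lemma mdist_le_2pi3 x y : (mdist x y <= 2 * pi / 3) = (- (1 / 2) <= dot x y).
Proof.
have p0 := @pi_gt0 R.
by rewrite mdist_le ?cos_2pi3//; apply/andP; split; lra.
Qed.

(* With [x = e^{i a}] and [y = e^{i b}], the targets [a + g / 3] and [b + h / 3]
   are arguments of cube roots of the same number, hence differ by a multiple of
   [2 pi / 3], whose absolute value must be at most [2 pi / 3]. *)
Lemma tighten_dot x y (g h q : R) :
  - (1 / 2) <= dot x y -> - (pi / 2) < g < pi / 2 -> - (pi / 2) < h < pi / 2 ->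
  0 <= q <= 1 -> rot g (cube x) = rot h (cube y) ->
  - (1 / 2) <= dot (rot (q * (g / 3)) x) (rot (q * (h / 3)) y).
Proof.
move=> xy /andP[g1 g2] /andP[h1 h2] /andP[q0 q1] e.
have p0 := @pi_gt0 R.
have [t /andP[t1 t2] yE] := rot_to x y.
have dxy : mdist x y <= 2 * pi / 3 by rewrite mdist_le_2pi3.
have c1 : cos (t *+ 3 + h - g) = 1.
  apply: (@rot_eq_id _ (cube x)); apply: (@rot_inj g).
  by rewrite rotD e yE cube_rot rotD; congr (rot _ _); ring.
have [|k kk tE] := cos_eq1 _ c1.
  by rewrite -[t *+ 3]mulr_natl; apply/andP; split; lra.
have hE : h - g = 2 * pi * k - 3 * t by rewrite -tE -[t *+ 3]mulr_natl; ring.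
have k1 : -1 <= k <= 1.
  by move: kk; rewrite !inE => /or3P[] /eqP ->; apply/andP; split; lra.
rewrite yE rotD dot_rot dotuu /cross [cy x * _]mulrC subrr mul0r subr0 [1 * cos _]mul1r.
(* The angle at time [q] is a convex combination of the initial angle [t] and the final one, so
   bounds at both ends suffice. *)
have -> : q * (h / 3) + t - q * (g / 3) = (1 - q) * t + q * (2 * pi / 3 * k).
  transitivity (q * ((h - g) / 3) + t); first by field.
  by rewrite hE; field.
have k2 : - (2 * pi / 3) <= 2 * pi / 3 * k <= 2 * pi / 3.
  have p3 : 0 <= 2 * pi / 3 :> R by lra.
  have /andP[? ?] := k1.
  by rewrite -{1}[2 * pi / 3]mulr1 -mulrN ler_wpM2l// -[leRHS]mulr1 ler_wpM2l.
have /andP[k3 k4] := k2.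
apply: cos_ge_2pi3; apply/andP; split.
  have -> : - (2 * pi / 3) = (1 - q) * - (2 * pi / 3) + q * - (2 * pi / 3) :> R by ring.
  by apply: lerD; rewrite ler_wpM2l//; lra.
have -> : 2 * pi / 3 = (1 - q) * (2 * pi / 3) + q * (2 * pi / 3) :> R by ring.
by apply: lerD; rewrite ler_wpM2l//; lra.
Qed.

End Geometry.

(** * Cut-offs, Dirac masses and mixtures on the circle *)

Section Thickening.
Variables (R : realType) (r : R).
Local Notation C := (circle R).
Local Notation V := (VRm C r).
Implicit Types (mu : V) (c : C).

(** This is [min 1 (max 0 s)], written with maxima for the sake of [cvg_max]. Clamping the time
    extends the homotopies continuously to all of [R * X]. *)
Definition clamp (s : R) : R := 1 - Num.max 0 (1 - Num.max 0 s).

Lemma clamp_itv s : 0 <= clamp s <= 1.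
Proof.
by rewrite /clamp subr_ge0 ge_max ler01/= !lerBlDr !lerDl !le_max !lexx.
Qed.

Lemma clamp_id s : 0 <= s <= 1 -> clamp s = s.
Proof.
move=> /andP[s0 s1]; rewrite /clamp (max_idPr s0) (max_idPr _) ?subr_ge0//.
by rewrite opprB addrC subrK.
Qed.

Lemma clamp_le0 s : s <= 0 -> clamp s = 0.
Proof. by move=> s0; rewrite /clamp (max_idPl s0) subr0 (max_idPr ler01) subrr. Qed.

Lemma clamp_ge1 s : 1 <= s -> clamp s = 1.
Proof.
move=> s1; rewrite /clamp (max_idPr (le_trans ler01 s1)) (max_idPl _) ?subr0//.
by rewrite subr_le0.
Qed.

Lemma clamp_eq0 s : (clamp s == 0) = (s <= 0).
Proof.
apply/eqP/idP => [h|/clamp_le0//]; rewrite leNgt; apply/negP => s0.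
have [s1|/ltW/clamp_ge1] := leP s 1; last by rewrite h => /eqP; rewrite eq_sym oner_eq0.
by move: h; rewrite clamp_id ?(ltW s0) ?s1// => s00; rewrite s00 ltxx in s0.
Qed.

Lemma cvg_clamp (T : Type) (A : set_system T) {FA : Filter A} (f : T -> R) a :
  f @ A --> a -> clamp (f t) @[t --> A] --> clamp a.
Proof.
move=> fa; apply: cvgB; first exact: cvg_cst.
apply: cvg_max; first exact: cvg_cst.
apply: cvgB; first exact: cvg_cst.
by apply: cvg_max => //; exact: cvg_cst.
Qed.

Lemma cvg_expect_val (T : topologicalType) (F : T -> V) (t0 : T) (psi : C -> R) :
  F @ t0 --> F t0 -> continuous psi -> (forall x, `|psi x| <= 1) ->
  expect (val (F t)) psi @[t --> t0] --> expect (val (F t0)) psi.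
Proof.
move=> Fc psic psi1; apply: (@cvg_expect _ _ _ _ F (fun _ => psi) t0 1) => //.
  exact: nearW.
by move=> p _ /=; apply: (@continuous_cvg _ _ _ _ _ snd psi p); [exact: psic|exact: cvg_snd].
Qed.

Lemma norm_cx_le1 (x : C) : `|cx x| <= 1.
Proof.
rewrite -(@ler_pXn2r _ 2)// ?nnegrE// expr1n real_normK ?num_real// -(circleE x).
by rewrite lerDl sqr_ge0.
Qed.

Lemma norm_cy_le1 (x : C) : `|cy x| <= 1.
Proof.
rewrite -(@ler_pXn2r _ 2)// ?nnegrE// expr1n real_normK ?num_real// -(circleE x).
by rewrite lerDr sqr_ge0.
Qed.

Definition dirac c : {fsfun C -> R with 0} := combination [:: (1, c)].

Lemma expect_dirac c F : expect (dirac c) F = F c.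
Proof. by rewrite expect_combination big_seq1 mul1r. Qed.

Lemma VR_measures_dirac c : 0 <= r -> VR_measures r (dirac c).
Proof.
move=> r0; apply: VR_measures_combination => [p||p q].
- by rewrite inE => /eqP ->.
- by rewrite big_seq1.
- by rewrite !inE => /eqP -> /eqP ->; rewrite mdistxx.
Qed.

Definition mkVR m (vm : VR_measures r m) : V := exist _ m (mem_set vm).

Definition mix (chi : R) c (m : {fsfun C -> R with 0}) : {fsfun C -> R with 0} :=
  combination ((chi, c) :: [seq ((1 - chi) * m x, x) | x <- finsupp m]).

Lemma expect_mix chi c m F :
  expect (mix chi c m) F = chi * F c + (1 - chi) * expect m F.
Proof.
rewrite expect_combination big_cons big_map /expect mulr_sumr.
by congr (_ + _); apply: eq_bigr => x _; rewrite mulrA.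
Qed.

Lemma VR_measures_mix chi c m : 0 <= r -> 0 <= chi <= 1 -> VR_measures r m ->
  (0 < chi -> forall x, x \in finsupp m -> mdist c x <= r) ->
  VR_measures r (mix chi c m).
Proof.
move=> r0 /andP[chi0 chi1] /VR_measuresP[Pm dm] dc; have [m0 m1] := Pm.
apply: VR_measures_combination => [p||].
- rewrite inE => /predU1P[->//|/mapP[x _ ->]/=].
  by rewrite mulr_ge0// subr_ge0.
- by rewrite big_cons big_map -mulr_sumr m1 mulr1 addrC subrK.
- have dc' x : chi != 0 -> x \in finsupp m -> mdist c x <= r.
    by move=> c0; apply: dc; rewrite lt_neqAle chi0 eq_sym c0.
  move=> p q; rewrite !inE => /predU1P[->|/mapP[x xm ->]]/predU1P[->|/mapP[y ym ->]]//=.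
  + by rewrite mdistxx.
  + by move=> c0 _; exact: dc'.
  + by move=> _ c0; rewrite metric_sym; exact: dc'.
  + by move=> _ _; exact: dm.
Qed.

End Thickening.

(** * Scales below 2pi/3 *)

Section SubcriticalScale.
Variables (R : realType) (r : R).
Hypotheses (r_ge0 : 0 <= r) (r_lt : r < 2 * pi / 3).
Local Notation C := (circle R).
Local Notation V := (VRm C r).
Implicit Types (mu : V) (c : C).

Lemma subcritical_arc mu : exists u q, [/\ 1 / 2 <= q, cos r <= 2 * q ^+ 2 - 1 &
  forall x, x \in finsupp (val mu) -> q <= dot u x].
Proof.
have p0 := @pi_gt0 R; have rl := r_lt; have rg := r_ge0.
have rpi : 0 <= r <= pi by apply/andP; split => //; lra.
have cr : - (1 / 2) < cos r.
  by rewrite -cos_2pi3 ltr_cos ?in_itv//=; lra.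
have dr : {in finsupp (val mu) &, forall x y, cos r <= dot x y}.
  by move=> x y xm ym; rewrite -mdist_le//; exact: (VRm_diam xm ym).
have ne : finsupp (val mu) != fset0.
  by apply/fset0Pn; exact: prob_supp (VRm_prob mu).
have [//|[x [y [w [xm ym _ sx sy]]]]] := arc_or_equilateral (ltW cr) ne dr.
have := dr _ _ xm ym; rewrite (equilateral_dot sx sy) leNgt cr//.
Qed.

Definition center mu : C := dir (expect (val mu) cx) (expect (val mu) cy).

Lemma center_arc mu : exists u q, [/\ 1 / 2 <= q, cos r <= 2 * q ^+ 2 - 1,
  norm2 (expect (val mu) cx) (expect (val mu) cy) != 0, q <= dot u (center mu) &
  forall x, x \in finsupp (val mu) -> q <= dot u x].
Proof.
have [u [q [q2 cq uq]]] := subcritical_arc mu; exists u, q.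
have q0 : 0 < q by lra.
by have [? ?] := mean_in_arc (VRm_prob mu) q0 uq.
Qed.

Lemma mdist_center mu x : x \in finsupp (val mu) -> mdist (center mu) x <= r.
Proof.
have p0 := @pi_gt0 R; have rl := r_lt; have rg := r_ge0.
have rpi : 0 <= r <= pi by apply/andP; split => //; lra.
have [u [q [q2 cq _ uc uq]]] := center_arc mu => /uq ux.
rewrite mdist_le//; apply: le_trans cq _; apply: arc_dot uc ux; lra.
Qed.

Lemma center_continuous : continuous center.
Proof.
move=> mu; have [u [q [_ _ n0 _ _]]] := center_arc mu.
have idc : (fun m : V => m) @ mu --> mu by exact: cvg_id.
apply: (@cvg_dir _ _ _ (nbhs_filter mu) _ _ _ _ n0).
  exact: (cvg_expect_val idc (@cx_continuous R) (@norm_cx_le1 R)).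
exact: (cvg_expect_val idc (@cy_continuous R) (@norm_cy_le1 R)).
Qed.

Definition diracV c : V := mkVR (VR_measures_dirac c r_ge0).

Lemma diracV_continuous : continuous diracV.
Proof.
move=> c; apply: (cvg_VRm (@mdist_lepi R)) => psi psic _ /=.
by under eq_cvg do rewrite expect_dirac; rewrite expect_dirac; exact: psic.
Qed.

Lemma subcritical_equivalence : homotopy_equivalent R V C.
Proof.
exists center, diracV; split.
- exact: center_continuous.
- exact: diracV_continuous.
(* The weight of the centre decreases from 1 to 0, since [homotopic] starts at the composite and
   ends at the identity. *)
- pose m (z : R * V) := mix (1 - clamp z.1) (center z.2) (val z.2).
  have vm z : VR_measures r (m z).
    apply: VR_measures_mix => //.
    + by have := clamp_itv z.1; lra.
    + exact: set_valP.
    + by move=> _; exact: mdist_center.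
  exists (fun z => mkVR (vm z)); split.
  + apply: continuous_subspaceT => z.
    apply: (cvg_VRm (@mdist_lepi R)) => psi psic psi1 /=.
    under eq_cvg do rewrite expect_mix; rewrite expect_mix.
    have c1 : clamp y.1 @[y --> z] --> clamp z.1 by apply: cvg_clamp; exact: cvg_fst.
    have sc : (fun y : R * V => y.2) @ z --> z.2 by exact: cvg_snd.
    apply: cvgD; apply: cvgM.
    * by apply: cvgB => //; exact: cvg_cst.
    * apply: (@continuous_cvg _ _ _ _ _ (fun y : R * V => center y.2) psi).
        exact: psic.
      apply: (@continuous_cvg _ _ _ _ _ (fun y : R * V => y.2) center) => //.
      exact: center_continuous.
    * by apply: cvgB; [exact: cvg_cst|apply: cvgB => //; exact: cvg_cst].
    * exact: (cvg_expect_val sc psic psi1).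
  + move=> mu; apply: VRm_ext => F /=.
    by rewrite expect_mix expect_dirac clamp_le0//= !subr0 subrr mul0r addr0 mul1r.
  + move=> mu; apply: VRm_ext => F /=.
    by rewrite expect_mix clamp_ge1//= subrr mul0r add0r subr0 mul1r.
- have fg c : center (diracV c) = c by rewrite /center/= !expect_dirac dir_circle.
  exists snd; split=> [|c|c]; last by []; last by rewrite /= fg.
  by apply: continuous_subspaceT => z; exact: cvg_snd.
Qed.

End SubcriticalScale.

(** * Reweighting points and moving them to cube roots *)

Section Tightening.
Variable R : realType.
Local Notation C := (circle R).
Implicit Types (x y c u : C) (a b p q t : R).

(** The oriented angle from [c] to the direction of [(a, b)] when their inner product is positive.
    Elsewhere the value is junk, but it stays below pi/2 in absolute value, which bounds every
    move. *)
Definition angto c a b : R :=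
  atan ((cx c * b - cy c * a) / (cx c * a + cy c * b)).

Lemma angto_itv c a b : - (pi / 2) < angto c a b < pi / 2.
Proof. by rewrite atan_gtNpi2 atan_ltpi2. Qed.

Lemma norm_angto_le c a b : `|angto c a b| <= pi / 2.
Proof. by have /andP[h1 h2] := angto_itv c a b; rewrite ler_norml !ltW. Qed.

Lemma rot_angto c a b : 0 < cx c * a + cy c * b -> rot (angto c a b) c = dir a b.
Proof.
move=> e0; rewrite /angto; set e := cx c * a + cy c * b in e0 *.
set f := cx c * b - cy c * a.
have ef : norm2 a b = norm2 e f.
  rewrite /norm2; congr Num.sqrt.
  rewrite -[LHS]mul1r -(circleE c) /e /f; ring.
have n0 : 0 < norm2 a b by rewrite ef norm2_gt0 gt_eqF.
have nn0 := lt0r_neq0 n0; have en0 := lt0r_neq0 e0.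
have sE : Num.sqrt (1 + (f / e) ^+ 2) = norm2 a b / e.
  apply/eqP; rewrite -(@eqrXn2 _ 2)// ?sqrtr_ge0//; last by rewrite divr_ge0 ?ltW.
  rewrite sqr_sqrtr; last by rewrite addr_ge0 ?sqr_ge0.
  by rewrite !expr_div_n ef sqr_norm2; apply/eqP; field.
have cE : cos (atan (f / e)) = e / norm2 a b by rewrite cos_atan sE invf_div.
have tE : sin (atan (f / e)) = f / norm2 a b.
  have := atanK (f / e); rewrite /tan cE => h.
  have : sin (atan (f / e)) / (e / norm2 a b) * (e / norm2 a b) = f / e * (e / norm2 a b).
    by rewrite h.
  rewrite divfK ?mulf_neq0 ?invr_eq0// => ->; field; first by rewrite nn0.
have aE : cx c * e - cy c * f = a.
  rewrite -[RHS]mul1r -(circleE c) /e /f; ring.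
have bE : cx c * f + cy c * e = b.
  rewrite -[RHS]mul1r -(circleE c) /e /f; ring.
apply: circle_ext; rewrite ?cx_rot ?cy_rot ?cx_dir ?cy_dir// cE tE !mulrA.
  by rewrite -mulrBl aE.
by rewrite -mulrDl bE.
Qed.

Section Limits.
Context (T : Type) (A : set_system T) {FA : Filter A}.
Implicit Types (f g h : T -> R) (F : T -> C).

Lemma cvg0_mul_bounded f g (M : R) : f @ A --> (0 : R) ->
  (forall s, `|g s| <= M) -> f s * g s @[s --> A] --> (0 : R).
Proof.
move=> f0 gM; apply/norm_cvg0P.
apply: (@squeeze_cvgr _ _ _ _ (fun=> 0) (fun s => `|f s| * M)).
- by apply: nearW => s; rewrite normr_ge0/= normrM ler_wpM2l.
- exact: cvg_cst.
- suff : `|f s| * M @[s --> A] --> 0 * M by rewrite mul0r.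
  by apply: cvgM; [exact/norm_cvg0P|exact: cvg_cst].
Qed.

Lemma cvg_cx F c : F @ A --> c -> cx (F s) @[s --> A] --> cx c.
Proof. by move=> Fc; apply: (@continuous_cvg _ _ _ _ _ F cx) => //; exact: cx_continuous. Qed.

Lemma cvg_cy F c : F @ A --> c -> cy (F s) @[s --> A] --> cy c.
Proof. by move=> Fc; apply: (@continuous_cvg _ _ _ _ _ F cy) => //; exact: cy_continuous. Qed.

Lemma cvg_expr f a n : f @ A --> a -> f s ^+ n @[s --> A] --> a ^+ n.
Proof.
move=> fa; elim: n => [|n ih]; first by under eq_cvg do rewrite expr0; exact: cvg_cst.
by under eq_cvg do rewrite exprS; rewrite exprS; apply: cvgM.
Qed.

Lemma cvg_cube F c : F @ A --> c -> cube (F s) @[s --> A] --> cube c.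
Proof.
move=> Fc; have hx := cvg_cx Fc; have hy := cvg_cy Fc.
apply: cvg_circle; rewrite ?cx_cube ?cy_cube.
  under eq_cvg do rewrite cx_cube.
  by apply: cvgB; repeat (exact: cvg_cst || exact: cvg_expr || apply: cvgM).
under eq_cvg do rewrite cy_cube.
by apply: cvgB; repeat (exact: cvg_cst || exact: cvg_expr || apply: cvgM).
Qed.

Lemma cvg_rot f F t c : f @ A --> t -> F @ A --> c -> rot (f s) (F s) @[s --> A] --> rot t c.
Proof.
move=> ft Fc; have hx := cvg_cx Fc; have hy := cvg_cy Fc.
have hc : cos (f s) @[s --> A] --> cos t.
  by apply: (@continuous_cvg _ _ _ _ _ f cos) => //; exact: continuous_cos.
have hs : sin (f s) @[s --> A] --> sin t.
  by apply: (@continuous_cvg _ _ _ _ _ f sin) => //; exact: continuous_sin.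
apply: cvg_circle; rewrite ?cx_rot ?cy_rot.
  by under eq_cvg do rewrite cx_rot; apply: cvgB; apply: cvgM.
by under eq_cvg do rewrite cy_rot; apply: cvgD; apply: cvgM.
Qed.

Lemma cvg_angto F g h c a b : F @ A --> c -> g @ A --> a -> h @ A --> b ->
  0 < cx c * a + cy c * b ->
  angto (F s) (g s) (h s) @[s --> A] --> angto c a b.
Proof.
move=> Fc ga hb e0; have hx := cvg_cx Fc; have hy := cvg_cy Fc.
apply: (@continuous_cvg _ _ _ _ _ (fun s => (cx (F s) * h s - cy (F s) * g s) /
  (cx (F s) * g s + cy (F s) * h s)) (@atan R)); first exact: continuous_atan.
apply: cvgM; first by apply: cvgB; apply: cvgM.
by apply: cvgV; [exact: lt0r_neq0|apply: cvgD; apply: cvgM].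
Qed.

End Limits.

(** Goes from 1 at [p = 0] to the positive part of an inner product at [p = 1], which erases the
    points whose cube is at least pi/2 away from [(a, b)]. *)
Definition wt p a b x : R :=
  (1 - p) + p * Num.max 0 (cx (cube x) * a + cy (cube x) * b).

(** Division by 3: rotating a point by [t] rotates its cube by [3 t]. *)
Definition mv q a b x : C := rot (q * (angto (cube x) a b / 3)) x.

Lemma mv0 a b x : mv 0 a b x = x.
Proof. by rewrite /mv mul0r rot0. Qed.

Lemma cube_mv1 a b x : 0 < cx (cube x) * a + cy (cube x) * b ->
  cube (mv 1 a b x) = dir a b.
Proof.
move=> e0; rewrite cube_rot -(rot_angto e0); congr rot.
by field.
Qed.

Lemma wt_ge0 p a b x : 0 <= p <= 1 -> 0 <= wt p a b x.
Proof.
by move=> /andP[p0 p1]; rewrite addr_ge0 ?subr_ge0// mulr_ge0// le_max lexx.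
Qed.

(** If points move at all then [p = 1], and those that survive have cubes within pi/2 of [(a, b)],
    where [angto] is the true angle and [tighten_dot] applies. *)
Lemma dot_mv p q a b x y : - (1 / 2) <= dot x y -> 0 <= q <= 1 ->
  (0 < q -> p = 1) -> wt p a b x != 0 -> wt p a b y != 0 ->
  - (1 / 2) <= dot (mv q a b x) (mv q a b y).
Proof.
move=> xy /andP[q0 q1] pq wx wy; have [q00|qn0] := eqVneq q 0.
  by rewrite q00 !mv0.
have p1 : p = 1 by apply: pq; rewrite lt_neqAle q0 eq_sym qn0.
have pos z : wt p a b z != 0 -> 0 < cx (cube z) * a + cy (cube z) * b.
  rewrite /wt p1 subrr add0r mul1r; case: ltP => // h.
  by rewrite eqxx.
apply: tighten_dot => //; rewrite ?angto_itv ?q0 ?q1//.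
by rewrite !rot_angto ?pos.
Qed.

Lemma dot_mv_arc u q a b x : 1 / 2 <= dot u x -> 0 <= q <= 1 ->
  0 < dot u (mv q a b x).
Proof.
move=> ux /andP[q0 q1]; have p0 := @pi_gt0 R.
have [t /andP[t1 t2] xE] := rot_to u x.
have d3 : mdist u x <= pi / 3.
  by rewrite mdist_le ?cos_pi3//; apply/andP; split; lra.
have /andP[g1 g2] := angto_itv (cube x) a b.
rewrite /mv; set g := angto _ _ _ in g1 g2 *.
rewrite xE rotD -{1}[u]rot0 dot_rot dotuu /cross [cy u * _]mulrC subrr mul0r subr0 subr0 mul1r.
have qg : - (pi / 6) < q * (g / 3) < pi / 6.
  have [g0|g0] := leP 0 g.
    have h : q * (g / 3) <= g / 3 by rewrite ler_piMl//; lra.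
    have h' : 0 <= q * (g / 3) by rewrite mulr_ge0//; lra.
    by apply/andP; split; lra.
  have h : g / 3 <= q * (g / 3) by rewrite ler_niMl//; lra.
  have h' : q * (g / 3) <= 0 by rewrite mulr_ge0_le0//; lra.
  by apply/andP; split; lra.
have /andP[? ?] := qg; apply: cos_gt0_pihalf; apply/andP; split; lra.
Qed.

Lemma cvg_wt (T : Type) (A : set_system T) {FA : Filter A}
    (fp f g : T -> R) (F : T -> C) p a b c :
  fp @ A --> p -> f @ A --> a -> g @ A --> b -> F @ A --> c ->
  wt (fp s) (f s) (g s) (F s) @[s --> A] --> wt p a b c.
Proof.
move=> hp fa gb Fc; have h3 := @cvg_cube _ _ FA _ _ Fc.
have hx := @cvg_cx _ _ FA _ _ h3; have hy := @cvg_cy _ _ FA _ _ h3.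
apply: cvgD; first by apply: cvgB => //; exact: cvg_cst.
apply: cvgM => //; apply: cvg_max; first exact: cvg_cst.
by apply: cvgD; apply: cvgM.
Qed.

(* Where [angto] is discontinuous, either [q = 0] and no point moves, or the
   weight [wt] vanishes. *)
Lemma cvg_wt_mv (T : Type) (A : set_system T) {FA : Filter A}
    (fp fq f g : T -> R) (F : T -> C) p q a b c (psi : C -> R) :
  fp @ A --> p -> fq @ A --> q -> f @ A --> a -> g @ A --> b -> F @ A --> c ->
  (q != 0 -> p = 1) -> continuous psi -> (forall x, `|psi x| <= 1) ->
  wt (fp s) (f s) (g s) (F s) * psi (mv (fq s) (f s) (g s) (F s)) @[s --> A] -->
  wt p a b c * psi (mv q a b c).
Proof.
move=> hp hq fa gb Fc pq psic psi1; have hw := @cvg_wt _ _ FA _ _ _ _ _ _ _ _ hp fa gb Fc.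
have h3 := @cvg_cube _ _ FA _ _ Fc.
have [e0|e0] := ltP 0 (cx (cube c) * a + cy (cube c) * b).
  apply: cvgM => //.
  apply: (@continuous_cvg _ _ _ _ _ (fun s => mv (fq s) (f s) (g s) (F s)) psi).
    exact: psic.
  apply: cvg_rot => //; apply: cvgM => //.
  by apply: cvgM; [exact: cvg_angto|exact: cvg_cst].
have [q0|qn0] := eqVneq q 0.
  apply: cvgM => //.
  apply: (@continuous_cvg _ _ _ _ _ (fun s => mv (fq s) (f s) (g s) (F s)) psi).
    exact: psic.
  apply: cvg_rot => //; rewrite q0 mul0r.
  apply: (@cvg0_mul_bounded _ _ FA _ _ (pi / 2 / 3)); first by rewrite -q0.
  by move=> s; rewrite normrM (ger0_norm (_ : 0 <= 3^-1))// ler_pM2r// norm_angto_le.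
have w0 : wt p a b c = 0.
  by rewrite /wt pq// subrr add0r mul1r; apply/max_idPl.
rewrite w0 mul0r; apply: (@cvg0_mul_bounded _ _ FA _ _ 1) => //.
by rewrite -w0.
Qed.

End Tightening.

(** * The homotopy at scale 2pi/3 *)

Section Squeeze.
Variable R : realType.
Local Notation C := (circle R).
Local Notation V := (VRm C (2 * pi / 3)).
Implicit Types (mu : V) (x y c u : C) (z : R * V).

Let r_ge0 : 0 <= 2 * pi / 3 :> R.
Proof. by have := @pi_gt0 R; lra. Qed.

Lemma VRm_dot mu : {in finsupp (val mu) &, forall x y, - (1 / 2) <= dot x y}.
Proof. by move=> x y xm ym; rewrite -mdist_le_2pi3; exact: (VRm_diam xm ym). Qed.

Definition m3x mu := expect (val mu) (fun x => cx (cube x)).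
Definition m3y mu := expect (val mu) (fun x => cy (cube x)).
Definition m3 mu := norm2 (m3x mu) (m3y mu).

(** [tame] rises from 0 to 1 as [m3] goes from 1/4 to 1/2, and [wild] falls from 1 to 0 between 1/2
    and 3/4. With these consecutive ramps, tightening is complete at time 1 wherever some mass is
    not transferred. *)
Definition tame mu := clamp (4 * m3 mu - 1).
Definition wild mu := clamp (3 - 4 * m3 mu).

(** The parameter [2 * clamp z.1 * tame z.2] lies in [0, 2]: its first unit drives the reweighting
    and its second one the move, so [p = 1] once [q > 0]. *)
Definition wtz z x := wt (clamp (2 * clamp z.1 * tame z.2)) (m3x z.2) (m3y z.2) x.
Definition mvz z x := mv (clamp (2 * clamp z.1 * tame z.2 - 1)) (m3x z.2) (m3y z.2) x.
Definition mass z := expect (val z.2) (wtz z).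

(* [z = (s, mu)]: as [s] runs through [0, 1], the measure [mu] is first
   restricted to the points whose cube is close to the mean of the cubes, then
   these points move to the nearest cube roots of its direction. *)
Definition tight z : {fsfun C -> R with 0} :=
  combination [seq (val z.2 x * wtz z x / mass z, mvz z x) | x <- finsupp (val z.2)].

Lemma wtz_ge0 z x : 0 <= wtz z x.
Proof. by apply: wt_ge0; exact: clamp_itv. Qed.

Lemma m3_mean mu : expect (val mu) (fun x => cx (cube x) * m3x mu + cy (cube x) * m3y mu) =
  m3 mu ^+ 2.
Proof.
rewrite sqr_norm2 !expr2 -!expectZ -expectD; apply: eq_expect => x _.
by rewrite mulrC [cy _ * _]mulrC.
Qed.

(** The mass is [(1 - p) + p * k]. If [p] is nonzero then [m3 > 0], and the positive parts integrate
    to [k], at least the integral of the inner products, which is [m3 ^+ 2]. *)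
Lemma mass_gt0 z : 0 < mass z.
Proof.
rewrite /mass /wtz; set p := clamp _.
have /andP[p0 p1] : 0 <= p <= 1 by exact: clamp_itv.
have -> : expect (val z.2) (wt p (m3x z.2) (m3y z.2)) = (1 - p) + p *
    expect (val z.2) (fun x => Num.max 0 (cx (cube x) * m3x z.2 + cy (cube x) * m3y z.2)).
  by rewrite expectD expectZ (expect_cst _ (VRm_prob _)).
set k := expect _ _.
have kE : m3 z.2 ^+ 2 <= k.
  rewrite -m3_mean; apply: le_expect => [x|x _]; first exact: VRm_ge0.
  by rewrite le_max lexx orbT.
have [p00|pn0] := eqVneq p 0; first by rewrite p00 mul0r addr0 subr0.
have n0 : 0 < m3 z.2.
  rewrite ltNge; apply/negP => n0; case/eqP: pn0; apply: clamp_le0.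
  by have -> : tame z.2 = 0; [apply: clamp_le0; lra|rewrite mulr0].
have k0 : 0 < k by apply: lt_le_trans kE; rewrite exprn_gt0.
have pp : 0 < p by rewrite lt_neqAle p0 eq_sym pn0.
by apply: ltr_wpDl; [rewrite subr_ge0|exact: mulr_gt0].
Qed.

Lemma expect_tight z F :
  expect (tight z) F = expect (val z.2) (fun x => wtz z x * F (mvz z x)) / mass z.
Proof.
rewrite expect_combination big_map /expect mulr_suml; apply: eq_bigr => x _ /=.
by rewrite !mulrA mulrAC.
Qed.

Lemma finsupp_tight z y : y \in finsupp (tight z) ->
  exists x, [/\ x \in finsupp (val z.2), wtz z x != 0 & mvz z x = y].
Proof.
move=> /finsupp_combination[_ /mapP[x xm ->] /= [w0 <-]]; exists x; split => //.
by apply: contraNneq w0 => ->; rewrite mulr0 mul0r.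
Qed.

Lemma VR_measures_tight z : VR_measures (2 * pi / 3) (tight z).
Proof.
have mz := mass_gt0 z.
apply: VR_measures_combination => [p /mapP[x _ ->]/=||p q].
- by apply: divr_ge0 (ltW mz); apply: mulr_ge0 (VRm_ge0 _ _) (wtz_ge0 _ _).
- by rewrite big_map -mulr_suml divff ?gt_eqF.
move=> /mapP[x xm ->] /mapP[y ym ->] /= wx wy; rewrite mdist_le_2pi3.
apply: (@dot_mv _ (clamp (2 * clamp z.1 * tame z.2))) => //.
- exact: (VRm_dot xm ym).
- exact: clamp_itv.
- move=> q0; apply: clamp_ge1; have : clamp (2 * clamp z.1 * tame z.2 - 1) != 0.
    by rewrite gt_eqF.
  by rewrite clamp_eq0 -ltNge; lra.
- by apply: contraNneq wx; rewrite /wtz => ->; rewrite mulr0 mul0r.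
- by apply: contraNneq wy; rewrite /wtz => ->; rewrite mulr0 mul0r.
Qed.

Lemma tight_prob z : finitely_supported_probability (tight z).
Proof. exact: VR_measures_probability (VR_measures_tight z). Qed.

Lemma arc_of_m3 mu : m3 mu < 1 ->
  exists u, forall x, x \in finsupp (val mu) -> 1 / 2 <= dot u x.
Proof.
move=> n1; have ne : finsupp (val mu) != fset0.
  by apply/fset0Pn; exact: prob_supp (VRm_prob mu).
have [[u [c [c2 _ uc]]]|[x [y [w [xm ym wm sx sy]]]]] :=
  arc_or_equilateral (lexx _) ne (@VRm_dot mu).
  by exists u => x /uc; exact: le_trans.
have cE (t : C) : t \in finsupp (val mu) -> cube t = cube x.
  by move=> tm; apply: (cube_equilateral sx sy); exact: (@VRm_dot mu).
have : m3 mu = 1.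
  rewrite /m3 /m3x /m3y (@eq_expect _ _ _ _ (fun=> cx (cube x))); last by move=> z /cE ->.
  rewrite (@eq_expect _ _ _ (fun t => cy (cube t)) (fun=> cy (cube x))); last by move=> z /cE ->.
  by rewrite !(expect_cst _ (VRm_prob _)) /norm2 circleE sqrtr1.
by move=> nE; rewrite nE ltxx in n1.
Qed.

(** [arc_of_m3] does not apply to [tight z], whose cubes may all agree by now. Instead, its points
    all have positive inner product with the centre [u] of an arc containing the original support,
    whereas those of a triangle would sum to 0. *)
Lemma tight_arc z : m3 z.2 < 1 ->
  exists u (q : R), 1 / 2 <= q /\ forall y, y \in finsupp (tight z) -> q <= dot u y.
Proof.
move=> /arc_of_m3[u uP]; have /VR_measuresP[Pt dt] := VR_measures_tight z.
have ne : finsupp (tight z) != fset0 by apply/fset0Pn; exact: prob_supp Pt.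
have dt' : {in finsupp (tight z) &, forall x y, - (1 / 2) <= dot x y}.
  by move=> x y xm ym; rewrite -mdist_le_2pi3 dt.
have [[v [c [c2 _ vc]]]|[x [y [w [xm ym wm sx sy]]]]] :=
  arc_or_equilateral (lexx _) ne dt'; first by exists v, c.
have pos t : t \in finsupp (tight z) -> 0 < dot u t.
  move=> /finsupp_tight[s [sm _ <-]].
  by apply: dot_mv_arc (uP _ sm) _; exact: clamp_itv.
have := pos _ xm; have := pos _ ym; have := pos _ wm.
have : dot u x + dot u y + dot u w = 0.
  transitivity (cx u * (cx x + cx y + cx w) + cy u * (cy x + cy y + cy w)).
    by rewrite /dot; ring.
  by rewrite sx sy; ring.
by move: (dot u x) (dot u y) (dot u w) => *; lra.
Qed.

Definition mx z := expect (tight z) cx.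
Definition my z := expect (tight z) cy.
Definition cen z : C := dir (mx z) (my z).

Lemma norm2_m_neq0 z : m3 z.2 < 1 -> norm2 (mx z) (my z) != 0.
Proof.
move=> /tight_arc[u [c [c2 uc]]]; have c0 : 0 < c by lra.
by have [] := mean_in_arc (tight_prob z) c0 uc.
Qed.

Lemma mdist_cen z : m3 z.2 < 1 ->
  forall y, y \in finsupp (tight z) -> mdist (cen z) y <= 2 * pi / 3.
Proof.
move=> /tight_arc[u [c [c2 uc]]] y ym; have c0 : 0 < c by lra.
have [_ uq] := mean_in_arc (tight_prob z) c0 uc.
rewrite mdist_le_2pi3; have := arc_dot (ltW c0) uq (uc _ ym).
apply: le_trans; have : (1 / 2) ^+ 2 <= c ^+ 2 by rewrite ler_pXn2r// nnegrE; lra.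
lra.
Qed.

Definition chi z := clamp z.1 * wild z.2.

Lemma chi_itv z : 0 <= chi z <= 1.
Proof.
have /andP[a0 a1] := clamp_itv z.1; have /andP[b0 b1] := clamp_itv (3 - 4 * m3 z.2).
by rewrite mulr_ge0//= mulr_ile1.
Qed.

Lemma m3_ge0 mu : 0 <= m3 mu. Proof. exact: norm2_ge0. Qed.

Lemma wild_neq0 mu : wild mu != 0 -> m3 mu < 1.
Proof. by rewrite /wild clamp_eq0 -ltNge; lra. Qed.

Lemma chi_neq0 z : chi z != 0 -> m3 z.2 < 1.
Proof. by rewrite mulf_eq0 negb_or => /andP[_ /wild_neq0]. Qed.

Lemma VR_measures_squeeze z : VR_measures (2 * pi / 3) (mix (chi z) (cen z) (tight z)).
Proof.
apply: VR_measures_mix => //; first exact: chi_itv.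
  exact: VR_measures_tight.
by move=> c0; apply: mdist_cen; apply: chi_neq0; rewrite gt_eqF.
Qed.

Definition squeeze z : V := mkVR (VR_measures_squeeze z).

Lemma cube_continuous : continuous (@cube R).
Proof. by move=> c; apply: (@cvg_cube _ _ _ (nbhs_filter c)); exact: cvg_id. Qed.

Lemma cvg_m3x (T : topologicalType) (F : T -> V) t0 : F @ t0 --> F t0 ->
  m3x (F t) @[t --> t0] --> m3x (F t0).
Proof.
move=> Fc; apply: cvg_expect_val Fc _ _ => [c|c]; last exact: norm_cx_le1.
by apply: (@cvg_cx _ _ _ (nbhs_filter c)); exact: cube_continuous.
Qed.

Lemma cvg_m3y (T : topologicalType) (F : T -> V) t0 : F @ t0 --> F t0 ->
  m3y (F t) @[t --> t0] --> m3y (F t0).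
Proof.
move=> Fc; apply: cvg_expect_val Fc _ _ => [c|c]; last exact: norm_cy_le1.
by apply: (@cvg_cy _ _ _ (nbhs_filter c)); exact: cube_continuous.
Qed.

Lemma cvg_m3 (T : topologicalType) (F : T -> V) t0 : F @ t0 --> F t0 ->
  m3 (F t) @[t --> t0] --> m3 (F t0).
Proof. by move=> Fc; apply: cvg_norm2; [exact: cvg_m3x|exact: cvg_m3y]. Qed.

Lemma cvg_tame (T : topologicalType) (F : T -> V) t0 : F @ t0 --> F t0 ->
  tame (F t) @[t --> t0] --> tame (F t0).
Proof.
move=> Fc; apply: cvg_clamp; apply: cvgB; last exact: cvg_cst.
by apply: cvgM; [exact: cvg_cst|exact: cvg_m3].
Qed.

Lemma cvg_wild (T : topologicalType) (F : T -> V) t0 : F @ t0 --> F t0 ->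
  wild (F t) @[t --> t0] --> wild (F t0).
Proof.
move=> Fc; apply: cvg_clamp; apply: cvgB; first exact: cvg_cst.
by apply: cvgM; [exact: cvg_cst|exact: cvg_m3].
Qed.

Lemma norm_m3x mu : `|m3x mu| <= 1.
Proof. by apply: ler_norm_expect (VRm_prob mu) _ => x _; exact: norm_cx_le1. Qed.

Lemma norm_m3y mu : `|m3y mu| <= 1.
Proof. by apply: ler_norm_expect (VRm_prob mu) _ => x _; exact: norm_cy_le1. Qed.

Lemma wtz_le3 z x : wtz z x <= 3.
Proof.
rewrite /wtz /wt; set p := clamp _; have /andP[p0 p1] : 0 <= p <= 1 by exact: clamp_itv.
have k2 : Num.max 0 (cx (cube x) * m3x z.2 + cy (cube x) * m3y z.2) <= 2.
  rewrite ge_max ler0n/= -[leRHS]/(1 + 1); apply: lerD; apply: le_trans (ler_norm _) _;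
    by rewrite normrM mulr_ile1 ?norm_m3x ?norm_m3y ?norm_cx_le1 ?norm_cy_le1.
have : p * Num.max 0 (cx (cube x) * m3x z.2 + cy (cube x) * m3y z.2) <= 1 * 2.
  by apply: ler_pM; rewrite ?le_max ?lexx.
lra.
Qed.

Lemma cvg_tight_num z0 psi : continuous psi -> (forall x, `|psi x| <= 1) ->
  expect (val z.2) (fun x => wtz z x * psi (mvz z x)) @[z --> z0] -->
  expect (val z0.2) (fun x => wtz z0 x * psi (mvz z0 x)).
Proof.
move=> psic psi1.
have sc : (fun z : R * V => z.2) @ z0 --> z0.2 by exact: cvg_snd.
apply: (@cvg_expect _ _ _ _ (fun z : R * V => z.2)
  (fun z x => wtz z x * psi (mvz z x)) z0 3) => //.
  apply: (@filterE _ (nbhs z0) (nbhs_filter z0)) => z x; rewrite normrM -[leRHS]mulr1 ler_pM//.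
  by rewrite ger0_norm ?wtz_le3 ?wtz_ge0.
move=> p _.
have f1 : (fun v : (R * V) * C => v.1) @ (z0, p) --> z0 by exact: cvg_fst.
have f2 : (fun v : (R * V) * C => v.1.2) @ (z0, p) --> z0.2.
  by apply: (@continuous_cvg _ _ _ _ _ (fun v : (R * V) * C => v.1) snd) => //; exact: cvg_snd.
have f3 : (fun v : (R * V) * C => v.1.1) @ (z0, p) --> z0.1.
  by apply: (@continuous_cvg _ _ _ _ _ (fun v : (R * V) * C => v.1) fst) => //; exact: cvg_fst.
have hs : 2 * clamp v.1.1 * tame v.1.2 @[v --> (z0, p)] --> 2 * clamp z0.1 * tame z0.2.
  apply: cvgM; first by apply: cvgM; [exact: cvg_cst|exact: cvg_clamp].
  exact: (@cvg_tame _ (fun v : (R * V) * C => v.1.2)).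
apply: cvg_wt_mv => //.
- exact: cvg_clamp.
- by apply: cvg_clamp; apply: cvgB => //; exact: cvg_cst.
- exact: (@cvg_m3x _ (fun v : (R * V) * C => v.1.2)).
- exact: (@cvg_m3y _ (fun v : (R * V) * C => v.1.2)).
- exact: cvg_snd.
- rewrite clamp_eq0 -ltNge => h; apply: clamp_ge1; lra.
Qed.

Lemma cvg_tight z0 psi : continuous psi -> (forall x, `|psi x| <= 1) ->
  expect (tight z) psi @[z --> z0] --> expect (tight z0) psi.
Proof.
move=> psic psi1; under eq_cvg do rewrite expect_tight; rewrite expect_tight.
apply: cvgM; first exact: cvg_tight_num.
apply: cvgV; first by rewrite gt_eqF ?mass_gt0.
have mE z : mass z = expect (val z.2) (fun x => wtz z x * (fun=> 1) (mvz z x)).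
  by apply: eq_expect => x _; rewrite mulr1.
under eq_cvg do rewrite mE; rewrite mE.
apply: (@cvg_tight_num _ (fun=> 1)); first exact: cst_continuous.
by move=> _; rewrite normr1.
Qed.

Lemma cvg_mx z0 : mx z @[z --> z0] --> mx z0.
Proof. by apply: cvg_tight; [exact: cx_continuous|exact: norm_cx_le1]. Qed.

Lemma cvg_my z0 : my z @[z --> z0] --> my z0.
Proof. by apply: cvg_tight; [exact: cy_continuous|exact: norm_cy_le1]. Qed.

Lemma cvg_chi z0 : chi z @[z --> z0] --> chi z0.
Proof.
apply: cvgM; first by apply: cvg_clamp; exact: cvg_fst.
by apply: (@cvg_wild _ (fun z : R * V => z.2)); exact: cvg_snd.
Qed.

Lemma squeeze_continuous : continuous squeeze.
Proof.
move=> z0; apply: (cvg_VRm (@mdist_lepi R)) => psi psic psi1 /=.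
under eq_cvg do rewrite expect_mix; rewrite expect_mix.
apply: cvgD; last first.
  apply: cvgM; last exact: cvg_tight.
  by apply: cvgB; [exact: cvg_cst|exact: cvg_chi].
(* Where [chi] vanishes, [cen] may be ill-defined; the factor tending to 0 absorbs it, the test
   function being bounded. *)
have [chi0|/chi_neq0 n1] := eqVneq (chi z0) 0.
  rewrite chi0 mul0r; apply: (@cvg0_mul_bounded _ _ _ _ _ _ 1) => //.
  by rewrite -chi0; exact: cvg_chi.
apply: cvgM; first exact: cvg_chi.
apply: (@continuous_cvg _ _ _ _ _ cen psi); first exact: psic.
by apply: (@cvg_dir _ _ _ (nbhs_filter z0)); [exact: norm2_m_neq0|exact: cvg_mx|exact: cvg_my].
Qed.

Lemma squeeze0 mu : squeeze (0, mu) = mu.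
Proof.
apply: VRm_ext => F /=; rewrite expect_mix /chi /= clamp_le0// mul0r mul0r add0r subr0.
rewrite mul1r expect_tight /mass/=.
have w1 x : wtz (0, mu) x = 1.
  by rewrite /wtz /= (clamp_le0 (lexx 0)) mulr0 mul0r clamp_le0// /wt mul0r subr0 addr0.
have m1 x : mvz (0, mu) x = x.
  by rewrite /mvz /= (clamp_le0 (lexx 0)) mulr0 mul0r sub0r clamp_le0 ?lerN10// mv0.
rewrite (@eq_expect _ _ _ (fun x => _ * _) F); last by move=> x _; rewrite w1 m1 mul1r.
rewrite (@eq_expect _ _ _ (wtz _) (fun=> 1)); last by move=> x _; rewrite w1.
by rewrite (expect_cst _ (VRm_prob _)) divr1.
Qed.

End Squeeze.

(** * Normalization of vectors and non-antipodal maps *)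

Section SphereDirection.
Variables (R : realType) (n : nat).
Local Notation S := (set_type (sphere R n)).
Implicit Types (v w : 'rV[R]_n.+1) (x y : S).

Definition normv v : R := Num.sqrt (\sum_i v ord0 i ^+ 2).

Lemma sqr_normv v : normv v ^+ 2 = \sum_i v ord0 i ^+ 2.
Proof. by rewrite sqr_sqrtr// sumr_ge0// => i _; rewrite sqr_ge0. Qed.

Lemma normv_ge0 v : 0 <= normv v. Proof. exact: sqrtr_ge0. Qed.

Lemma normv_eq0 v : (normv v == 0) = (v == 0).
Proof.
rewrite -sqrf_eq0 sqr_normv psumr_eq0; last by move=> i _; rewrite sqr_ge0.
apply/allP/eqP => [h|-> i _]; last by rewrite /= mxE expr0n /= eqxx.
apply/rowP => i; rewrite mxE; apply/eqP; rewrite -sqrf_eq0.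
by apply: h; rewrite mem_index_enum.
Qed.

Lemma normvZ k v : 0 <= k -> normv (k *: v) = k * normv v.
Proof.
move=> k0; apply/eqP; rewrite -(@eqrXn2 _ 2)//; [|exact: normv_ge0|by rewrite mulr_ge0// normv_ge0].
rewrite exprMn !sqr_normv mulr_sumr; apply/eqP; apply: eq_bigr => i _.
by rewrite mxE exprMn.
Qed.

Lemma normv_sphere x : normv (val x) = 1.
Proof. by rewrite /normv; have := set_valP x; rewrite /sphere/= => ->; rewrite sqrtr1. Qed.

Lemma sphere_normalize v : v != 0 -> (normv v)^-1 *: v \in sphere R n.
Proof.
rewrite -normv_eq0 => v0; rewrite inE /sphere/= -sqr_normv.
by rewrite normvZ ?invr_ge0 ?normv_ge0// mulVf// expr1n.
Qed.

Let delta_neq0 : delta_mx ord0 ord0 != 0 :> 'rV[R]_n.+1.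
Proof. by apply/eqP => /rowP/(_ ord0)/eqP; rewrite !mxE eqxx oner_eq0. Qed.

Definition pole : S :=
  @exist _ (fun v => v \in sphere R n) _ (sphere_normalize delta_neq0).

(* The direction of [0] is a junk value. *)
Definition sdir v : S := insubd pole ((normv v)^-1 *: v).

Lemma val_sdir v : v != 0 -> val (sdir v) = (normv v)^-1 *: v.
Proof. by move=> v0; rewrite /sdir insubdK// sphere_normalize. Qed.

Lemma sdir_val x : sdir (val x) = x.
Proof.
apply: val_inj; rewrite val_sdir ?normv_sphere ?invr1 ?scale1r//.
by rewrite -normv_eq0 normv_sphere oner_eq0.
Qed.

Lemma cvg_rV (T : Type) (A : set_system T) {FA : Filter A} (f : T -> 'rV[R]_n.+1) v :
  (forall i, f t ord0 i @[t --> A] --> v ord0 i) -> f @ A --> v.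
Proof.
move=> h; rewrite [v]row_sum_delta; under eq_cvg do rewrite [f _]row_sum_delta.
apply: cvg_big => [|i _]; first exact: add_continuous.
by apply: cvgZ; [exact: h|exact: cvg_cst].
Qed.

Lemma cvg_coord (T : Type) (A : set_system T) {FA : Filter A} (f : T -> 'rV[R]_n.+1) v i :
  f @ A --> v -> f t ord0 i @[t --> A] --> v ord0 i.
Proof.
move=> fv; apply: (@continuous_cvg _ _ _ _ _ f (fun w => w ord0 i)) => //.
exact: coord_continuous.
Qed.

Lemma val_continuous : continuous (val : S -> 'rV[R]_n.+1).
Proof. exact: initial_continuous. Qed.

Lemma cvg_sphere (T : topologicalType) (f : T -> S) t0 :
  val (f t) @[t --> t0] --> val (f t0) -> f @ t0 --> f t0.
Proof.
move=> h U [_ [[W oW <-]] /= Wsfz /filterS]; apply; apply: h.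
exact: open_nbhs_nbhs.
Qed.

Lemma cvg_sdir (T : topologicalType) (f : T -> 'rV[R]_n.+1) t0 : f t0 != 0 ->
  f @ t0 --> f t0 -> sdir (f t) @[t --> t0] --> sdir (f t0).
Proof.
move=> f0 fc.
have nc : normv (f t) @[t --> t0] --> normv (f t0).
  apply: (@continuous_cvg _ _ _ _ _ (fun t => \sum_i f t ord0 i ^+ 2) Num.sqrt).
    exact: sqrt_continuous.
  apply: cvg_big => [|i _]; first exact: add_continuous.
  by apply: cvg_expr; exact: cvg_coord.
have n0 : 0 < normv (f t0) by rewrite lt_neqAle normv_ge0 eq_sym normv_eq0 f0.
apply: (@cvg_sphere _ (fun t => sdir (f t))); rewrite val_sdir//.
apply: (@cvg_trans _ ((normv (f t))^-1 *: f t @[t --> t0])).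
  apply: near_eq_cvg; near=> t; rewrite val_sdir// -normv_eq0 gt_eqF//.
  by near: t; exact: (cvgr_gt _ nc _ n0).
by apply: cvgZ => //; apply: cvgV => //; rewrite gt_eqF.
Unshelve. all: by end_near. Qed.

(** Normalize the segment from [f x] to [x]. If it met 0, comparing the norms of its two terms would
    force equal weights, hence [f x = - x]. *)
Lemma homotopic_not_antipodal (f : S -> S) : continuous f ->
  (forall x, val (f x) <> - val x) -> homotopic R f id.
Proof.
move=> fc fN; pose v (z : R * S) : 'rV[R]_n.+1 :=
  (1 - clamp z.1) *: val (f z.2) + clamp z.1 *: val z.2.
have v0 z : v z != 0.
  apply/eqP => h; apply: (fN z.2).
  have /andP[c0 c1] := clamp_itv z.1.
  have e : (1 - clamp z.1) *: val (f z.2) = clamp z.1 *: - val z.2.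
    by apply/eqP; rewrite scalerN -addr_eq0; apply/eqP.
  have nE : normv (- val z.2) = 1.
    rewrite -(normv_sphere z.2) /normv; congr Num.sqrt; apply: eq_bigr => i _.
    by rewrite mxE sqrrN.
  have := congr1 normv e.
  rewrite normvZ ?subr_ge0// normvZ// nE normv_sphere !mulr1 => cE.
  have cn0 : clamp z.1 != 0.
    by apply/eqP => c00; move/eqP: cE; rewrite c00 subr0 oner_eq0.
  by move: e; rewrite cE => /(scalerI cn0).
exists (fun z => sdir (v z)); split.
- apply: continuous_subspaceT => z; apply: (@cvg_sdir _ v z (v0 z)).
  have c1 : clamp y.1 @[y --> z] --> clamp z.1 by apply: cvg_clamp; exact: cvg_fst.
  apply: cvgD; apply: cvgZ => //.
  + by apply: cvgB => //; exact: cvg_cst.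
  + apply: (@continuous_cvg _ _ _ _ _ (fun y : R * S => f y.2) val).
      exact: val_continuous.
    apply: (@continuous_cvg _ _ _ _ _ (fun y : R * S => y.2) f); first exact: fc.
    exact: cvg_snd.
  + apply: (@continuous_cvg _ _ _ _ _ (fun y : R * S => y.2) val).
      exact: val_continuous.
    exact: cvg_snd.
- by move=> x; rewrite /v/= clamp_le0// subr0 scale1r scale0r addr0 sdir_val.
- by move=> x; rewrite /v/= clamp_ge1// subrr scale1r scale0r add0r sdir_val.
Qed.

End SphereDirection.

(** * Cube roots on the circle and their triangle *)

Section CubeRoots.
Variable R : realType.
Local Notation C := (circle R).
Implicit Types (x y z w u : C) (a b c d t : R).

Let th : R := 2 * pi / 3.

Let cos_th : cos th = - (1 / 2). Proof. exact: cos_2pi3. Qed.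

Let sin_th2 : sin th ^+ 2 = 3 / 4.
Proof. by rewrite sin2cos2 cos_th; field. Qed.

Definition roots z : seq C := [:: z; rot th z; rot (- th) z].

Lemma big_roots (F : C -> R) z :
  \sum_(w <- roots z) F w = F z + F (rot th z) + F (rot (- th) z).
Proof. by rewrite !big_cons big_nil addr0 addrA. Qed.

Lemma rot_2pi t z : rot (t + 2 * pi) z = rot t z.
Proof.
have -> : 2 * pi = pi *+ 2 :> R by rewrite mulr_natl.
by apply: circle_ext; rewrite !(cx_rot, cy_rot) cosD2pi sinD2pi.
Qed.

Lemma roots_rot z w : w \in roots z -> perm_eq (roots w) (roots z).
Proof.
have th2 : rot (th + th) z = rot (- th) z.
  by rewrite -(rot_2pi (- th)); congr rot; rewrite /th; field.
have thN : rot (- th + - th) z = rot th z.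
  by rewrite -(rot_2pi (- th + _)); congr rot; rewrite /th; field.
rewrite !inE => /or3P[]/eqP -> //; rewrite /roots !rotD.
  rewrite th2 addNr rot0; apply/permP => p /=; ring.
rewrite thN subrr rot0; apply/permP => p /=; ring.
Qed.

Lemma mem_roots z w : (w \in roots z) = (cube w == cube z).
Proof.
apply/idP/eqP.
  have c3 k : k \in [:: -1; 1] -> rot (k * th *+ 3) (cube z) = cube z.
    have thE : th *+ 3 = 2 * pi by rewrite /th; field.
    rewrite !inE => /orP[]/eqP ->.
      by rewrite mulN1r mulNrn thE -[RHS]rot0 -(rot_2pi (- _)) addNr.
    by rewrite mul1r thE -[2 * pi]add0r rot_2pi rot0.
  rewrite !inE => /or3P[]/eqP -> //; rewrite cube_rot.
    by rewrite -[th]mul1r c3 ?inE ?eqxx ?orbT.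
  by rewrite -mulN1r c3 ?inE ?eqxx.
have [t /andP[t1 t2] ->] := rot_to z w; rewrite cube_rot => /rot_eq_id c1.
have p0 := @pi_gt0 R; have dp := mdist_lepi z w.
have [|k + tE] := cos_eq1 _ c1.
  by rewrite -[t *+ 3]mulr_natl; apply/andP; split; lra.
have {}tE : t = th * k.
  by move: tE; rewrite -[t *+ 3]mulr_natl /th => tE; lra.
by rewrite tE !inE => /or3P[] /eqP ->; rewrite ?mulr1 ?mulrN1 ?mulr0 ?rot0 eqxx ?orbT.
Qed.

Lemma cbrt_exists u : exists z, cube z = u.
Proof.
have [t _ ->] := rot_to (circle1 R) u.
exists (rot (t / 3) (circle1 R)); rewrite cube_rot.
have -> : cube (circle1 R) = circle1 R.
  have x1 : cx (circle1 R) = 1 by rewrite /cx /= mxE.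
  have y1 : cy (circle1 R) = 0 by rewrite /cy /= mxE.
  by apply: circle_ext; rewrite ?cx_cube ?cy_cube x1 y1; ring.
by congr rot; field.
Qed.

(** An arbitrary choice, with no continuity. It is harmless because [joinm] depends on it only
    through the unordered triple of roots: [expect_joinm] accepts any other root. *)
Definition cbrt u : C := xget u [set z | cube z = u].

Lemma cube_cbrt u : cube (cbrt u) = u.
Proof. by rewrite /cbrt; case: xgetP => // h; have [z zu] := cbrt_exists u; case: (h z). Qed.

Lemma dot_roots x y z : x \in roots z -> y \in roots z -> x = y \/ dot x y = - (1 / 2).
Proof.
move=> xz yz; have : y \in roots x by rewrite (perm_mem (roots_rot xz)).
rewrite !inE => /or3P[]/eqP ->; first (by left); right.
  rewrite -{1}[x]rot0 dot_rot dotuu /cross [cy x * _]mulrC !subrr mul0r subr0 subr0.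
  by rewrite cos_th; ring.
rewrite -{1}[x]rot0 dot_rot dotuu /cross [cy x * _]mulrC !subrr mul0r subr0 subr0.
by rewrite cosN cos_th; ring.
Qed.

Definition proj a b z : R := cx z * a + cy z * b.

Lemma sum_proj a b z : proj a b z + proj a b (rot th z) + proj a b (rot (- th) z) = 0.
Proof.
by rewrite /proj !(cx_rot, cy_rot) cosN sinN cos_th; field.
Qed.

(** The coefficient is 1 for [w = y] and 0 for the two other roots, at inner product -1/2 with [y].
    Being affine in [y], it can be averaged over a measure on the roots, which leaves only the
    barycentre. *)
Lemma roots_frame (F : C -> R) z y : y \in roots z ->
  F y = \sum_(w <- roots z) (1 + 2 * dot y w) / 3 * F w.
Proof.
move=> yz; rewrite -(perm_big _ (roots_rot yz))/= big_roots dotuu.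
have h w : w \in roots y -> w != y -> dot y w = - (1 / 2).
  move=> wy wNy; have [e|//] := dot_roots (mem_head _ _ : y \in roots y) wy.
  by rewrite e eqxx in wNy.
have s2 := sin_th2; have c2 := cos_th.
have d1 : dot y (rot th y) = - (1 / 2).
  rewrite -{1}[y]rot0 dot_rot dotuu /cross [cy y * _]mulrC subrr mul0r subr0 subr0.
  by rewrite c2; ring.
have d2 : dot y (rot (- th) y) = - (1 / 2).
  rewrite -{1}[y]rot0 dot_rot dotuu /cross [cy y * _]mulrC subrr mul0r subr0 subr0.
  by rewrite cosN c2; ring.
by rewrite d1 d2; field.
Qed.

(** The inner products with the roots sum to 0 and their squares to 3/2, so after raising each by
    1/2 the pairwise products sum to 0; hence they cannot all exceed -1/2. *)
Lemma roots_opposite u z : exists2 w, w \in roots z & dot u w <= - (1 / 2).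
Proof.
have s0 : dot u z + dot u (rot th z) + dot u (rot (- th) z) = 0.
  by have := sum_proj (cx u) (cy u) z; rewrite /proj /dot; lra.
have s2 : dot u z ^+ 2 + dot u (rot th z) ^+ 2 + dot u (rot (- th) z) ^+ 2 = 3 / 2.
  have rE t : dot u (rot t z) = dot u z * cos t - cross u z * sin t.
    by rewrite -{1}[u]rot0 dot_rot subr0.
  have := dot2_cross2 u z; have := sin_th2; rewrite !rE cosN sinN cos_th.
  move: (sin th) (dot u z) (cross u z) => s a b s2 ab.
  transitivity (3 / 2 * a ^+ 2 + 2 * b ^+ 2 * s ^+ 2); first by field.
  rewrite s2; lra.
have [h|h] := leP (dot u z) (- (1 / 2)); first by exists z; rewrite ?inE ?eqxx.
have [h'|h'] := leP (dot u (rot th z)) (- (1 / 2)).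
  by exists (rot th z); rewrite ?inE ?eqxx ?orbT.
have [h''|h''] := leP (dot u (rot (- th) z)) (- (1 / 2)).
  by exists (rot (- th) z); rewrite ?inE ?eqxx ?orbT.
move: (dot u z) (dot u (rot th z)) (dot u (rot (- th) z)) s0 s2 h h' h''.
move=> a b c s0 s2 h h' h''.
have p1 : 0 < (a + 1 / 2) * (b + 1 / 2) by apply: mulr_gt0; lra.
have p2 : 0 < (b + 1 / 2) * (c + 1 / 2) by apply: mulr_gt0; lra.
have p3 : 0 < (c + 1 / 2) * (a + 1 / 2) by apply: mulr_gt0; lra.
have : (a + 1 / 2) * (b + 1 / 2) + (b + 1 / 2) * (c + 1 / 2) + (c + 1 / 2) * (a + 1 / 2)
  = (a + b + c) * ((a + b + c) / 2 + 1) - (a ^+ 2 + b ^+ 2 + c ^+ 2) / 2 + 3 / 4 by field.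
rewrite s0 s2 mul0r; move=> h0; lra.
Qed.

(** The gauge of the filled triangle on [roots z]: for [h > 0], [depth a b z <= h] means that
    [(a, b)] divided by [h] has nonnegative barycentric coordinates [coef h a b]. *)
Definition depth a b z : R := Num.max (- 2 * proj a b z)
  (Num.max (- 2 * proj a b (rot th z)) (- 2 * proj a b (rot (- th) z))).

Lemma depth_ge a b z w : w \in roots z -> - 2 * proj a b w <= depth a b z.
Proof. by rewrite !inE => /or3P[]/eqP ->; rewrite /depth !le_max lexx ?orbT. Qed.

Lemma depth_attained a b z : exists2 w, w \in roots z & depth a b z = - 2 * proj a b w.
Proof.
rewrite /depth; case: leP => _; last by exists z; rewrite ?inE ?eqxx.
case: leP => _; first by exists (rot (- th) z); rewrite ?inE ?eqxx ?orbT.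
by exists (rot th z); rewrite ?inE ?eqxx ?orbT.
Qed.

Lemma depth_roots a b z w : w \in roots z -> depth a b w = depth a b z.
Proof.
move=> wz; have mE := perm_mem (roots_rot wz); apply/eqP; rewrite eq_le.
have [x xw xE] := depth_attained a b w; have [y yz yE] := depth_attained a b z.
have h1 : depth a b w <= depth a b z by rewrite xE; apply: depth_ge; rewrite -mE.
by rewrite h1 yE; apply: depth_ge; rewrite mE.
Qed.

End CubeRoots.

(** * Measures parametrized by the join *)

Section Join.
Variable R : realType.
Local Notation C := (circle R).
Implicit Types (x y z w u : C) (a b c d t k : R).

(** The triangle lies in the unit disc, so its gauge dominates the norm. *)
Lemma depth_norm a b z : norm2 a b <= depth a b z.
Proof.
have [n0|n0] := eqVneq (norm2 a b) 0.
  rewrite n0; move/eqP: n0; rewrite norm2_eq0 => /andP[/eqP -> /eqP ->].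
  by have := @depth_ge _ 0 0 z z (mem_head _ _); rewrite /proj !mulr0 addr0 mulr0.
have [w wz dw] := roots_opposite (dir a b) z.
apply: le_trans (depth_ge a b wz).
have n1 : 0 < norm2 a b by rewrite lt_neqAle norm2_ge0 eq_sym n0.
have pE : proj a b w = norm2 a b * dot (dir a b) w.
  rewrite /proj /dot cx_dir// cy_dir//; field; exact: n0.
rewrite pE mulrCA -[leLHS]mulr1 ler_pM2l//; lra.
Qed.

(** The smallest scale at which [(a, b)] fits in the triangle and [(c, d)] in the unit disc;
    dividing by it makes the weights homogeneous of degree 0. *)
Definition height a b c d z : R := Num.max (norm2 c d) (depth a b z).

Definition share a b c d z : R := norm2 c d / height a b c d z.

Definition coef h a b w : R := (h + 2 * proj a b w) / (3 * h).

(* The join [S^3 = S^1 * S^1]: a point of the first circle gives a Dirac mass,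
   and a point of the second one the uniform measure on its cube roots; in
   between, [proj] displaces the barycentre of the latter. *)
Definition joinm a b c d : {fsfun C -> R with 0} :=
  let z := cbrt (dir c d) in
  combination ((1 - share a b c d z, dir a b) ::
    [seq (share a b c d z * coef (height a b c d z) a b w, w) | w <- roots z]).

Lemma height_ge0 a b c d z : 0 <= height a b c d z.
Proof. by rewrite le_max norm2_ge0. Qed.

Lemma height_gt0 a b c d z : (norm2 a b != 0) || (norm2 c d != 0) ->
  0 < height a b c d z.
Proof.
rewrite lt_max => /orP[n|n]; apply/orP; [right|left].
  by apply: lt_le_trans (depth_norm a b z); rewrite lt_neqAle norm2_ge0 eq_sym n.
by rewrite lt_neqAle norm2_ge0 eq_sym n.
Qed.

Lemma share_itv a b c d z : 0 <= share a b c d z <= 1.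
Proof.
rewrite /share divr_ge0 ?norm2_ge0 ?height_ge0//=; have := height_ge0 a b c d z.
rewrite le_eqVlt => /predU1P[<-|h0]; first by rewrite invr0 mulr0.
by rewrite ler_pdivrMr// mul1r le_max lexx.
Qed.

Lemma coef_ge0 a b c d z w : w \in roots z -> 0 <= coef (height a b c d z) a b w.
Proof.
move=> wz; apply: divr_ge0; last by rewrite mulr_ge0 ?height_ge0.
have : depth a b z <= height a b c d z by rewrite le_max lexx orbT.
have := depth_ge a b wz; lra.
Qed.

Lemma coef_sum h a b z : h != 0 -> \sum_(w <- roots z) coef h a b w = 1.
Proof.
move=> h0; rewrite big_roots /coef -!mulrDl.
transitivity ((3 * h + 2 * (proj a b z + proj a b (rot (2 * pi / 3) z) +
  proj a b (rot (- (2 * pi / 3)) z))) / (3 * h)); first by congr (_ / _); ring.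
by rewrite sum_proj mulr0 addr0 divff// mulf_neq0.
Qed.

Lemma expect_joinm a b c d z (F : C -> R) : cube z = dir c d ->
  expect (joinm a b c d) F = (1 - share a b c d z) * F (dir a b) +
    share a b c d z * \sum_(w <- roots z) coef (height a b c d z) a b w * F w.
Proof.
move=> zE; have zr : z \in roots (cbrt (dir c d)) by rewrite mem_roots cube_cbrt zE.
rewrite /joinm /share /height (depth_roots a b zr) expect_combination big_cons big_map.
congr (_ + _); rewrite mulr_sumr (perm_big _ (roots_rot zr)).
by apply: eq_bigr => w _; rewrite mulrA.
Qed.

Lemma VR_measures_joinm a b c d : (norm2 a b != 0) || (norm2 c d != 0) ->
  VR_measures (2 * pi / 3) (joinm a b c d).
Proof.
move=> n0; rewrite /joinm; set z := cbrt _.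
have h0 := height_gt0 z n0; have /andP[s0 s1] := share_itv a b c d z.
set h := height a b c d z in h0 s0 s1 *; set s := share a b c d z in s0 s1 *.
apply: VR_measures_combination.
- move=> p; rewrite inE => /predU1P[->|/mapP[w wz ->]]/=; first by rewrite subr_ge0.
  by rewrite mulr_ge0// coef_ge0.
- rewrite big_cons big_map -mulr_sumr coef_sum ?gt_eqF//=; lra.
(* If [dir a b] and [w] both have mass, [depth] is the larger term of [height], so the scaled
   [(a, b)] lies on a side of the triangle and the opposite vertex [v] has weight 0. The inner
   product of [dir a b] with [v] is at most -1/2 and with the third root at most 1, so the zero sum
   leaves at least -1/2 for [w]. *)
have dc w : w \in roots z -> 1 - s != 0 -> s * coef h a b w != 0 ->
    - (1 / 2) <= dot (dir a b) w.
  move=> wz s1N swN.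
  have nlt : norm2 c d < depth a b z.
    rewrite ltNge; apply: contra s1N => le; rewrite subr_eq0 eq_sym.
    have hE : h = norm2 c d by rewrite /h /height (max_idPl le).
    by rewrite /s /share -/h hE divff// -hE gt_eqF.
  have hE : h = depth a b z by rewrite /h /height (max_idPr (ltW nlt)).
  have nab : norm2 a b != 0.
    apply: contraTneq nlt => n00; move/eqP: (n00); rewrite norm2_eq0.
    move=> /andP[/eqP a0 /eqP b0]; rewrite -leNgt a0 b0 /depth /proj !mulr0 addr0.
    by rewrite mulr0 !maxxx norm2_ge0.
  have n1 : 0 < norm2 a b by rewrite lt_neqAle norm2_ge0 eq_sym nab.
  have [v vz vE] := depth_attained a b z.
  have wv : w != v.
    apply: contraNneq swN => ->; rewrite /coef hE vE.
    by have -> : - 2 * proj a b v + 2 * proj a b v = 0 by [ring]; rewrite mul0r mulr0.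
  have pE y : proj a b y = norm2 a b * dot (dir a b) y.
    rewrite /proj /dot cx_dir// cy_dir//; field; exact: nab.
  have dv : dot (dir a b) v <= - (1 / 2).
    have := depth_norm a b z; rewrite vE pE mulrCA -{1}[norm2 a b]mulr1 ler_pM2l//; lra.
  have vr : v \in roots w by rewrite (perm_mem (roots_rot wz)).
  have := sum_proj a b w.
  move: vr wv; rewrite !inE => /or3P[]/eqP vw; first by rewrite vw eqxx.
    rewrite -vw !pE => _ e; have /andP[_] := dot_itv (dir a b) (rot (- (2 * pi / 3)) w).
    have : dot (dir a b) w + dot (dir a b) v + dot (dir a b) (rot (- (2 * pi / 3)) w) = 0.
      by apply: (mulfI nab); rewrite mulr0 -e; ring.
    lra.
  rewrite -vw !pE => _ e; have /andP[_] := dot_itv (dir a b) (rot (2 * pi / 3) w).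
  have : dot (dir a b) w + dot (dir a b) (rot (2 * pi / 3) w) + dot (dir a b) v = 0.
    by apply: (mulfI nab); rewrite mulr0 -e; ring.
  lra.
move=> p q; rewrite [p \in _]in_cons [q \in _]in_cons mdist_le_2pi3.
move=> /predU1P[->|/mapP[x xz ->]] /predU1P[->|/mapP[y yz ->]]/=.
- by move=> _ _; rewrite dotuu; lra.
- by move=> p1 q1; exact: dc.
- by move=> p1 q1; rewrite dotC; exact: dc.
- by move=> _ _; have [->|->] := dot_roots xz yz; rewrite ?dotuu; lra.
Qed.

(** All ingredients are homogeneous, so [joinm] only sees the ray of [(a, b, c, d)]; this undoes the
    normalization made by [to_sphere]. *)
Lemma joinm_scale k a b c d : 0 < k ->
  joinm (k * a) (k * b) (k * c) (k * d) = joinm a b c d.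
Proof.
move=> k0; have kn0 := lt0r_neq0 k0.
have pE w : proj (k * a) (k * b) w = k * proj a b w by rewrite /proj; ring.
have mE s t : Num.max (k * s) (k * t) = k * Num.max s t by rewrite maxr_pMr// ltW.
have dE z : depth (k * a) (k * b) z = k * depth a b z.
  by rewrite /depth !pE !(mulrCA (-2) k) !mE.
have hE z : height (k * a) (k * b) (k * c) (k * d) z = k * height a b c d z.
  by rewrite /height dE norm2_scale ?mE// ltW.
have sE z : share (k * a) (k * b) (k * c) (k * d) z = share a b c d z.
  by rewrite /share hE (norm2_scale _ _ (ltW k0)) -mulf_div divff// mul1r.
have cE h w : coef (k * h) (k * a) (k * b) w = coef h a b w.
  rewrite /coef pE mulrCA -mulrDr [3 * (k * _)]mulrCA.
  by rewrite -mulf_div divff// mul1r.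
rewrite /joinm !dir_scale// sE; congr (combination (_ :: _)).
by apply: eq_map => w; rewrite hE cE.
Qed.

End Join.

(** * Continuity of the join parametrization *)

Section JoinContinuity.
Variable R : realType.
Local Notation C := (circle R).
Implicit Types (x y z w u : C) (a b c d : R).

Lemma coef_mean_le1 a b c d z (psi : C -> R) : (forall x, `|psi x| <= 1) ->
  `|\sum_(w <- roots z) coef (height a b c d z) a b w * psi w| <= 1.
Proof.
move=> psi1; apply: (le_trans (ler_norm_sum _ _ _)).
apply: (@le_trans _ _ (\sum_(w <- roots z) coef (height a b c d z) a b w)).
  rewrite big_seq [leRHS]big_seq; apply: ler_sum => w wz.
  by rewrite normrM ger0_norm ?coef_ge0// ler_piMr// coef_ge0.
have [h0|h0] := eqVneq (height a b c d z) 0; last by rewrite coef_sum.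
by rewrite big1// => w _; rewrite /coef h0 mulr0 invr0 mulr0.
Qed.

Section Limits.
Context (T : Type) (A : set_system T) {FA : Filter A}.
Variables (fa fb fc fd : T -> R) (a b c d : R).
Hypotheses (ha : fa @ A --> a) (hb : fb @ A --> b) (hc : fc @ A --> c) (hd : fd @ A --> d).

Lemma near_norm2_gt0 (f g : T -> R) (x y : R) : f @ A --> x -> g @ A --> y ->
  norm2 x y != 0 -> \forall t \near A, 0 < norm2 (f t) (g t).
Proof.
move=> fx gy n0; have n1 : 0 < norm2 x y by rewrite lt_neqAle norm2_ge0 eq_sym n0.
exact: (cvgr_gt _ (cvg_norm2 fx gy) _ n1).
Qed.

Let cvg_proj (F : T -> C) z : F @ A --> z -> proj (fa t) (fb t) (F t) @[t --> A] --> proj a b z.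
Proof.
by move=> Fz; apply: cvgD; apply: cvgM => //; [exact: cvg_cx|exact: cvg_cy].
Qed.

Let cvg_roots (F : T -> C) z (k : R) : F @ A --> z -> rot k (F t) @[t --> A] --> rot k z.
Proof. by move=> Fz; apply: cvg_rot => //; exact: cvg_cst. Qed.

Let cvg_height (F : T -> C) z : F @ A --> z ->
  height (fa t) (fb t) (fc t) (fd t) (F t) @[t --> A] --> height a b c d z.
Proof.
move=> Fz; apply: cvg_max; first exact: cvg_norm2.
apply: cvg_max; first by apply: cvgM; [exact: cvg_cst|exact: cvg_proj].
by apply: cvg_max; (apply: cvgM; [exact: cvg_cst|apply: cvg_proj; exact: cvg_roots]).
Qed.

Let cvg_coef (h : T -> R) h0 (F : T -> C) z : h0 != 0 -> h @ A --> h0 -> F @ A --> z ->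
  coef (h t) (fa t) (fb t) (F t) @[t --> A] --> coef h0 a b z.
Proof.
move=> hn0 hh Fz; apply: cvgM.
  by apply: cvgD => //; apply: cvgM; [exact: cvg_cst|exact: cvg_proj].
apply: cvgV; first by rewrite mulf_neq0.
by apply: cvgM => //; exact: cvg_cst.
Qed.

Variable psi : C -> R.
Hypotheses (psic : continuous psi) (psi1 : forall x, `|psi x| <= 1).

Let cvg_psi (F : T -> C) z : F @ A --> z -> psi (F t) @[t --> A] --> psi z.
Proof. by move=> Fz; apply: (@continuous_cvg _ _ _ _ _ F psi) => //; exact: psic. Qed.

(** The roots may jump here, but their total weight [share] tends to 0: near the limit it is at most
    [norm2 / norm2] of [(c, d)] over [(a, b)], by [depth_norm]. *)
Let cvg_joinm_first : norm2 a b != 0 -> norm2 c d = 0 ->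
  expect (joinm (fa t) (fb t) (fc t) (fd t)) psi @[t --> A] --> expect (joinm a b c d) psi.
Proof.
move=> nab ncd.
under eq_cvg do rewrite (expect_joinm _ _ _ (cube_cbrt _)).
rewrite (expect_joinm _ _ _ (cube_cbrt _)).
pose z t := cbrt (dir (fc t) (fd t)).
have s0 : share a b c d (cbrt (dir c d)) = 0 by rewrite /share ncd mul0r.
have sc : share (fa t) (fb t) (fc t) (fd t) (z t) @[t --> A] --> (0 : R).
  apply: (@squeeze_cvgr _ _ _ _ (fun=> 0)
    (fun t => norm2 (fc t) (fd t) / norm2 (fa t) (fb t))); last 2 first.
  - exact: cvg_cst.
  - suff : norm2 (fc t) (fd t) / norm2 (fa t) (fb t) @[t --> A] --> norm2 c d / norm2 a b.
      by rewrite ncd mul0r.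
    apply: cvgM; first exact: cvg_norm2.
    by apply: cvgV => //; exact: cvg_norm2.
  near=> t; have := share_itv (fa t) (fb t) (fc t) (fd t) (z t) => /andP[-> _] /=.
  have n1 : 0 < norm2 (fa t) (fb t) by near: t; exact: near_norm2_gt0 nab.
  rewrite ler_wpM2l ?norm2_ge0// lef_pV2 ?posrE//.
    by rewrite (le_trans (depth_norm _ _ (z t)))// le_max lexx orbT.
  by apply: height_gt0; rewrite gt_eqF.
rewrite s0 mul0r; apply: cvgD; last first.
  by apply: (@cvg0_mul_bounded _ _ _ FA _ _ 1) => // t; exact: coef_mean_le1.
apply: cvgM; first by apply: cvgB => //; exact: cvg_cst.
by apply: cvg_psi; exact: cvg_dir.
Unshelve. all: by end_near. Qed.

(* Near [(c, d) <> 0] the cube roots of [dir c d] can be chosen continuously. *)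
Let cvg_joinm_second : norm2 c d != 0 ->
  expect (joinm (fa t) (fb t) (fc t) (fd t)) psi @[t --> A] --> expect (joinm a b c d) psi.
Proof.
move=> ncd; have n1 : 0 < norm2 c d by rewrite lt_neqAle norm2_ge0 eq_sym ncd.
pose u := dir c d; pose z0 := cbrt u.
pose z t := rot (angto u (fc t) (fd t) / 3) z0.
have uE : cx u * c + cy u * d = norm2 c d.
  rewrite cx_dir// cy_dir//; apply: (mulfI ncd); rewrite -[RHS]expr2 sqr_norm2; field.
  exact: ncd.
have ang0 : angto u c d = 0.
  rewrite /angto (_ : cx u * d - cy u * c = 0) ?mul0r ?atan0//.
  rewrite cx_dir// cy_dir//; field; exact: ncd.
have zc : z @ A --> z0.
  rewrite -[z0]rot0 -(mul0r (3^-1 : R)) -ang0; apply: cvg_rot; last exact: cvg_cst.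
  apply: cvgM; last exact: cvg_cst.
  by apply: cvg_angto => //; [exact: cvg_cst|rewrite uE].
have zE : \forall t \near A, cube (z t) = dir (fc t) (fd t).
  have dc : cx u * fc t + cy u * fd t @[t --> A] --> norm2 c d.
    by rewrite -uE; apply: cvgD; apply: cvgM => //; exact: cvg_cst.
  near=> t; rewrite cube_rot cube_cbrt -(@rot_angto _ u).
    by congr rot; field.
  by near: t; exact: (cvgr_gt _ dc _ n1).
have h0 : 0 < height a b c d z0 by apply: height_gt0; rewrite ncd orbT.
apply: (@cvg_trans _ (((1 - share (fa t) (fb t) (fc t) (fd t) (z t)) * psi (dir (fa t) (fb t))
  + share (fa t) (fb t) (fc t) (fd t) (z t) * \sum_(w <- roots (z t))
    coef (height (fa t) (fb t) (fc t) (fd t) (z t)) (fa t) (fb t) w * psi w) @[t --> A])).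
  apply: near_eq_cvg; near=> t; rewrite (@expect_joinm _ _ _ _ _ (z t))//.
  by near: t.
rewrite (expect_joinm _ _ _ (cube_cbrt _)).
have hc' := cvg_height zc.
have sc : share (fa t) (fb t) (fc t) (fd t) (z t) @[t --> A] --> share a b c d z0.
  apply: cvgM; first exact: cvg_norm2.
  by apply: cvgV => //; exact: lt0r_neq0.
apply: cvgD; last first.
  apply: cvgM => //; under eq_cvg do rewrite big_roots; rewrite big_roots.
  have hn0 := lt0r_neq0 h0.
  by apply: cvgD; [apply: cvgD|]; (apply: cvgM; [apply: cvg_coef|apply: cvg_psi]) => //;
    exact: cvg_roots.
(* At [(a, b) = 0] the direction [dir a b] may jump, but its weight [1 - share] tends to 0. *)
have [nab|nab] := eqVneq (norm2 a b) 0; last first.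
  apply: cvgM; first by apply: cvgB => //; exact: cvg_cst.
  by apply: cvg_psi; exact: cvg_dir.
have s1 : 1 - share a b c d z0 = 0.
  move/eqP: (nab); rewrite norm2_eq0 => /andP[/eqP a0 /eqP b0].
  rewrite /share /height a0 b0 /depth /proj !mulr0 addr0 mulr0 !maxxx.
  by rewrite (max_idPl (norm2_ge0 _ _)) divff// subrr.
rewrite -/u -/z0 s1 mul0r; apply: (@cvg0_mul_bounded _ _ _ FA _ _ 1) => //.
by rewrite -s1; apply: cvgB => //; exact: cvg_cst.
Unshelve. all: by end_near. Qed.

Lemma cvg_joinm : (norm2 a b != 0) || (norm2 c d != 0) ->
  expect (joinm (fa t) (fb t) (fc t) (fd t)) psi @[t --> A] --> expect (joinm a b c d) psi.
Proof.
have [ncd|ncd _] := eqVneq (norm2 c d) 0; last exact: cvg_joinm_second.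
by rewrite orbF => nab; exact: cvg_joinm_first.
Qed.

End Limits.
End JoinContinuity.

Lemma cvg_pair_nbhs (T U W : topologicalType) (f : T -> U) (g : T -> W) (t : T) (u : U) (w : W) :
  f @ t --> u -> g @ t --> w -> (f x, g x) @[x --> t] --> (u, w).
Proof. exact: cvg_pair. Qed.

(** * The equivalence with the 3-sphere *)

Section CriticalScale.
Variable R : realType.
Local Notation C := (circle R).
Local Notation V := (VRm C (2 * pi / 3)).
Local Notation S3 := (set_type (sphere R 3)).
Implicit Types (mu : V) (x y u : C) (s : S3).

Definition row4 (a b c d : R) : 'rV[R]_4 := \row_i nth 0 [:: a; b; c; d] i.

Definition co (k : nat) (s : S3) : R := val s ord0 (inord k).

Lemma row4_val s : row4 (co 0 s) (co 1 s) (co 2 s) (co 3 s) = val s.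
Proof.
apply/rowP => i; rewrite mxE /co -[in RHS](inord_val i).
by case: i => [[|[|[|[|//]]]]].
Qed.

Lemma row4_neq0 a b c d : (row4 a b c d != 0) = (norm2 a b != 0) || (norm2 c d != 0).
Proof.
rewrite !norm2_eq0 -negb_and; congr negb; apply/eqP/andP => [/rowP h|].
  have h0 := h (inord 0); have h1 := h (inord 1); have h2 := h (inord 2).
  have h3 := h (inord 3); rewrite !mxE !inordK//= in h0 h1 h2 h3.
  by rewrite h0 h1 h2 h3 eqxx.
move=> [/andP[/eqP -> /eqP ->] /andP[/eqP -> /eqP ->]]; apply/rowP => i.
by rewrite !mxE; case: i => [[|[|[|[|//]]]]].
Qed.

Lemma co_sdir (a b c d : R) (v := row4 a b c d) : v != 0 ->
  [/\ co 0 (sdir v) = (normv v)^-1 * a, co 1 (sdir v) = (normv v)^-1 * b,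
      co 2 (sdir v) = (normv v)^-1 * c & co 3 (sdir v) = (normv v)^-1 * d].
Proof. by move=> v0; rewrite /co val_sdir// !mxE !inordK. Qed.

Lemma co_neq0 s : (norm2 (co 0 s) (co 1 s) != 0) || (norm2 (co 2 s) (co 3 s) != 0).
Proof. by rewrite -row4_neq0 row4_val -normv_eq0 normv_sphere oner_eq0. Qed.

Definition of_sphere s : V := mkVR (VR_measures_joinm (co_neq0 s)).

Lemma cvg_co (k : nat) s : co k t @[t --> s] --> co k s.
Proof. by apply: (@cvg_coord _ _ _ _ (nbhs_filter s)); exact: val_continuous. Qed.

Lemma of_sphere_continuous : continuous of_sphere.
Proof.
move=> s; apply: (cvg_VRm (@mdist_lepi R)) => psi psic psi1 /=.
by apply: (@cvg_joinm _ _ _ (nbhs_filter s)) => //; [exact: cvg_co..|exact: co_neq0].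
Qed.

Definition m3dir mu : C := dir (m3x mu) (m3y mu).

(** Scaled so that [height] is 1 whenever [wild mu < 1], by [height_join]; then [share] is exactly
    the fraction [1 - wild mu] not transferred. *)
Definition join_row mu : 'rV[R]_4 :=
  row4 (mx (1, mu)) (my (1, mu)) ((1 - wild mu) * cx (m3dir mu)) ((1 - wild mu) * cy (m3dir mu)).

Lemma norm2_circle x : norm2 (cx x) (cy x) = 1.
Proof. by rewrite /norm2 circleE sqrtr1. Qed.

Lemma wild_itv mu : 0 <= wild mu <= 1. Proof. exact: clamp_itv. Qed.

Lemma norm2_wild mu :
  norm2 ((1 - wild mu) * cx (m3dir mu)) ((1 - wild mu) * cy (m3dir mu)) = 1 - wild mu.
Proof.
have /andP[_ w1] := wild_itv mu.
by rewrite norm2_scale ?subr_ge0// norm2_circle mulr1.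
Qed.

Lemma join_row_neq0 mu : join_row mu != 0.
Proof.
rewrite row4_neq0 norm2_wild subr_eq0; have [w1|_] := eqVneq 1 (wild mu).
  by rewrite norm2_m_neq0//; apply: wild_neq0; rewrite -w1 oner_neq0.
by rewrite orbT.
Qed.

Definition to_sphere mu : S3 := sdir (join_row mu).

Lemma cvg_mx1 (T : topologicalType) (F : T -> V) t0 : F @ t0 --> F t0 ->
  mx (1, F t) @[t --> t0] --> mx (1, F t0).
Proof.
move=> Fc; apply: (@continuous_cvg _ _ _ _ _ (fun t : T => (1, F t) : R * V) (@mx R)).
  exact: cvg_mx.
by apply: cvg_pair_nbhs => //; exact: cvg_cst.
Qed.

Lemma cvg_my1 (T : topologicalType) (F : T -> V) t0 : F @ t0 --> F t0 ->
  my (1, F t) @[t --> t0] --> my (1, F t0).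
Proof.
move=> Fc; apply: (@continuous_cvg _ _ _ _ _ (fun t : T => (1, F t) : R * V) (@my R)).
  exact: cvg_my.
by apply: cvg_pair_nbhs => //; exact: cvg_cst.
Qed.

(** At [m3 = 0] the direction [m3dir] is junk, but the factor [1 - wild] vanishes there. *)
Lemma cvg_wild_mul (T : topologicalType) (F : T -> V) t0 (h : C -> R) :
  F @ t0 --> F t0 -> continuous h -> (forall x, `|h x| <= 1) ->
  (1 - wild (F t)) * h (m3dir (F t)) @[t --> t0] --> (1 - wild (F t0)) * h (m3dir (F t0)).
Proof.
move=> Fc hc h1; have wc : 1 - wild (F t) @[t --> t0] --> 1 - wild (F t0).
  by apply: cvgB; [exact: cvg_cst|exact: cvg_wild].
have [n0|n0] := eqVneq (m3 (F t0)) 0.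
  have w0 : 1 - wild (F t0) = 0.
    by rewrite /wild n0 mulr0 subr0 clamp_ge1 ?subrr// ler1n.
  rewrite w0 mul0r; apply: (@cvg0_mul_bounded _ _ _ _ _ _ 1) => //.
  by rewrite -w0.
apply: cvgM => //; apply: (@continuous_cvg _ _ _ _ _ (fun t => m3dir (F t)) h).
  exact: hc.
by apply: cvg_dir n0 _ _; [exact: cvg_m3x|exact: cvg_m3y].
Qed.

Lemma to_sphere_continuous : continuous to_sphere.
Proof.
move=> mu; have idc : (fun nu : V => nu) @ mu --> mu by exact: cvg_id.
apply: cvg_sdir; first exact: join_row_neq0.
apply: (@cvg_rV _ _ _ _ (nbhs_filter mu)) => i; rewrite /join_row.
under eq_cvg do rewrite mxE; rewrite mxE.
case: i => [[|[|[|[|//]]]] /= _].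
- exact: (cvg_mx1 idc).
- exact: (cvg_my1 idc).
- exact: (cvg_wild_mul idc (@cx_continuous R) (@norm_cx_le1 R)).
- exact: (cvg_wild_mul idc (@cy_continuous R) (@norm_cy_le1 R)).
Qed.

Lemma tame_wild mu : wild mu < 1 -> [/\ 1 / 2 < m3 mu, tame mu = 1 &
  forall x, (wtz (1, mu) x = Num.max 0 (cx (cube x) * m3x mu + cy (cube x) * m3y mu)) /\
            mvz (1, mu) x = mv 1 (m3x mu) (m3y mu) x].
Proof.
move=> w1; have n2 : 1 / 2 < m3 mu.
  rewrite ltNge; apply/negP => h; have : wild mu = 1 by apply: clamp_ge1; lra.
  by move=> e; rewrite e ltxx in w1.
have t1 : tame mu = 1 by apply: clamp_ge1; lra.
split=> // x; rewrite /wtz /mvz /= t1 clamp_ge1// !mulr1 !clamp_ge1; [|lra..].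
by rewrite /wt subrr add0r mul1r.
Qed.

Lemma tight1_roots mu y : wild mu < 1 -> y \in finsupp (tight (1, mu)) ->
  cube y = m3dir mu.
Proof.
move=> /tame_wild[_ _ wm] /finsupp_tight[x [_ /= wx <-]]; have [wE ->] := wm x.
apply: cube_mv1; move: wx; rewrite wE; case: ltP => //.
by rewrite eqxx.
Qed.

(** The tightened measure sits on [roots z]; integrating [roots_frame] recovers its three weights
    from its barycentre. *)
Lemma expect_tight1 mu z (F : C -> R) : wild mu < 1 -> cube z = m3dir mu ->
  expect (tight (1, mu)) F =
  \sum_(w <- roots z) (1 + 2 * proj (mx (1, mu)) (my (1, mu)) w) / 3 * F w.
Proof.
move=> w1 zE; have rP y : y \in finsupp (tight (1, mu)) -> y \in roots z.
  by move=> /(tight1_roots w1) yE; rewrite mem_roots zE yE.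
rewrite (@eq_expect _ _ _ F (fun y => \sum_(w <- roots z) (1 + 2 * dot y w) / 3 * F w)).
  rewrite /expect; under eq_bigr do rewrite mulr_sumr.
  rewrite exchange_big/=; apply: eq_bigr => w _.
  transitivity (expect (tight (1, mu)) (fun y => F w / 3 * (1 + 2 * dot w y))).
    by apply: eq_bigr => y _; rewrite (dotC y w); ring.
  rewrite expectZ expectD (expect_cst _ (tight_prob _)) expectZ expectD !expectZ.
  by rewrite /proj -/(mx _) -/(my _); ring.
by move=> y /rP yz; exact: roots_frame.
Qed.

(** The barycentre lies in the triangle, so [depth] is at most 1. If [wild mu = 0] the first term is
    1. Otherwise [m3 mu < 1], so the tightened measure lies in an arc and misses one root; its
    barycentre is then on the opposite side, where [depth] is 1. *)
Lemma height_join mu z : wild mu < 1 -> cube z = m3dir mu ->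
  Num.max (1 - wild mu) (depth (mx (1, mu)) (my (1, mu)) z) = 1.
Proof.
move=> w1 zE; set a := mx _; set b := my _.
have Pt := tight_prob (1, mu); have [t0 _] := Pt.
have rP y : y \in finsupp (tight (1, mu)) -> y \in roots z.
  by move=> /(tight1_roots w1) yE; rewrite mem_roots zE yE.
have pE w : expect (tight (1, mu)) (dot w) = proj a b w by rewrite expectD !expectZ.
have depth1 : depth a b z <= 1.
  have [w wz ->] := depth_attained a b z.
  suff : - (1 / 2) <= proj a b w by lra.
  rewrite -pE -[leLHS](expect_cst _ Pt); apply: le_expect => // y /rP yz.
  by have [->|->] := dot_roots wz yz; rewrite ?dotuu; lra.
have [w0|w0] := eqVneq (wild mu) 0; first by rewrite w0 subr0; exact/max_idPl.
suff -> : depth a b z = 1.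
  by apply/max_idPr; have /andP[? _] := wild_itv mu; lra.
apply/eqP; rewrite eq_le depth1/=.
have n1 : m3 (1 : R, mu).2 < 1 by exact: wild_neq0.
have [u [q [q2 uq]]] := tight_arc n1.
have [/allP h|/allPn[w wz wN]] := boolP (all (mem (finsupp (tight (1, mu)))) (roots z)).
  have := sum_proj (cx u) (cy u) z.
  have := uq _ (h z (mem_head _ _)).
  have := uq (rot (2 * pi / 3) z) (h _ _).
  rewrite !inE eqxx orbT => /(_ isT).
  have := uq (rot (- (2 * pi / 3)) z) (h _ _).
  rewrite !inE eqxx !orbT => /(_ isT).
  rewrite /dot /proj; lra.
apply: le_trans (depth_ge a b wz).
suff -> : proj a b w = - (1 / 2) by lra.
rewrite -pE -[RHS](expect_cst _ Pt); apply: eq_expect => y ym.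
have [wy|//] := dot_roots wz (rP y ym); by case/negP: wN; rewrite wy; exact: ym.
Qed.

(** When [wild mu = 1] both measures are the Dirac mass at [cen]; otherwise [height] is 1, and
    [share] and [coef] give back the weights of the squeezed measure. *)
Lemma of_to_sphere mu : of_sphere (to_sphere mu) = squeeze (1, mu).
Proof.
apply: VRm_ext => F /=; have v0 := join_row_neq0 mu.
have [-> -> -> ->] := co_sdir v0; rewrite joinm_scale; last first.
  by rewrite invr_gt0 lt_neqAle normv_ge0 eq_sym normv_eq0 v0.
set a := mx _; set b := my _; have /andP[_ w1] := wild_itv mu.
rewrite expect_mix -/(cen _) /chi /= clamp_ge1// mul1r.
have [wE|wN] := eqVneq (wild mu) 1.
  rewrite (expect_joinm _ _ _ (cube_cbrt _)) /share norm2_wild wE subrr !mul0r.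
  by rewrite subr0 mul1r.
have {}w1 : wild mu < 1 by rewrite lt_neqAle wN w1.
have dE : dir ((1 - wild mu) * cx (m3dir mu)) ((1 - wild mu) * cy (m3dir mu)) = m3dir mu.
  by rewrite dir_scale ?subr_gt0// dir_circle.
have zE := cube_cbrt (m3dir mu); set z := cbrt _ in zE.
rewrite (@expect_joinm _ _ _ _ _ z); last by rewrite dE.
rewrite /share /height norm2_wild height_join// divr1.
have -> : 1 - (1 - wild mu) = wild mu by ring.
congr (_ + _ * _); rewrite (expect_tight1 _ w1 zE); apply: eq_bigr => w _.
by rewrite /coef mulr1.
Qed.

(** Suppose the image is the antipode of [s]. If [(c, d) = 0], the measure is a Dirac mass, so
    [wild] is 0 and the last two coordinates of the image cannot both vanish. Otherwise the mean
    cube points opposite to [dir c d] and the new barycentre opposite to [(a, b)], while tightening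
    turns [dir a b] by less than a right angle. *)
Lemma to_of_sphere s : val (to_sphere (of_sphere s)) <> - val s.
Proof.
set mu := of_sphere s => e; have v0 := join_row_neq0 mu.
pose l := (normv (join_row mu))^-1.
have l0 : 0 < l by rewrite invr_gt0 lt_neqAle normv_ge0 eq_sym normv_eq0 v0.
have coN k : co k (to_sphere mu) = - co k s by rewrite /co e mxE.
have [/esym e0 /esym e1 /esym e2 /esym e3] := co_sdir v0; rewrite -/l !coN in e0 e1 e2 e3.
set a := co 0 s in e0; set b := co 1 s in e1; set c := co 2 s in e2; set d := co 3 s in e3.
have [ncd|ncd] := eqVneq (norm2 c d) 0.
  have E F : expect (val mu) F = F (dir a b).
    by rewrite /= (expect_joinm _ _ _ (cube_cbrt _)) /share ncd !mul0r subr0 mul1r addr0.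
  have n1 : m3 mu = 1 by rewrite /m3 /m3x /m3y !E norm2_circle.
  have w0 : wild mu = 0 by rewrite /wild n1 clamp_le0//; lra.
  move/eqP: ncd; rewrite norm2_eq0 => /andP[/eqP c0 /eqP d0].
  move: e2 e3; rewrite w0 c0 d0 subr0 !mul1r oppr0 => /eqP + /eqP.
  rewrite !mulf_eq0 (gt_eqF l0)/= => /eqP h1 /eqP h2.
  by have /eqP := circleE (m3dir mu); rewrite h1 h2 expr0n addr0 eq_sym oner_eq0.
have /andP[_ w1] := wild_itv mu.
have wN : wild mu != 1.
  apply: contraNneq ncd => wE; rewrite norm2_eq0 -oppr_eq0 -[d == 0]oppr_eq0 -e2 -e3.
  by rewrite wE subrr !mul0r mulr0 eqxx.
have {}w1 : wild mu < 1 by rewrite lt_neqAle wN w1.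
have [n2 _ wm] := tame_wild w1.
have n0 : m3 mu != 0 by rewrite gt_eqF//; lra.
have k0 : 0 < l * (1 - wild mu) by rewrite mulr_gt0 ?subr_gt0.
have uE : dir c d = dir (- cx (m3dir mu)) (- cy (m3dir mu)).
  rewrite -[RHS](dir_scale _ _ k0); congr dir; first by rewrite mulrN -mulrA e2 opprK.
  by rewrite mulrN -mulrA e3 opprK.
have nN : norm2 (- cx (m3dir mu)) (- cy (m3dir mu)) = 1.
  by rewrite -[RHS](norm2_circle (m3dir mu)) /norm2 !sqrrN.
have ux : cx (dir c d) = - cx (m3dir mu) by rewrite uE cx_dir nN ?oner_neq0// divr1.
have uy : cy (dir c d) = - cy (m3dir mu) by rewrite uE cy_dir nN ?oner_neq0// divr1.
have mxE' : m3x mu = m3 mu * cx (m3dir mu) by rewrite cx_dir// mulrC divfK.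
have myE' : m3y mu = m3 mu * cy (m3dir mu) by rewrite cy_dir// mulrC divfK.
(* The cube roots of [dir c d] lose all their weight, hence [tight] moves
   [dir a b] only, and to a point of its open half-circle. *)
have supp y : y \in finsupp (tight (1, mu)) -> y = mvz (1, mu) (dir a b).
  move=> /finsupp_tight[x [xm wx <-]]; congr (mvz _ _).
  have [p] := finsupp_combination xm; rewrite in_cons => /predU1P[-> [_ <-//]|].
  move=> /mapP[w]; rewrite mem_roots cube_cbrt => /eqP wE -> [_ /= wx'].
  case/eqP: wx; rewrite (wm x).1 -wx' wE ux uy mxE' myE'; apply/max_idPl.
  have -> : - cx (m3dir mu) * (m3 mu * cx (m3dir mu)) + - cy (m3dir mu) * (m3 mu * cy (m3dir mu))
    = - (m3 mu * (cx (m3dir mu) ^+ 2 + cy (m3dir mu) ^+ 2)) by ring.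
  by rewrite circleE mulr1 oppr_le0 m3_ge0.
set y := mvz (1, mu) (dir a b) in supp.
have E F : expect (tight (1, mu)) F = F y.
  rewrite -[RHS](expect_cst _ (tight_prob (1, mu))); apply: eq_expect => x /supp ->.
  by [].
have dy : 0 < dot (dir a b) y.
  by apply: dot_mv_arc; [rewrite dotuu; lra|exact: clamp_itv].
rewrite /mx /my !E in e0 e1.
have nab : norm2 a b = l.
  by rewrite -[RHS]mulr1 -(norm2_circle y) -norm2_scale ?ltW// e0 e1 /norm2 !sqrrN.
have nab0 : norm2 a b != 0 by rewrite nab gt_eqF.
have : l * dot (dir a b) y < 0.
  rewrite /dot cx_dir// cy_dir// mulrDr !(mulrCA l) e0 e1 !mulrN -opprD oppr_lt0.
  have -> : a / norm2 a b * a + b / norm2 a b * b = (a ^+ 2 + b ^+ 2) / norm2 a b by field.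
  by rewrite -sqr_norm2 expr2 mulfK// nab.
by rewrite pmulr_rlt0// ltNge (ltW dy).
Qed.

Lemma critical_equivalence : homotopy_equivalent R V S3.
Proof.
exists to_sphere, of_sphere; split.
- exact: to_sphere_continuous.
- exact: of_sphere_continuous.
(* [squeeze] starts from the identity, so its time is reversed. *)
- exists (fun z => squeeze (1 - z.1, z.2)); split.
  + apply: continuous_subspaceT => z.
    apply: (@continuous_cvg _ _ _ _ _ (fun z : R * V => (1 - z.1, z.2)) (@squeeze R)).
      exact: squeeze_continuous.
    apply: cvg_pair_nbhs; last exact: cvg_snd.
    by apply: cvgB; [exact: cvg_cst|exact: cvg_fst].
  + by move=> mu; rewrite /= subr0 of_to_sphere.
  + by move=> mu; rewrite /= subrr squeeze0.
- apply: homotopic_not_antipodal.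
    move=> s; apply: continuous_comp; first exact: of_sphere_continuous.
    exact: to_sphere_continuous.
  exact: to_of_sphere.
Qed.

End CriticalScale.

Theorem mainTheorem6 (R : realType) :
  (forall r : R, 0 <= r -> r < 2 * pi / 3 ->
    homotopy_equivalent R (VRm (circle R) r) (circle R)) /\
  homotopy_equivalent R (VRm (circle R) (2 * pi / 3)) (set_type (sphere R 3)).
Proof.
split; last exact: critical_equivalence.
by move=> r r0 r1; exact: subcritical_equivalence.
Qed.
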